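(* Let $1<p<Q$, let $f\in L^m(\Omega)$ with $p_*=\frac{pQ}{Q(p-1)+p}\leq m<\frac{Q}{p}$, and let $u\in W^{1,p}_0(\Omega,X)$ be a weak solution to $$X^*a(x,u,Xu)=f(x)\ \text{ in }\Omega,\qquad u=0\ \text{ on }\partial\Omega.$$ Then $u\in L^s(\Omega)$ with $$s=\frac{m(p-1)Q}{Q-mp}=[m^*(p-1)]^*,$$ and there exists a constant $C=C(Q,p,\Omega,\alpha,m,X)$ such that $$\|u\|_{L^s(\Omega)}\leq C\,\|f\|_{L^m(\Omega)}^{\frac1{p-1}}.$$
   Context: Setting. $\Omega$ is a bounded open subset of $\mathbb{R}^N$, $N\geq2$. $X=\{X_1,\dots,X_d\}$, $d\geq2$, is a family of locally Lipschitz-continuous vector fields on $\mathbb{R}^N$, $X_j=(c_{j1},\dots,c_{jN})$, identified with the operators $X_j=\sum_{k=1}^N c_{jk}\partial_{x_k}$. For a $C^1$ function $u$, the $X$-gradient is $Xu=(X_1u,\dots,X_du)=C(x)\nabla u$ with $C(x)=(c_{jk}(x))$. Geometric standing assumptions. An absolutely continuous path $\gamma:[0,T]\to\mathbb{R}^N$ is $X$-subunit if $\dot\gamma(t)=\sum_{j=1}^d\theta_j(t)X_j(\gamma(t))$ with $\sum_{j=1}^d\theta_j^2(t)\leq1$ for a.e. $t\in[0,T]$. Any two points are assumed to be connected by an $X$-subunit path, and the Carnot–Carathéodory (control) distance $\delta(x,y)$ is the infimum of the $T>0$ for which there is an $X$-subunit path $\gamma:[0,T]\to\mathbb{R}^N$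 with $\gamma(0)=x$, $\gamma(T)=y$. $B_r$ denotes a $\delta$-ball of radius $r$; $B_{\lambda r}$ is the concentric ball of radius $\lambda r$; $|E|$ is the Lebesgue measure of $E$. It is assumed that: (1) $|y-x|\to0$ if and only if $\delta(x,y)\to0$; (2) (doubling) there is a constant $Q$, which is fixed and taken $>2$ (as one may, without loss of generality), such that $0<|B_{2r}|\leq2^Q|B_r|$ for every $\delta$-ball $B_r$; (3) (Poincaré) there are constants $C_P,\nu>0$ such that for every $\delta$-ball $B_r$ and every $u\in C^1(\overline{B_{\nu r}})$, $\frac1{|B_r|}\int_{B_r}|u-u_r|\,dx\leq C_P\,r\,\frac{1}{|B_{\nu r}|}\int_{B_{\nu r}}|Xu|\,dx$, where $u_r=\frac1{|B_r|}\int_{B_r}u\,dx$. Function space. $W^{1,p}_0(\Omega,X)$ is the closure of $C_c^\infty(\Omega)$ under the norm $\|u\|_{W^{1,p}_0(\Omega,X)}=\|Xu\|_{L^p(\Omega)}$; for $u$ in this space, $Xu\in (L^p(\Omega))^d$ is the $L^p$-limit of $X\varphi_n$ for any sequence $\varphi_n\in C_c^\infty(\Omega)$ converging to $u$. $X^*$ is the formal adjoint: $\langle X^*F,\varphi\rangle=\int_\Omega F\cdot X\varphi\,dx$. $p'=p/(p-1)$. For $1\leq t<Q$, $t^*=\frac{tQ}{Q-t}$. Operator. $a:\Omega\times\mathbb{R}\times\mathbb{R}^d\to\mathbb{R}^d$ is a Carathéodory function (measurable in $x$, continuous in $(s,\xi)$ for a.e. $x$) such that for a.e. $x\in\Omega$,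 every $s\in\mathbb{R}$ and every $\xi\neq\eta\in\mathbb{R}^d$: $a(x,s,\xi)\cdot\xi\geq\alpha|\xi|^p$; $|a(x,s,\xi)|\leq\beta(h(x)+|s|^{p-1}+|\xi|^{p-1})$; $[a(x,s,\xi)-a(x,s,\eta)]\cdot(\xi-\eta)>0$; where $\alpha,\beta>0$ are constants and $h\in L^{p'}(\Omega)$. Weak solution: $u\in W^{1,p}_0(\Omega,X)$ with $\int_\Omega a(x,u,Xu)\cdot Xv\,dx=\int_\Omega f\,v\,dx$ for all $v\in W^{1,p}_0(\Omega,X)$. The notation $C=C(Q,p,\Omega,\alpha,m,X)$ means that $C$ depends only on the listed data (in particular not on $f$ or $u$); the dependence on $\Omega$ and $X$ is through the constant $\mathcal{S}_p$ in the Sobolev inequality $\|w\|_{L^{p^*}(\Omega)}\leq\mathcal{S}_p\|Xw\|_{L^p(\Omega)}$ for $w\in W^{1,p}_0(\Omega,X)$. *)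

(* Defs.v *)
From HB Require Import structures.
From mathcomp Require Import all_boot all_order all_algebra.
From mathcomp Require Import all_classical all_reals all_analysis.

Set Implicit Arguments.
Unset Strict Implicit.
Unset Printing Implicit Defensive.

Import Order.TTheory GRing.Theory Num.Theory.
Import numFieldNormedType.Exports.

Local Open Scope classical_set_scope.
Local Open Scope ring_scope.

(** * Lebesgue measure on R^N

    The library has no Lebesgue measure on ['rV[R]_N].  We take the Lebesgue
    outer measure (infimum of the total volume of countable covers by boxes)
    and its restriction to the Caratheodory measurable sets. *)

Section LebesgueRN.
Context {R : realType} {N : nat}.
Implicit Types (a b x : 'rV[R]_N) (A : set 'rV[R]_N).

Definition box a b : set 'rV[R]_N :=
  [set x | forall i, a ord0 i < x ord0 i <= b ord0 i].

Definition box_volume a b : R :=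
  \prod_(i < N) Num.max 0 (b ord0 i - a ord0 i).

(* Covers are indexed by an arbitrary set of naturals, so that the empty cover
   is allowed (for N = 0 no box is empty). *)
Definition lebesgue_outer A : \bar R :=
  ereal_inf [set e | exists (D : set nat) (a b : nat -> 'rV[R]_N),
    A `<=` \bigcup_(k in D) box (a k) (b k) /\
    e = (\esum_(k in D) (box_volume (a k) (b k))%:E)%E].

Lemma box_volume_ge0 a b : 0 <= box_volume a b.
Proof. by apply: prodr_ge0 => i _; rewrite le_max lexx. Qed.

Lemma lebesgue_outer_ge0 A : (0 <= lebesgue_outer A)%E.
Proof.
apply: le_ereal_inf_tmp => _ [D [a [b [_ ->]]]].
by apply: esum_ge0 => k _; rewrite lee_fin box_volume_ge0.
Qed.

Lemma lebesgue_outer0 : lebesgue_outer set0 = 0%E.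
Proof.
apply/eqP; rewrite eq_le lebesgue_outer_ge0 andbT.
apply: ereal_inf_lbound; exists set0, (fun=> 0), (fun=> 0).
by split; [exact: sub0set|rewrite esum_set0].
Qed.

Lemma le_lebesgue_outer : {homo lebesgue_outer : A B / A `<=` B >-> (A <= B)%E}.
Proof.
move=> A B AB; apply: ereal_inf_le_tmp => _ [D [a [b [BD ->]]]].
by exists D, a, b; split => //; exact: subset_trans BD.
Qed.

Lemma lebesgue_outer_sigma_subadditive : sigma_subadditive lebesgue_outer.
Proof.
move=> A; have [[i ioo]|] := pselect (exists i, lebesgue_outer (A i) = +oo%E).
  rewrite (eseries_pinfty _ _ ioo) ?leey// => n _.
  by rewrite -ltNye (lt_le_trans _ (lebesgue_outer_ge0 _)).
rewrite -forallNE => Aoo.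
apply/lee_addgt0Pr => e e0.
rewrite (le_trans _ (epsilon_trick _ _ (ltW e0)))//; last first.
  by move=> n; exact: lebesgue_outer_ge0.
pose V (G : set nat * ((nat -> 'rV[R]_N) * (nat -> 'rV[R]_N))) k : \bar R :=
  (box_volume (G.2.1 k) (G.2.2 k))%:E.
have V0 G k : (0 <= V G k)%E by rewrite lee_fin box_volume_ge0.
pose P n G := A n `<=` \bigcup_(k in G.1) box (G.2.1 k) (G.2.2 k) /\
  (\esum_(k in G.1) V G k <= lebesgue_outer (A n) + (e / (2 ^ n.+1)%:R)%:E)%E.
have [G PG] : {G & forall n, P n (G n)}.
  apply: (@choice _ _ P) => n; rewrite /P.
  have en : 0 < e / (2 ^ n.+1)%:R by rewrite divr_gt0// ltr0n expn_gt0.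
  have fA : lebesgue_outer (A n) \is a fin_num.
    rewrite ge0_fin_numE ?lebesgue_outer_ge0// ltey.
    by apply/eqP; exact: Aoo.
  have [_ [D [a [b [AD ->]]]] Dlt] := lb_ereal_inf_adherent en fA.
  by exists (D, (a, b)); split => //; exact: ltW.
have /card_esym/ppcard_eqP[f] := card_nat2.
pose J i := (G i).1.
pose K : set (nat * nat) := [set: nat] `*`` J.
apply: (@le_trans _ _ (\esum_(ij in K) V (G ij.1) ij.2)%E).
  apply: ereal_inf_lbound.
  exists (f @^-1` K), (fun k => (G (f k).1).2.1 (f k).2),
    (fun k => (G (f k).1).2.2 (f k).2); split.
    move=> t [i _ /(PG i).1[j Gj tj]].
    by exists (f^-1%FUN (i, j)) => /=; rewrite invK ?inE//; split.
  rewrite (reindex_esum (f @^-1` K) K f)//.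
  split=> [k //|k l _ _|ij Kij]; first by move/inj; apply; rewrite inE.
  by exists (f^-1%FUN ij) => /=; rewrite invK ?inE.
rewrite -(esum_esum (a := fun i => V (G i)))//.
rewrite -nneseries_esumT; last first.
  by move=> n; apply: esum_ge0.
by apply: lee_nneseries => n *; [apply: esum_ge0|exact: (PG n).2].
Qed.

HB.instance Definition _ := isOuterMeasure.Build R 'rV[R]_N lebesgue_outer
  lebesgue_outer0 lebesgue_outer_ge0 le_lebesgue_outer
  lebesgue_outer_sigma_subadditive.

Definition lebesgueN :
    {measure set (caratheodory_type lebesgue_outer) -> \bar R} :=
  [the {measure set (caratheodory_type lebesgue_outer) -> \bar R} of
    [the {outer_measure set 'rV[R]_N -> \bar R} of lebesgue_outer]
      : set (caratheodory_type lebesgue_outer) -> \bar R].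

End LebesgueRN.

Section Euclidean.
Context {R : realType} {n : nat}.
Implicit Types v w : 'rV[R]_n.

Definition dotp v w : R := \sum_(i < n) v ord0 i * w ord0 i.

(* The library's norm on row vectors is the sup norm; same topology. *)
Definition enorm v : R := Num.sqrt (dotp v v).

End Euclidean.

Section Smoothness.
Context {R : realType} {N : nat}.
Implicit Types (u phi : 'rV[R]_N -> R) (U Omega : set 'rV[R]_N).

Definition partial (k : 'I_N) u : 'rV[R]_N -> R :=
  fun x => 'D_(delta_mx ord0 k) u x.

Definition gradient u : 'rV[R]_N -> 'rV[R]_N := fun x => \row_k partial k u x.

(* For U open. *)
Definition C1_on U u :=
  forall x, U x -> differentiable u x /\
    forall k, {for x, continuous (partial k u)}.

Fixpoint class_C (k : nat) u : Prop :=
  if k is k'.+1 then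
    (forall x, differentiable u x) /\ forall i, class_C k' (partial i u)
  else continuous u.

Definition test_function Omega phi :=
  [/\ forall k, class_C k phi,
      compact (closure [set x | phi x != 0]) &
      closure [set x | phi x != 0] `<=` Omega].

End Smoothness.

Section Lebesgue_spaces.
Context {R : realType} {N : nat} (Omega : set 'rV[R]_N).
Implicit Types (f : 'rV[R]_N -> R) (p : R).

(* Functions are total; only their values on Omega matter. *)
Definition LpNorm p f : \bar R := 'N[lebesgueN]_p%:E[EFin \o (f \_ Omega)]%E.

Definition in_Lp p f := (f \_ Omega) \in Lfun (@lebesgueN R N) p%:E.

End Lebesgue_spaces.

(** * Vector fields and the control distance

    A family X_1, ..., X_d is given by its coefficient matrix C(x), whose
    rows are the X_j(x). *)

Section Vector_fields.
Context {R : realType} {N d : nat} (X : 'rV[R]_N -> 'M[R]_(d, N)).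

Definition locally_lipschitz :=
  forall x : 'rV[R]_N, exists2 U, nbhs x U & [lipschitz X y | y in U].

Definition Xgrad (u : 'rV[R]_N -> R) : 'rV[R]_N -> 'rV[R]_d :=
  fun x => gradient u x *m (X x)^T.

Definition absolutely_continuous (T : R) (gamma : R -> 'rV[R]_N) :=
  forall e, 0 < e -> exists2 r, 0 < r &
    forall (n : nat) (s t : 'I_n -> R),
      (forall i, 0 <= s i /\ s i <= t i <= T) ->
      (forall i j, i != j -> t i <= s j \/ t j <= s i) ->
      \sum_(i < n) (t i - s i) < r ->
      \sum_(i < n) enorm (gamma (t i) - gamma (s i)) < e.

Definition subunit (T : R) (gamma : R -> 'rV[R]_N) :=
  absolutely_continuous T gamma /\
  exists theta : R -> 'rV[R]_d,
    {ae lebesgue_measure, forall t : R, 0 <= t <= T ->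
      is_derive t (1 : R) gamma
        (\sum_(j < d) theta t ord0 j *: row j (X (gamma t))) /\
      \sum_(j < d) theta t ord0 j ^+ 2 <= 1}.

Definition subunit_times (x y : 'rV[R]_N) : set R :=
  [set T | 0 < T /\ exists gamma, [/\ subunit T gamma, gamma 0 = x & gamma T = y]].

(* [inf] is junk on the empty set; see [connected_by_subunit]. *)
Definition cc_dist (x y : 'rV[R]_N) : R := inf (subunit_times x y).

Definition cc_ball (x : 'rV[R]_N) (r : R) : set 'rV[R]_N :=
  [set y | cc_dist x y < r].

Definition average (E : set 'rV[R]_N) (f : 'rV[R]_N -> R) : \bar R :=
  ((fine (lebesgueN E))^-1%:E * \int[lebesgueN]_(x in E) (f x)%:E)%E.

Definition connected_by_subunit := forall x y, subunit_times x y !=set0.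

Definition cc_topology := forall (x : 'rV[R]_N) (y : nat -> 'rV[R]_N),
  (enorm (y n - x) @[n --> \oo] --> 0) <-> (cc_dist x (y n) @[n --> \oo] --> 0).

Definition doubling (Q : R) := forall (x : 'rV[R]_N) (r : R), 0 < r ->
  (0 < lebesgueN (cc_ball x (2 * r)) <=
   (2 `^ Q)%:E * lebesgueN (cc_ball x r))%E.

(* C^1 on the closed ball: C^1 on an open neighbourhood of it. *)
Definition poincare := exists CP nu : R, [/\ 0 < CP, 0 < nu &
  forall (x : 'rV[R]_N) (r : R), 0 < r ->
    forall (U : set 'rV[R]_N) (u : 'rV[R]_N -> R),
    open U -> closure (cc_ball x (nu * r)) `<=` U -> C1_on U u ->
    let u_r := fine (average (cc_ball x r) u) in
    (average (cc_ball x r) (fun y => `|u y - u_r|%R) <=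
     (CP * r)%:E * average (cc_ball x (nu * r)) (fun y => enorm (Xgrad u y)))%E].

Record standing_assumptions (Q : R) : Prop := StandingAssumptions {
  sa_lipschitz : locally_lipschitz ;
  sa_connected : connected_by_subunit ;
  sa_topology : cc_topology ;
  sa_doubling : doubling Q ;
  sa_poincare : poincare }.

End Vector_fields.

Section Sobolev_space.
Context {R : realType} {N d : nat}.
Context (X : 'rV[R]_N -> 'M[R]_(d, N)) (Omega : set 'rV[R]_N) (p : R).

(* [W0 u G]: u belongs to W^{1,p}_0(Omega, X) and Xu = G.  Elements of the
   closure of the test functions under |X phi|_p are realised as functions
   through convergence of the test functions in L^p(Omega). *)
Definition W0 (u : 'rV[R]_N -> R) (G : 'rV[R]_N -> 'rV[R]_d) :=
  [/\ in_Lp Omega p u, forall j, in_Lp Omega p (fun x => G x ord0 j) &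
    exists phi : nat -> 'rV[R]_N -> R,
      [/\ forall n, test_function Omega (phi n),
          (LpNorm Omega p (fun x => phi n x - u x)%R @[n --> \oo] --> 0)%E &
          (LpNorm Omega p (fun x => enorm (Xgrad X (phi n) x - G x)%R)
             @[n --> \oo] --> 0)%E]].

Definition sobolev_exponent (Q t : R) := t * Q / (Q - t).

Definition sobolev_constant (Q S : R) := 0 < S /\
  forall w G, W0 w G ->
    (LpNorm Omega (sobolev_exponent Q p) w <=
     S%:E * LpNorm Omega p (enorm \o G))%E.

Record operator_assumptions (alpha beta : R) (h : 'rV[R]_N -> R)
    (a : 'rV[R]_N -> R -> 'rV[R]_d -> 'rV[R]_d) : Prop := OperatorAssumptions {
  oa_measurable : forall s xi j,
    measurable_fun (Omega : set (caratheodory_type lebesgue_outer))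
      (fun x => a x s xi ord0 j) ;
  oa_continuous : {ae lebesgueN, forall x, Omega x ->
    continuous (fun z : R * 'rV[R]_d => a x z.1 z.2)} ;
  oa_source : in_Lp Omega (p / (p - 1)) h ;
  oa_coercive : {ae lebesgueN, forall x, Omega x -> forall s xi,
    alpha * enorm xi `^ p <= dotp (a x s xi) xi} ;
  oa_growth : {ae lebesgueN, forall x, Omega x -> forall s xi,
    enorm (a x s xi) <= beta * (h x + `|s| `^ (p - 1) + enorm xi `^ (p - 1))} ;
  oa_monotone : {ae lebesgueN, forall x, Omega x -> forall s xi eta, xi != eta ->
    0 < dotp (a x s xi - a x s eta) (xi - eta)} }.

Definition weak_solution (a : 'rV[R]_N -> R -> 'rV[R]_d -> 'rV[R]_d)
    (f u : 'rV[R]_N -> R) :=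
  exists2 Xu, W0 u Xu & forall v Xv, W0 v Xv ->
    (\int[lebesgueN]_(x in Omega) (dotp (a x (u x) (Xu x)) (Xv x))%:E =
     \int[lebesgueN]_(x in Omega) (f x * v x)%:E)%E.

End Sobolev_space.

(* Main.v *)
Require Import Defs.
From HB Require Import structures.
From mathcomp Require Import all_boot all_order all_algebra.
From mathcomp Require Import all_classical all_reals all_analysis.
From mathcomp Require Import measurable_realfun ring lra.
Import Order.TTheory GRing.Theory Num.Theory.
Import numFieldNormedType.Exports.
Local Open Scope classical_set_scope.
Local Open Scope ring_scope.

(** The estimate comes from one test function.  Let gamma = s / q, where q is
    the Sobolev exponent of p; then gamma >= 1 exactly when m >= p_*.
    Testing the equation with v = u |u|^(p (gamma - 1)) and using coercivity,
    the left-hand side controls a multiple of the p-energy of |u|^gamma.  On the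
    right, |v| = (|u|^gamma)^sigma with sigma = (p (gamma - 1) + 1) / gamma, and
    sigma m' = q, so Hoelder's inequality bounds it by ||f||_m A^sigma, where A
    is the L^q norm of |u|^gamma.  The Sobolev inequality closes the loop:
    A^p <= C ||f||_m A^sigma.  Since p - sigma = (p - 1) / gamma > 0, this bounds
    A, which is the gamma-th power of the L^s norm of u.

    Two things keep this from being a proof: v has to be admissible, and A has to
    be finite before A^sigma is divided out.  Both are obtained by replacing |u|
    with the square root of (dl + u^2) / (1 + dl u^2), which is smooth, bounded,
    bounded away from 0, and tends to |u| as dl tends to 0.  All the identities
    above survive as inequalities between explicit functions of u
    ([dtpow_powR], [weight_le_tpow], [norm_tpow_le]).  As the truncation is
    smooth it maps test functions to test functions, so the chain rule on the
    closure, [W0_comp], follows by approximation.  [truncated_bound] is the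
    estimate for fixed dl, and [weak_solution_estimate] its limit by Fatou.

    The Sobolev inequality is derived from doubling and Poincare by Hedberg's
    method.  For smooth phi, the averages of phi on concentric balls of radius
    r / 2^i converge to phi(x); by Poincare the i-th increment is at most
    C r 2^-i times an average of |X phi| ([telescoping]).  That average is at
    most the maximal function M of |X phi| at x and, by doubling, at most
    C 2^(i Q / p) ||X phi||_p.  Using the better bound in each term gives
    C M^(1 - p / Q) ||X phi||_p^(p / Q) ([hedberg_sum]), whose L^q norm is
    controlled by the L^p boundedness of the maximal function
    ([ball_maximal_weak], [layer_cake]).  The average of phi on the largest ball
    remains; that ball is chosen with at least twice the measure of Omega,
    while phi vanishes off Omega, so this average is absorbed ([absorption]).
    Fatou's lemma along an almost everywhere convergent subsequence passes from
    test functions to the closure ([sobolev_W0]). *)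

Set Implicit Arguments.
Unset Strict Implicit.
Unset Printing Implicit Defensive.

(** * Open sets are Lebesgue measurable in R^N *)

Section lebesgueN_borel.
Context {R : realType} {N : nat}.
Implicit Types (a b x : 'rV[R]_N) (A : set 'rV[R]_N).
Local Notation T := (caratheodory_type (@lebesgue_outer R N)).
Local Notation mu := (@lebesgueN R N).

Definition set_coord a (i : 'I_N) (c : R) : 'rV[R]_N :=
  \row_j (if j == i then c else a ord0 j).

Lemma box_volume_cut a b i c :
  box_volume a (set_coord b i (Num.min (b ord0 i) c)) +
  box_volume (set_coord a i (Num.max (a ord0 i) c)) b = box_volume a b.
Proof.
rewrite /box_volume !(bigD1 (P := predT) i)//= /set_coord !mxE eqxx.
rewrite (eq_bigr (fun j => Num.max 0 (b ord0 j - a ord0 j))); last first.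
  by move=> j /negPf ji; rewrite !mxE ji.
rewrite [X in _ + _ * X](eq_bigr (fun j => Num.max 0 (b ord0 j - a ord0 j))); last first.
  by move=> j /negPf ji; rewrite !mxE ji.
rewrite -mulrDl; congr (_ * _).
move: (a ord0 i) (b ord0 i) => s t; rewrite /Num.max /Num.min.
by case: (ltP t c) => ?; case: (ltP s c) => ?; do ![case: ltP => ?]; lra.
Qed.

(** Cutting every box of a cover of A along the hyperplane x_i = c yields covers
    of the two parts of A with the same total volume: this is the Caratheodory
    criterion for the half-space. *)
Lemma halfspace_measurable (i : 'I_N) (c : R) :
  measurable ([set x | x ord0 i <= c] : set T).
Proof.
apply: le_caratheodory_measurable => A.
apply: le_ereal_inf_tmp => _ [D [a [b [AD ->]]]].
have -> : (\esum_(k in D) (box_volume (a k) (b k))%:E =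
   \esum_(k in D) (box_volume (a k) (set_coord (b k) i (Num.min (b k ord0 i) c)))%:E +
   \esum_(k in D) (box_volume (set_coord (a k) i (Num.max (a k ord0 i) c)) (b k))%:E)%E.
  rewrite -esumD; last 2 first.
  - by move=> k _; rewrite lee_fin box_volume_ge0.
  - by move=> k _; rewrite lee_fin box_volume_ge0.
  by apply: eq_esum => k _; rewrite -EFinD box_volume_cut.
apply: leeD; apply: ereal_inf_lbound.
- exists D, a, (fun k => set_coord (b k) i (Num.min (b k ord0 i) c)); split => //.
  move=> x [/AD [k Dk xk]] /= xc; exists k => // j; rewrite /set_coord !mxE.
  case: eqP => [->|_]; last exact: xk.
  by have /andP[-> ?] := xk i; rewrite le_min xc andbT.
- exists D, (fun k => set_coord (a k) i (Num.max (a k ord0 i) c)), b; split => //.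
  move=> x [/AD [k Dk xk]] /= /negP; rewrite -ltNge => xc.
  exists k => // j; rewrite /set_coord !mxE.
  case: eqP => [->|_]; last exact: xk.
  by have /andP[? ->] := xk i; rewrite gt_max xc !andbT.
Qed.

Lemma box_measurable a b : measurable (box a b : set T).
Proof.
have -> : box a b = \bigcap_(i in [set: 'I_N])
    ([set x | x ord0 i <= b ord0 i] `\` [set x | x ord0 i <= a ord0 i]).
  apply/seteqP; split=> [x xab i _ /=|x xab i].
    have /andP[ax xb] := xab i; split => //=; apply/negP; by rewrite -ltNge.
  by have [/= -> /negP] := xab i I; rewrite -ltNge => ->.
apply: fin_bigcap_measurable; first exact: finite_finset.
by move=> i _; apply: measurableD; exact: halfspace_measurable.
Qed.

(** Boxes with rational corners are countably many, so this exhibits an open set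
    as a countable union of measurable sets. *)
Lemma rational_box x (U : set 'rV[R]_N) : nbhs x U ->
  exists a b : 'rV[rat]_N, box (map_mx ratr a) (map_mx ratr b) x /\
    box (map_mx ratr a) (map_mx ratr b) `<=` U.
Proof.
move=> /nbhs_ballP[e /= e0 eU].
have ha (i : 'I_N) : exists q : rat, x ord0 i - e < ratr q < x ord0 i.
  have [q] := @rat_in_itvoo R (x ord0 i - e) (x ord0 i) ltac:(lra).
  by rewrite in_itv/= => ?; exists q.
have hb (i : 'I_N) : exists q : rat, x ord0 i < ratr q < x ord0 i + e.
  have [q] := @rat_in_itvoo R (x ord0 i) (x ord0 i + e) ltac:(lra).
  by rewrite in_itv/= => ?; exists q.
have [fa fa'] := choice ha; have [fb fb'] := choice hb.
exists (\row_i fa i), (\row_i fb i); split.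
  move=> i; rewrite !mxE; have := fa' i; have := fb' i.
  by move=> /andP[h1 _] /andP[_ ->]; rewrite ltW.
move=> y yab; apply: eU; split => // i j; rewrite (ord1 i).
have := yab j; rewrite !mxE /ball/=.
have := fa' j; have := fb' j; rewrite ltr_norml; lra.
Qed.

Lemma open_measurableN A : open A -> measurable (A : set T).
Proof.
rewrite openE => oA.
pose B (ab : 'rV[rat]_N * 'rV[rat]_N) : set 'rV[R]_N :=
  box (map_mx ratr ab.1) (map_mx ratr ab.2).
have -> : A = \bigcup_(ab in [set ab | B ab `<=` A]) B ab.
  apply/seteqP; split=> [x /oA /rational_box[a [b [xab abA]]]|x [ab/=]]; last exact.
  by exists (a, b).
rewrite bigcup_mkcond; apply: countable_bigcupT_measurable => [|ab].
  exact: countableP.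
by case: ifP => _; [exact: box_measurable|exact: measurable0].
Qed.

Lemma continuous_measurableN (f : 'rV[R]_N -> R) :
  continuous f -> measurable_fun [set: T] (f : T -> R).
Proof.
move=> cf; apply: (measurability _ (RGenOInfty.measurableE R)).
move=> _ [_ [x ->] <-]; rewrite setTI; apply: open_measurableN.
apply: open_comp => [y _|]; [exact: cf|].
exact: interval_open.
Qed.

Lemma bounded_lty A : bounded_set A -> (mu A < +oo)%E.
Proof.
move=> [M [_ /(_ (M + 1))]].
rewrite ltrDl ltr01 => /(_ isT) AM; set K := M + 1 in AM.
have AB : A `<=` box (const_mx (- K - 1)) (const_mx (K + 1)).
  move=> x /AM /=; rewrite {1}/Num.norm/= mx_normrE => h i.
  have {}h : `|x ord0 i| <= K.
    by apply: le_trans h; apply/bigmax_geP; right => /=; exists (ord0, i).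
  rewrite !mxE; move: h; rewrite ler_norml; lra.
apply: (@le_lt_trans _ _ (\esum_(k in [set 0%N]) (box_volume (const_mx (- K - 1)) (const_mx (K + 1) : 'rV[R]_N))%:E)%E).
  apply: ereal_inf_lbound; exists [set 0%N], (fun=> const_mx (- K - 1)), (fun=> const_mx (K + 1)).
  by split => // x /AB ?; exists 0%N.
by rewrite esum_set1 ?ltry// lee_fin box_volume_ge0.
Qed.

(** Translation carries covers to covers of the same volume; applied to the
    opposite translation as well, the inequality becomes an equality. *)
Lemma lebesgue_outer_shift A (c : 'rV[R]_N) :
  lebesgue_outer ((fun x : 'rV[R]_N => x + c) @` A) = lebesgue_outer A.
Proof.
suff H A' (d : 'rV[R]_N) : (lebesgue_outer ((fun x : 'rV[R]_N => x + d)%R @` A') <= lebesgue_outer A')%E.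
  apply/eqP; rewrite eq_le H /=.
  apply: le_trans (H ((fun x : 'rV[R]_N => x + c) @` A) (- c)).
  apply: le_lebesgue_outer => x Ax; exists (x + c); first by exists x.
  by rewrite addrK.
apply: ereal_inf_le_tmp => _ [D [a [b [AD ->]]]].
exists D, (fun k => a k + d), (fun k => b k + d); split.
  move=> _ [x /AD [k Dk xk] <-]; exists k => // i; rewrite !mxE.
  by have /andP[h1 h2] := xk i; rewrite ltrD2r lerD2r h1.
apply: eq_esum => k _; congr EFin; apply: eq_bigr => i _; rewrite !mxE.
by congr Num.max; ring.
Qed.

End lebesgueN_borel.

(** * The Euclidean norm, and affine changes of time *)

Section enorm_theory.
Context {R : realType} {n : nat}.
Implicit Types v w : 'rV[R]_n.

Lemma dotp_ge0 v : 0 <= dotp v v.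
Proof. by apply: sumr_ge0 => i _; rewrite -expr2 sqr_ge0. Qed.

Lemma dotpC v w : dotp v w = dotp w v.
Proof. by apply: eq_bigr => i _; rewrite mulrC. Qed.

Lemma dotpDl v1 v2 w : dotp (v1 + v2) w = dotp v1 w + dotp v2 w.
Proof. by rewrite -big_split; apply: eq_bigr => i _; rewrite !mxE mulrDl. Qed.

Lemma dotpZl c v w : dotp (c *: v) w = c * dotp v w.
Proof. by rewrite mulr_sumr; apply: eq_bigr => i _; rewrite !mxE mulrA. Qed.

Lemma dotpDr v w1 w2 : dotp v (w1 + w2) = dotp v w1 + dotp v w2.
Proof. by rewrite dotpC dotpDl !(dotpC v). Qed.

Lemma dotpZr c v w : dotp v (c *: w) = c * dotp v w.
Proof. by rewrite dotpC dotpZl dotpC. Qed.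

Lemma enorm_ge0 v : 0 <= enorm v.
Proof. exact: sqrtr_ge0. Qed.

Lemma sqr_enorm v : enorm v ^+ 2 = dotp v v.
Proof. by rewrite sqr_sqrtr ?dotp_ge0. Qed.

Lemma enormZ c v : enorm (c *: v) = `|c| * enorm v.
Proof.
rewrite /enorm dotpZl dotpZr mulrA -expr2 sqrtrM ?sqr_ge0//.
by rewrite sqrtr_sqr.
Qed.

Lemma enorm0 : enorm (0 : 'rV[R]_n) = 0.
Proof. by rewrite -(scale0r (0 : 'rV[R]_n)) enormZ normr0 mul0r. Qed.

Lemma enormN v : enorm (- v) = enorm v.
Proof. by rewrite -scaleN1r enormZ normrN normr1 mul1r. Qed.

Lemma dotp_le_enorm v w : `|dotp v w| <= enorm v * enorm w.
Proof.
rewrite -[leLHS]sqrtr_sqr -sqrtrM ?dotp_ge0//.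
apply: ler_wsqrtr.
have H c e : 0 <= c ^+ 2 * dotp v v - 2 * c * e * dotp v w + e ^+ 2 * dotp w w.
  have := dotp_ge0 (c *: v + (- e) *: w).
  rewrite !dotpDl !dotpDr !dotpZl !dotpZr (dotpC w v); set x := dotp _ _; lra.
have := dotp_ge0 w; rewrite le_eqVlt => /predU1P[w0|w0].
  (* For w of norm 0 the quadratic form is affine in the second coefficient; this
     choice makes it negative unless dotp v w vanishes. *)
  have := H (dotp v w) ((dotp v v + 1) / 2); rewrite -w0 !mulr0 addr0.
  nra.
rewrite -(ler_pM2r w0) -subr_ge0; have := H (dotp w w) (dotp v w).
by move/le_trans; apply; rewrite le_eqVlt; apply/orP; left; apply/eqP; ring.
Qed.

Lemma ler_enormD v w : enorm (v + w) <= enorm v + enorm w.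
Proof.
rewrite -[leRHS]ger0_norm ?addr_ge0 ?enorm_ge0// -sqrtr_sqr.
apply: ler_wsqrtr; rewrite dotpDl !dotpDr (dotpC w v) sqrrD !sqr_enorm.
have := le_trans (ler_norm _) (dotp_le_enorm v w); rewrite mulr2n; lra.
Qed.

Lemma ler_coord_enorm v i : `|v ord0 i| <= enorm v.
Proof.
rewrite -sqrtr_sqr; apply: ler_wsqrtr; rewrite /dotp (bigD1 i)//= -expr2.
by rewrite lerDl; apply: sumr_ge0 => j _; rewrite -expr2 sqr_ge0.
Qed.

Lemma ler_enorm_sum v : enorm v <= \sum_(i < n) `|v ord0 i|.
Proof.
rewrite -[leRHS]ger0_norm ?sumr_ge0// -sqrtr_sqr; apply: ler_wsqrtr.
rewrite /dotp expr2 mulr_suml; apply: ler_sum => i _.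
rewrite (le_trans (ler_norm _))// normrM ler_wpM2l//.
by rewrite (bigD1 i)//= lerDl sumr_ge0.
Qed.

Lemma continuous_enorm : continuous (@enorm R n).
Proof.
move=> v; apply: (@continuous_comp _ _ _ (fun v => dotp v v) Num.sqrt).
  move: v; apply: continuous_big => [|i _ v]; first exact: add_continuous.
  by apply: continuousM; exact: coord_continuous.
exact: sqrt_continuous.
Qed.

(** The topology of row vectors is that of the sup norm, whereas the control
    distance is compared with the Euclidean one. *)
Lemma cvg_enormB (x : 'rV[R]_n) (y : nat -> 'rV[R]_n) :
  y k @[k --> \oo] --> x <-> enorm (y k - x) @[k --> \oo] --> 0.
Proof.
split=> [yx|yx].
  rewrite -enorm0; apply: continuous_cvg; first exact: continuous_enorm.
  by rewrite -(subrr x); apply: cvgB => //; exact: cvg_cst.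
apply/cvgrPdist_lt => e e0; have /cvgrPdist_lt/(_ _ e0) := yx.
apply: filterS => k; rewrite sub0r normrN ger0_norm ?enorm_ge0// => ye.
rewrite {1}/Num.norm/= mx_normrE; apply/bigmax_ltP; split => // -[i j] _ /=.
rewrite (ord1 i) !mxE distrC; have := ler_coord_enorm (y k - x) j.
by rewrite !mxE => /le_lt_trans; apply.
Qed.

End enorm_theory.

Section is_derive_affine.
Context {R : realType} {V : normedModType R}.
Implicit Types (f g : R -> V).

Lemma is_derive_affine f (a b t : R) v :
  is_derive (a * t + b) (1 : R) f v ->
  is_derive t (1 : R) (fun s => f (a * s + b)) (a *: v).
Proof.
move=> [df dv]; have df' := (derivable1_diffP _ _).1 df.
have [da va] : is_derive t (1 : R) (fun s : R => a * s + b) a.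
  by apply: is_derive_eq; rewrite addr0 scaler1.
have da' := (derivable1_diffP _ _).1 da.
have dfa : differentiable (f \o (fun s : R => a * s + b)) t.
  exact: differentiable_comp.
split; first exact/derivable1_diffP.
have ea : 'd (fun s : R => a * s + b) t (1 : R) = a by rewrite -deriveE.
rewrite deriveE//.
have -> : 'd (f \o (fun s : R => a * s + b)) t (1 : R) =
    'd f (a * t + b) ('d (fun s : R => a * s + b) t (1 : R)).
  by rewrite (@diff_comp _ _ _ _ (fun s : R => a * s + b) f t da' df').
rewrite ea -[X in 'd f _ X]mulr1 -[_ * 1]/(a *: (1 : R)) linearZ/=.
by rewrite -deriveE// dv.
Qed.

End is_derive_affine.

Section lebesgue_affine.
Context {R : realType}.
Local Notation mu := (@lebesgue_measure R).

Lemma lebesgue_measure_shift (c : R) (A : set R) : measurable A ->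
  pushforward mu ((fun t => t + c) : _ -> measurableTypeR R) A = mu A.
Proof.
move=> mA; apply/esym; apply: lebesgue_measure_unique => [|mf|//]; first by apply: measurable_funD.
move=> _ [[a b]] _ <-.
rewrite -[RHS]/(mu ((fun t => t + c) @^-1` `]a, b])).
rewrite (_ : _ @^-1` _ = [set` `](a - c), (b - c)]]); last first.
  by apply/seteqP; split=> x /=; rewrite !in_itv/= ltrBlDr lerBrDr.
rewrite !lebesgue_measure_itv/= !lte_fin.
by rewrite ltrD2r; case: ifP => // _; rewrite -!EFinD; congr EFin; ring.
Qed.

(** A subunit path satisfies its differential equation for almost every time;
    this and [ae_reflect] follow the exceptional set through a change of time. *)
Lemma ae_shift (P : set R) (c : R) :
  {ae mu, forall t, P t} -> {ae mu, forall t, P (t + c)}.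
Proof.
move=> [A [mA A0 PA]]; exists ((fun t => t + c) @^-1` A); split.
- rewrite -[_ @^-1` _]setTI.
  have : measurable_fun [set: R] (fun t : R => t + c).
    by apply: measurable_funD.
  by apply => //.
- exact: etrans (lebesgue_measure_shift c mA) A0.
- by move=> t /= ?; exact: PA.
Qed.

Lemma ae_reflect (P : set R) (c : R) :
  {ae mu, forall t, P t} -> {ae mu, forall t, P (c - t)}.
Proof.
move=> /(@ae_shift _ c) [A [mA A0 PA]].
exists (-%R @^-1` A); split.
- rewrite -[_ @^-1` _]setTI.
  have : measurable_fun [set: R] (fun t : R => - t).
    exact: measurable_funN.
  by apply => //.
- exact: etrans (lebesgue_measureN mA) A0.
- by move=> t /= ?; apply: PA => /=; rewrite addrC.
Qed.

End lebesgue_affine.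

(** * The control distance *)

Section subunit_paths.
Context {R : realType} {N d : nat} (X : 'rV[R]_N -> 'M[R]_(d, N)).
Implicit Types (x y z : 'rV[R]_N) (T : R) (gamma : R -> 'rV[R]_N).

Lemma subunit_cst x T : subunit X T (fun=> x).
Proof.
split.
  move=> e e0; exists 1 => // k s t _ _ _.
  by rewrite big1// => i _; rewrite subrr enorm0.
exists (fun=> 0); apply: aeW => t _; split.
  rewrite big1; first exact: is_derive_cst.
  by move=> j _; rewrite mxE scale0r.
by rewrite big1// => j _; rewrite mxE expr0n.
Qed.

Lemma subunit_reverse T gamma :
  subunit X T gamma -> subunit X T (fun t => gamma (T - t)).
Proof.
move=> [ac [theta dtheta]]; split.
  move=> e /ac[r r0 H]; exists r => // k s t st dis lr.
  have -> : \sum_(i < k) enorm (gamma (T - t i) - gamma (T - s i)) =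
      \sum_(i < k) enorm (gamma (T - s i) - gamma (T - t i)).
    by apply: eq_bigr => i _; rewrite -[LHS]enormN opprB.
  apply: (H k (fun i => T - t i) (fun i => T - s i)).
    by move=> i; have [h1 /andP[h2 h3]] := st i; split; [lra|apply/andP; split; lra].
    by move=> i j /dis[] ?; [right|left]; lra.
  apply: le_lt_trans lr; apply: ler_sum => i _; lra.
exists (fun t => - theta (T - t)).
have FF : Filter (nbhs (almost_everywhere (@lebesgue_measure R))).
  exact: ae_filter_ringOfSetsType.
have := ae_reflect T dtheta; apply: filterS => t dt tT.
have [|dg ng] := dt; first by lra.
split.
  have := @is_derive_affine _ _ gamma (-1) T t _ _.
  rewrite mulN1r addrC => /(_ _ dg) H.
  rewrite (_ : (fun t => _) = (fun s => gamma (-1 * s + T))); last first.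
    by apply/funext => s; rewrite mulN1r addrC.
  apply: (is_derive_eq H).
  rewrite scaler_sumr; apply: eq_bigr => j _.
  by rewrite scalerA mxE mulN1r.
apply: le_trans ng; apply: ler_sum => j _.
by rewrite mxE sqrrN.
Qed.

(** The concatenation is written as a sum of two time-stopped paths.  At each
    time one of the two is at rest, so absolute continuity and the differential
    equation are inherited summand by summand, away from the junction. *)
Lemma subunit_concat T1 T2 gamma1 gamma2 y : 0 < T1 -> 0 < T2 ->
  gamma1 T1 = y -> gamma2 0 = y ->
  subunit X T1 gamma1 -> subunit X T2 gamma2 ->
  subunit X (T1 + T2)
    (fun t => gamma1 (Num.min t T1) + gamma2 (Num.max t T1 - T1) - y).
Proof.
move=> T10 T20 g1y g2y [ac1 [th1 d1]] [ac2 [th2 d2]]; split.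
  move=> e e0; have e20 : 0 < e / 2 by lra.
  have [r1 r10 H1] := ac1 _ e20; have [r2 r20 H2] := ac2 _ e20.
  exists (Num.min r1 r2); first by rewrite lt_min r10.
  move=> k s t st dis; rewrite lt_min => /andP[lr1 lr2].
  pose m u := Num.min u T1; pose M u := Num.max u T1 - T1.
  have m_mono u v : u <= v -> m u <= m v.
    by move=> uv; rewrite /m; case: (leP u T1) => ?; case: (leP v T1) => ?; lra.
  have M_mono u v : u <= v -> M u <= M v.
    by move=> uv; rewrite /M; case: (leP u T1) => ?; case: (leP v T1) => ?; lra.
  have mM u : m u + M u = u.
    by rewrite /m /M; case: (leP u T1) => ?; lra.
  have mM_len (a : R -> R) (b : R -> R) (r : R) : (forall u, a u + b u = u) ->
      (forall u v, u <= v -> b u <= b v) ->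
      \sum_(i < k) (t i - s i) < r -> \sum_(i < k) (a (t i) - a (s i)) < r.
    move=> ab bm; apply: le_lt_trans; apply: ler_sum => i _.
    have [_ /andP[/bm ? _]] := st i; have := ab (t i); have := ab (s i); lra.
  have m0 u : 0 <= u -> 0 <= m u by move=> u0; rewrite /m le_min u0 ltW.
  have mT u : m u <= T1 by rewrite /m ge_min lexx orbT.
  have M0 u : 0 <= M u by rewrite /M subr_ge0 le_max lexx orbT.
  have MT u : u <= T1 + T2 -> M u <= T2.
    by move=> uT; rewrite /M lerBlDl ge_max uT lerDl ltW.
  have A1 : \sum_(i < k) enorm (gamma1 (m (t i)) - gamma1 (m (s i))) < e / 2.
    apply: H1.
    - move=> i; have [h1 /andP[h2 h3]] := st i.
      by split; [exact: m0|rewrite mT andbT m_mono].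
    - by move=> i j /dis[h|h]; [left|right]; exact: m_mono.
    - exact: mM_len lr1.
  have A2 : \sum_(i < k) enorm (gamma2 (M (t i)) - gamma2 (M (s i))) < e / 2.
    apply: H2.
    - move=> i; have [h1 /andP[h2 h3]] := st i.
      by split => //; rewrite MT// andbT M_mono.
    - by move=> i j /dis[h|h]; [left|right]; exact: M_mono.
    - by apply: (mM_len M m _ _ _ lr2) => // u; rewrite addrC.
  have -> : e = e / 2 + e / 2 by lra.
  apply: le_lt_trans (ltrD A1 A2); rewrite -big_split; apply: ler_sum => i _ /=.
  apply: le_trans (ler_enormD _ _); rewrite -/(m _) -/(m _) -/(M _) -/(M _).
  rewrite le_eqVlt; apply/orP; left; apply/eqP; congr enorm.
  by rewrite opprB addrA subrK opprD addrACA.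
exists (fun t => if t < T1 then th1 t else th2 (t - T1)).
have d3 : {ae lebesgue_measure, forall t : R, t != T1}.
  exists [set T1]; split => //; first exact: lebesgue_measure_set1.
  by move=> t /= /negP; rewrite negbK => /eqP.
have d2' := ae_shift (- T1) d2.
have FF : Filter (nbhs (almost_everywhere (@lebesgue_measure R))).
  exact: ae_filter_ringOfSetsType.
apply: filterS3 d1 d2' d3 => t p1 p2 tT1 tT.
case: ltP => h.
  have [|dg ng] := p1; first by lra.
  rewrite /= subrr g2y addrK; split => //.
  apply: near_eq_is_derive dg.
  near=> s; have sT1 : s < T1 by near: s; exact: lt_nbhsl.
  by rewrite (min_l (ltW sT1)) (max_r (ltW sT1)) subrr g2y addrK.
have {}h : T1 < t by rewrite lt_neqAle eq_sym tT1.
have [|dg ng] := p2; first by lra.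
rewrite /= g1y addrAC subrr add0r; split => //.
have H v : is_derive (t - T1) (1 : R) gamma2 v ->
    is_derive t (1 : R) (fun s => gamma2 (1 * s - T1)) v.
  by have := @is_derive_affine _ _ gamma2 1 (- T1) t v; rewrite mul1r scale1r.
apply: near_eq_is_derive (H _ dg).
near=> s; have sT1 : T1 < s by near: s; exact: lt_nbhsr.
by rewrite (min_r (ltW sT1)) (max_l (ltW sT1)) g1y addrAC subrr add0r mul1r.
Unshelve. all: by end_near. Qed.

End subunit_paths.

Section cc_distance.
Context {R : realType} {N d : nat} (X : 'rV[R]_N -> 'M[R]_(d, N)).
Hypothesis conn : connected_by_subunit X.
Implicit Types (x y z : 'rV[R]_N) (T r : R).
Local Notation delta := (cc_dist X).

Lemma has_inf_times x y : has_inf (subunit_times X x y).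
Proof. by split; [exact: conn|exists 0 => T [/ltW]]. Qed.

Lemma cc_dist_le T x y : subunit_times X x y T -> delta x y <= T.
Proof. by move=> ?; apply: ge_inf => //; have [] := has_inf_times x y. Qed.

Lemma cc_dist_ge0 x y : 0 <= delta x y.
Proof. by apply: lb_le_inf; [exact: conn|move=> T [/ltW]]. Qed.

Lemma cc_dist_lt r x y : delta x y < r -> exists2 T, subunit_times X x y T & T < r.
Proof. by move=> /(inf_lt (conn x y)) [T]; exists T. Qed.

Lemma cc_dist_xx x : delta x x = 0.
Proof.
apply/eqP; rewrite eq_le cc_dist_ge0 andbT; apply/ler_addgt0Pr => e e0.
rewrite add0r; apply: cc_dist_le; split => //; exists (fun=> x); split => //.
exact: subunit_cst.
Qed.

Lemma cc_dist_sym x y : delta x y = delta y x.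
Proof.
suff H u v : delta u v <= delta v u by apply/eqP; rewrite eq_le !H.
apply/ler_addgt0Pr => e e0.
have [|T [T0 [g [sg g0 gT]]] Te] := @cc_dist_lt (delta v u + e) v u; first by lra.
apply: le_trans (ltW Te); apply: cc_dist_le; split => //.
exists (fun t => g (T - t)); split; first exact: subunit_reverse.
  by rewrite subr0.
by rewrite subrr.
Qed.

Lemma cc_dist_triangle y x z : delta x z <= delta x y + delta y z.
Proof.
apply/ler_addgt0Pr => e e0.
have [|T1 [T10 [g1 [sg1 g10 g1T]]] Te1] := @cc_dist_lt (delta x y + e / 2) x y; first by lra.
have [|T2 [T20 [g2 [sg2 g20 g2T]]] Te2] := @cc_dist_lt (delta y z + e / 2) y z; first by lra.
apply: (@le_trans _ _ (T1 + T2)); last by lra.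
apply: cc_dist_le; split; first by lra.
eexists; split; first exact: (subunit_concat T10 T20 g1T g20 sg1 sg2).
  by rewrite /= (min_l (ltW T10)) (max_r (ltW T10)) subrr g10 g20 addrK.
have h : T1 <= T1 + T2 by lra.
by rewrite /= (min_r h) (max_l h) g1T addrAC subrr add0r addrC addKr.
Qed.

Lemma cc_ball_sub x y r s : delta x y + r <= s -> cc_ball X y r `<=` cc_ball X x s.
Proof.
by move=> h z; rewrite /cc_ball/= => yz; have := cc_dist_triangle y x z; lra.
Qed.

Hypothesis top : cc_topology X.

(** The comparison of topologies is stated for sequences: a failure would give,
    at the radii 1 / (k + 1), a sequence converging for one distance only. *)
Lemma nbhs_cc_dist x (U : set 'rV[R]_N) : nbhs x U ->
  exists2 e, 0 < e & cc_ball X x e `<=` U.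
Proof.
move=> xU; apply: contrapT => H.
have /choice[y yP] : forall k : nat, exists y, delta x y < k.+1%:R^-1 /\ ~ U y.
  move=> k; apply: contrapT => H'; apply: H; exists k.+1%:R^-1; first by rewrite invr_gt0.
  by move=> y xy; apply: contrapT => Uy; apply: H'; exists y.
have : delta x (y k) @[k --> \oo] --> 0.
  apply: (@squeeze_cvgr _ _ _ _ (fun=> 0) harmonic).
  - apply: nearW => k; rewrite cc_dist_ge0/= /harmonic/=.
    by apply: ltW; case: (yP k).
  - exact: cvg_cst.
  - exact: cvg_harmonic.
move/top/cvg_enormB => /(_ _ xU)[k _ /(_ k (leqnn k))]/=.
by case: (yP k).
Qed.

Lemma nbhs_cc_ball x r : 0 < r -> nbhs x (cc_ball X x r).
Proof.
move=> r0; apply: contrapT => H.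
have /choice[y yP] : forall k : nat, exists y, ball x k.+1%:R^-1 y /\ ~ cc_ball X x r y.
  move=> k; apply: contrapT => H'; apply: H; apply/nbhs_ballP.
  exists k.+1%:R^-1; first by rewrite /= invr_gt0.
  by move=> y xy; apply: contrapT => Uy; apply: H'; exists y.
have : y k @[k --> \oo] --> x.
  apply/cvg_ballP => e e0; near=> k.
  have [h _] := yP k; apply: le_ball h.
  apply: ltW; near: k; exact: near_infty_natSinv_lt (PosNum e0).
move/cvg_enormB/top => /cvgrPdist_lt/(_ _ r0)[k _ /(_ k (leqnn k))]/=.
rewrite sub0r normrN ger0_norm ?cc_dist_ge0//.
by case: (yP k).
Unshelve. all: by end_near. Qed.

Lemma cc_ball_open x r : open (cc_ball X x r).
Proof.
rewrite openE => y xy; rewrite /interior.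
have h : 0 < r - delta x y by move: xy; rewrite /cc_ball/=; lra.
apply: filterS (nbhs_cc_ball y h); apply: cc_ball_sub; lra.
Qed.

(** The open balls of integer radius cover the compact closure of A. *)
Lemma bounded_sub_cc_ball (A : set 'rV[R]_N) (x : 'rV[R]_N) : bounded_set A ->
  exists2 D, 0 < D & A `<=` cc_ball X x D.
Proof.
move=> bA; have : compact (closure A).
  apply: bounded_closed_compact; last exact: closed_closure.
  case: bA => M [Mr AM]; exists M; split => // y My.
  have : closed [set z : 'rV[R]_N | `|z| <= y].
    by apply: (@closed_comp _ _ (@Num.norm _ 'rV[R]_N) [set r | r <= y]); [move=> z _; exact: norm_continuous|exact: closed_le].
  move=> /closure_id ->; apply: closure_subset; exact: AM.
rewrite compact_cover => /(_ nat setT (fun k => cc_ball X x k%:R)) [].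
- by move=> k _; exact: cc_ball_open.
- move=> y _; exists (Num.bound (delta x y)) => //=; rewrite /cc_ball/=.
  by apply: archi_boundP; exact: cc_dist_ge0.
- move=> D _ AD; exists (\sum_(k <- finmap.enum_fset D) k.+1%:R + 1).
    by rewrite ltr_wpDl// sumr_ge0.
  move=> y /subset_closure/AD[k /= kD]; rewrite /cc_ball/= => /lt_trans; apply.
  rewrite (big_rem k)//= -addrA (@lt_le_trans _ _ k.+1%:R) ?ltr_nat//.
  by rewrite lerDl addr_ge0// sumr_ge0.
Qed.

End cc_distance.

(** * Maximal functions of countable families of balls *)

(** Induction on the balls in order of increasing radius: the smallest ball is
    treated after all the others, and if it meets a selected ball then that one
    is larger, so that its enlargement contains the small ball. *)
Lemma vitali_selection (R : realType) (T : Type) (I : eqType)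
    (B B' : I -> set T) (r : I -> R) (s : seq I) :
  (forall i, B i `<=` B' i) ->
  (forall i j, r i <= r j -> B i `&` B j !=set0 -> B i `<=` B' j) ->
  exists s', [/\ uniq s', {subset s' <= s}, trivIset [set` s'] B &
    \bigcup_(i in [set` s]) B i `<=` \bigcup_(i in [set` s']) B' i].
Proof.
move=> BB' BrB'.
pose s1 := sort (fun i j => r i <= r j) s.
have sE : s1 =i s by move=> i; rewrite mem_sort.
have : sorted (fun i j => r i <= r j) s1 by apply: sort_sorted => i j; exact: le_total.
have H2 (t : seq I) : sorted (fun i j => r i <= r j) t ->
  exists s', [/\ uniq s', {subset s' <= t}, trivIset [set` s'] B &
    \bigcup_(i in [set` t]) B i `<=` \bigcup_(i in [set` s']) B' i].
  elim: t => [_|i t IH /= it].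
    by exists [::]; split => // x [].
  have [s' [us' s't tB tBB']] := IH (path_sorted it).
  have ri j : j \in t -> r i <= r j.
    move: it; rewrite path_sortedE; last by move=> ? ? ?; exact: le_trans.
    by move=> /andP[/allP + _] => /[apply].
  have [[j js' ij]|dis] := pselect (exists2 j, j \in s' & B i `<=` B' j).
    exists s'; split => //; first by move=> k /s't; rewrite inE orbC => ->.
    move=> x [k /=]; rewrite inE => /predU1P[->|kt] Bx.
      by exists j => //; exact: ij.
    by apply: tBB'; exists k.
  have is' : i \notin s' by apply/negP => is'; apply: dis; exists i.
  have disj j : j \in s' -> B i `&` B j = set0.
    move=> js'; apply/eqP/negPn/negP => /set0P ij; apply: dis; exists j => //.
    exact: BrB' (ri _ (s't _ js')) ij.
  exists (i :: s'); split => /=.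
  - by rewrite is' us'.
  - by move=> j; rewrite !inE => /predU1P[->|/s't ->]; rewrite ?eqxx ?orbT.
  - move=> j k /=; rewrite !inE => /predU1P[->|js'] /predU1P[->|ks'] //.
    + by rewrite disj// => -[].
    + by rewrite setIC disj// => -[].
    + exact: tB.
  - move=> x [k /=]; rewrite inE => /predU1P[->|kt] Bx.
      by exists i; [rewrite /= inE eqxx|exact: BB'].
    have [|j /= js' Bj] := tBB' x; first by exists k.
    by exists j => //=; rewrite inE js' orbT.
move/H2 => [s' [us' s's1 tB sB]]; exists s'; split => //.
  by move=> i /s's1; rewrite sE.
apply: subset_trans sB => x [i /= si Bx]; exists i => //=; by rewrite sE.
Qed.

Section maximal.
Context d (T : measurableType d) (R : realType) (mu : {measure set T -> \bar R}).
Local Open Scope ereal_scope.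

(** On each ball the part of g below l / 2 accounts for at most half of
    l mu (B i).  Hence the other half is carried by the set where g exceeds
    l / 2, and the selected balls are disjoint.  Restricting the integral to that
    set is what makes the L^p bound of [layer_cake] possible. *)
Lemma weak_type_finite (B B' : nat -> set T) (r : nat -> R) (K l : R)
    (g : T -> R) (s : seq nat) :
  (forall i, measurable (B i)) -> (forall i, measurable (B' i)) ->
  (forall i, mu (B i) < +oo) ->
  (forall i, mu (B' i) <= K%:E * mu (B i)) ->
  (forall i, B i `<=` B' i) ->
  (forall i j, (r i <= r j)%R -> B i `&` B j !=set0 -> B i `<=` B' j) ->
  (0 <= K)%R -> (0 < l)%R -> measurable_fun setT g -> (forall x, 0 <= g x)%R ->
  (forall i, i \in s -> l%:E * mu (B i) <= \int[mu]_(x in B i) (g x)%:E) ->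
  mu (\bigcup_(i in [set` s]) B i) <=
    (K * (2 / l))%:E * \int[mu]_(x in [set x | (l / 2 < g x)%R]) (g x)%:E.
Proof.
move=> mB mB' Bfin BK BB' BrB' K0 l0 mg g0 sl.
have [s' [us' s's tB sB]] := vitali_selection s BB' BrB'.
have mG : measurable [set x | (l / 2 < g x)%R].
  by rewrite -[X in measurable X]setTI -preimage_itvoy; apply: mg => //.
have mge (D : set T) : measurable_fun D (EFin \o g).
  exact/measurable_EFinP/measurable_funTS.
apply: (@le_trans _ _ (\sum_(i <- s') mu (B' i))).
  apply: (@le_trans _ _ (mu (\big[setU/set0]_(i <- s') B' i))).
    apply: le_measure; rewrite ?inE.
    - rewrite bigcup_seq; exact: bigsetU_measurable.
    - exact: bigsetU_measurable.
    - by rewrite -bigcup_seq.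
  rewrite -[X in X <= _]/(mu _); elim: s' {us' s's tB sB} => [|i t IH].
    by rewrite !big_nil measure0.
  rewrite !big_cons; apply: le_trans (measureU2 _ _ _) _ => //.
    exact: bigsetU_measurable.
  exact: leeD2l.
have Bi i : i \in s -> mu (B i) <=
    (2 / l)%:E * \int[mu]_(x in B i `&` [set x | (l / 2 < g x)%R]) (g x)%:E.
  move=> /sl; set J := \int[mu]_(x in _ `&` _) _ => h.
  have [Jy|Jfin] := eqVneq J +oo.
    by rewrite Jy gt0_muley ?leey// lte_fin divr_gt0.
  have J0 : 0 <= J by apply: integral_ge0 => x _; rewrite lee_fin.
  have h2 : \int[mu]_(x in B i) (g x)%:E <= J + (l / 2)%:E * mu (B i).
    rewrite /J integral_mkcondr -integral_cst// -ge0_integralD//=.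
    - apply: ge0_le_integral => //.
      + by move=> x _; rewrite lee_fin.
      + apply: emeasurable_funD; last exact: measurable_cst.
        by apply/measurable_restrict => //; exact: mge.
      + move=> x _; rewrite patchE; case: ifPn => [_|].
          by rewrite -EFinD lee_fin lerDl; lra.
        by rewrite notin_setE/= add0e lee_fin => /negP; rewrite -leNgt.
    - by move=> x _; rewrite patchE; case: ifP => _; rewrite ?lee_fin.
    - by apply/measurable_restrict => //; exact: mge.
    - by move=> x _; rewrite lee_fin; lra.
  move: (le_trans h h2).
  have /fineK <- : mu (B i) \is a fin_num by rewrite ge0_fin_numE.
  have /fineK <- : J \is a fin_num by rewrite ge0_fin_numE// ltey.
  rewrite -!EFinM -EFinD !lee_fin => h3.
  rewrite -ler_pdivrMl ?divr_gt0// invf_div; lra.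
apply: (@le_trans _ _ (\sum_(i <- s') K%:E * ((2 / l)%:E *
    \int[mu]_(x in B i `&` [set x | (l / 2 < g x)%R]) (g x)%:E))).
  rewrite big_seq [leRHS]big_seq; apply: lee_sum => i /s's si.
  apply: le_trans (BK i) _; apply: lee_wpmul2l; rewrite ?lee_fin//; exact: Bi.
have I0 D : 0 <= \int[mu]_(x in D) (g x)%:E.
  by apply: integral_ge0 => x _; rewrite lee_fin.
under eq_bigr do rewrite muleA -EFinM.
rewrite -ge0_sume_distrr//; apply: lee_wpmul2l.
  by rewrite lee_fin mulr_ge0// divr_ge0// ltW.
rewrite -[leLHS](@ge0_integral_bigsetU _ _ _ mu _
    (fun i => B i `&` [set x | (l / 2 < g x)%R]) (EFin \o g) s') //.
- apply: ge0_subset_integral => //.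
  + by apply: bigsetU_measurable => i _; exact: measurableI.
  + by move=> x _; rewrite lee_fin.
  + by rewrite -bigcup_seq => x [i _ []].
- by move=> i; exact: measurableI.
- exact: trivIset_setIr.
- by move=> x _; rewrite lee_fin.
Qed.

Section maximal_function.
Variables (B B' : nat -> set T) (r : nat -> R) (K : R) (g : T -> R) (A : R)
  (a : nat -> R).
Hypotheses (mB : forall i, measurable (B i)) (mB' : forall i, measurable (B' i)).
Hypotheses (Bfin : forall i, mu (B i) < +oo)
  (BK : forall i, mu (B' i) <= K%:E * mu (B i)).
Hypotheses (BB' : forall i, B i `<=` B' i)
  (BrB' : forall i j, (r i <= r j)%R -> B i `&` B j !=set0 -> B i `<=` B' j).
Hypotheses (K0 : (0 <= K)%R) (mg : measurable_fun setT g) (g0 : forall x, (0 <= g x)%R).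
Hypotheses (a0 : forall i, (0 <= a i)%R) (aA : forall i, (a i <= A)%R)
  (aB : forall i, (a i)%:E * mu (B i) <= \int[mu]_(x in B i) (g x)%:E).

Definition maximal x : R := sups (fun k => a k * \1_(B k) x)%R 0%N.

Lemma maximal_ub x : has_ubound (range (fun k => a k * \1_(B k) x)%R).
Proof.
exists A => _ [k _ <-]; rewrite indicE; case: (_ \in _); rewrite ?mulr1//.
by rewrite mulr0 (le_trans (a0 0%N)).
Qed.

Lemma maximalE x : maximal x = sup (range (fun k => a k * \1_(B k) x)%R).
Proof.
by rewrite /maximal /sups; congr sup; apply/seteqP; split=> _ [k _ <-]; exists k.
Qed.

Lemma le_maximal k x : B k x -> (a k <= maximal x)%R.
Proof.
move=> Bx; rewrite maximalE; apply: ub_le_sup; first exact: maximal_ub.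
by exists k => //; rewrite indicE mem_set// mulr1.
Qed.

Lemma maximal_ge0 x : (0 <= maximal x)%R.
Proof.
rewrite maximalE; apply: (@le_trans _ _ (a 0%N * \1_(B 0%N) x)%R).
  by rewrite mulr_ge0.
by apply: ub_le_sup; [exact: maximal_ub|exists 0%N].
Qed.

Lemma maximal_le x : (maximal x <= A)%R.
Proof.
rewrite maximalE; apply: ge_sup; first by exists (a 0%N * \1_(B 0%N) x)%R; exists 0%N.
move=> _ [k _ <-]; rewrite indicE; case: (_ \in _); rewrite ?mulr1//.
by rewrite mulr0 (le_trans (a0 0%N)).
Qed.

Lemma measurable_maximal : measurable_fun setT maximal.
Proof.
apply: measurable_fun_sups => [x _|k]; first exact: maximal_ub.
by apply: measurable_funM => //; exact: measurable_indic.
Qed.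

(** The level set of a supremum over a countable family is the increasing union
    of the level sets of the finite subfamilies, for which the constant is
    uniform. *)
Lemma maximal_weak_type (l : R) : (0 < l)%R ->
  mu [set x | (l < maximal x)%R] <=
    (K * (2 / l))%:E * \int[mu]_(x in [set x | (l / 2 < g x)%R]) (g x)%:E.
Proof.
move=> l0; pose s n := [seq i <- iota 0 n | (l < a i)%R].
pose F n := \bigcup_(i in [set` s n]) B i.
have mF n : measurable (F n).
  by rewrite /F bigcup_seq; exact: bigsetU_measurable.
have -> : [set x | (l < maximal x)%R] = \bigcup_n F n.
  apply/seteqP; split=> [x /=|x [n _ [i /=]]].
    rewrite maximalE => /sup_gt[|_ [k _ <-] lk].
      by exists (a 0%N * \1_(B 0%N) x)%R; exists 0%N.
    exists k.+1 => //; exists k => /=.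
      rewrite mem_filter mem_iota add0n ltnS leqnn !andbT.
      apply: lt_le_trans lk _; rewrite indicE; case: (_ \in _); rewrite ?mulr1//.
      by rewrite mulr0.
    move: lk; rewrite indicE; have [/set_mem//|_] := boolP (x \in B k).
    by rewrite mulr0; lra.
  rewrite mem_filter => /andP[la _] /le_maximal; exact: lt_le_trans.
have mUF : measurable (\bigcup_n F n) by exact: bigcupT_measurable.
have ndF : {homo F : n m / (n <= m)%N >-> (n <= m)%O}.
  move=> n m nm; apply/subsetPset => x [i /=]; rewrite mem_filter mem_iota => /and3P[li _ im] Bx.
  by exists i => //=; rewrite mem_filter li mem_iota/= add0n (leq_trans im).
have cF := nondecreasing_cvg_mu (mu := mu) mF mUF ndF.
rewrite -(cvg_lim _ cF)//; apply: lime_le; first by apply/cvg_ex; eexists; exact: cF.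
apply: nearW => n; apply: (weak_type_finite (B' := B') (r := r)) => // i.
rewrite mem_filter => /andP[li _]; apply: le_trans (aB i).
by apply: lee_wpmul2r => //; rewrite lee_fin ltW.
Qed.

End maximal_function.

(** The powers increase geometrically, so the sum is comparable with its largest
    term. *)
Lemma dyadic_sum (q e y : R) n : (0 < q)%R -> (0 < e)%R -> (0 <= y)%R ->
  (\sum_(k < n) (e * 2 ^+ k) `^ q * (e * 2 ^+ k < y)%R%:R <=
   2 `^ q / (2 `^ q - 1) * y `^ q)%R.
Proof.
move=> q0 e0 y0; have q1 : (1 < 2 `^ q :> R)%R.
  have E : (1 `^ q = 1 :> R)%R by rewrite powR1.
  by rewrite -[X in (X < _)%R]E gt0_ltr_powR ?nnegrE//; lra.
have Q1 : (0 < 2 `^ q - 1 :> R)%R by lra.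
elim: n => [|n IH].
  by rewrite big_ord0 mulr_ge0 ?powR_ge0// divr_ge0 ?powR_ge0// ltW.
have [h|h] := ltP (e * 2 ^+ n)%R y; last first.
  by rewrite big_ord_recr/= ltNge h/= mulr0 addr0.
apply: (@le_trans _ _ (\sum_(k < n.+1) (e * 2 ^+ k) `^ q)%R).
  by apply: ler_sum => k _; case: (_ < _)%R; rewrite ?mulr1 ?mulr0// powR_ge0.
apply: (@le_trans _ _ (2 `^ q / (2 `^ q - 1) * (e * 2 ^+ n) `^ q)%R).
  elim: n {IH h} => [|n IH].
    rewrite big_ord_recr big_ord0/= add0r ler_peMl ?powR_ge0//.
    by rewrite ler_pdivlMr// mul1r; lra.
  rewrite big_ord_recr/=; apply: le_trans (lerD IH (lexx _)) _.
  have -> : ((e * 2 ^+ n.+1) `^ q = 2 `^ q * (e * 2 ^+ n) `^ q)%R.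
    by rewrite exprS mulrCA [LHS]powRM// mulr_ge0 ?exprn_ge0// ltW.
  move: (powR_ge0 (e * 2 ^+ n) q); set z := ((e * 2 ^+ n) `^ q)%R => z0.
  set t := (2 `^ q)%R in Q1 q1 *; rewrite le_eqVlt; apply/orP; left; apply/eqP.
  by field; lra.
apply: ler_wpM2l; first by rewrite divr_ge0 ?powR_ge0// ltW.
apply: ge0_ler_powR; rewrite ?nnegrE ?(ltW h)//; first exact: ltW.
by rewrite mulr_ge0 ?exprn_ge0// ltW.
Qed.

(** The weak estimate is summed over the dyadic levels e 2^k of M; exchanging sum
    and integral, each g(x) only sees the levels below 2 g(x), a geometric sum of
    size g(x)^(p - 1).  As M is bounded, finitely many levels suffice above e;
    below e the contribution e^p mu(D) is made as small as desired. *)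
Lemma layer_cake (p K : R) : (1 < p)%R -> (0 <= K)%R -> exists2 C : R, (0 <= C)%R &
  forall (A : R) (M g : T -> R) (D : set T), measurable D -> mu D < +oo ->
  measurable_fun setT M -> measurable_fun setT g ->
  (forall x, (0 <= M x <= A)%R) -> (forall x, 0 <= g x)%R ->
  (forall l, (0 < l)%R -> mu [set x | (l < M x)%R] <=
    (K * (2 / l))%:E * \int[mu]_(x in [set x | (l / 2 < g x)%R]) (g x)%:E) ->
  \int[mu]_(x in D) (M x `^ p)%:E <= C%:E * \int[mu]_x (g x `^ p)%:E.
Proof.
move=> p1 K0; have q0 : (0 < p - 1)%R by lra.
have [c c0 cE] : exists2 c : R, (0 <= c)%R & c = (2 `^ (p - 1) / (2 `^ (p - 1) - 1))%R.
  have E : (1 `^ (p - 1) = 1 :> R)%R by rewrite powR1.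
  eexists; last by [].
  rewrite divr_ge0 ?powR_ge0// subr_ge0 -[leLHS]E.
  by rewrite ge0_ler_powR ?nnegrE//; lra.
exists (2 * (2 `^ p * K) * (c * 2 `^ (p - 1)))%R.
  by rewrite !mulr_ge0 ?powR_ge0.
move=> A M g D mD Dfin mM mg MA g0 weak.
apply/lee_addgt0Pr => e' e'0.
(* e is the lowest level; below it M^p is at most e^p. *)
have [e e0 eD] : exists2 e : R, (0 < e)%R & (e `^ p)%:E * mu D <= e'%:E.
  have Df : mu D \is a fin_num by rewrite ge0_fin_numE.
  have m0 : (0 < fine (mu D) + 1)%R by rewrite ltr_wpDl// fine_ge0.
  exists ((e' / (fine (mu D) + 1)) `^ p^-1)%R; first by rewrite powR_gt0// divr_gt0.
  rewrite -powRrM mulVf ?gt_eqF//; last by lra.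
  rewrite powRr1; last by rewrite divr_ge0// ltW.
  rewrite -(fineK Df) -EFinM lee_fin mulrAC ler_pdivrMr// ler_pM2l//; lra.
have [n An] : exists n : nat, (A <= e * 2 ^+ n)%R.
  exists (Num.bound (A / e)); rewrite -ler_pdivrMl// mulrC.
  have [A0|A0] := leP 0%R (A / e)%R; last by rewrite (le_trans (ltW A0))// exprn_ge0.
  apply: (le_trans (ltW (archi_boundP A0))).
  by rewrite -natrX ler_nat ltnW// ltn_expl.
pose l k : R := (e * 2 ^+ k)%R.
have l0 k : (0 < l k)%R by rewrite mulr_gt0// exprn_gt0.
pose E k := [set x | (l k < M x)%R].
pose G k := [set x | (l k / 2 < g x)%R].
have mE k : measurable (E k).
  by rewrite /E -[X in measurable X]setTI -preimage_itvoy; apply: mM => //.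
have mG k : measurable (G k).
  by rewrite /G -[X in measurable X]setTI -preimage_itvoy; apply: mg => //.
have pw x : (M x `^ p <= e `^ p + \sum_(k < n) (l k.+1) `^ p * \1_(E k) x)%R.
  have /andP[M0 MA'] := MA x.
  have p0 : (0 <= p)%R by lra.
  elim: n {An} (le_trans MA' An) => [|n IH] Mn.
    rewrite big_ord0 addr0 ge0_ler_powR ?nnegrE//; first exact: ltW.
    by rewrite -[e]mulr1.
  rewrite big_ord_recr/= addrA.
  have [h|h] := leP (M x) (l n).
    by rewrite (le_trans (IH h))// lerDl mulr_ge0 ?powR_ge0.
  rewrite indicE mem_set//= mulr1 ler_wpDl ?addr_ge0 ?powR_ge0//.
    by apply: sumr_ge0 => k _; rewrite mulr_ge0 ?powR_ge0.
  by rewrite ge0_ler_powR ?nnegrE// ltW.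
have mpow (f : T -> R) (q : R) (D' : set T) : measurable_fun setT f ->
    measurable_fun D' (fun x => (f x `^ q)%:E).
  move=> mf; apply/measurable_EFinP/measurable_funTS.
  exact: (@measurableT_comp _ _ _ _ _ _ (@powR R ^~ q)).
have mterm (D' : set T) k : measurable_fun D' (fun x => ((l k.+1) `^ p * \1_(E k) x)%:E).
  apply/measurable_EFinP/measurable_funTS/measurable_funM => //.
apply: (@le_trans _ _ ((e `^ p)%:E * mu D +
    \sum_(k < n) (l k.+1 `^ p)%:E * mu (E k))).
  apply: (@le_trans _ _ (\int[mu]_(x in D) ((e `^ p)%:E +
     \sum_(k < n) ((l k.+1) `^ p * \1_(E k) x)%:E))).
    apply: ge0_le_integral => //.
    - by move=> x _; rewrite lee_fin powR_ge0.
    - exact: mpow.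
    - by apply: emeasurable_funD => //; apply: emeasurable_sum => k _; exact: mterm.
    - by move=> x _; rewrite sumEFin -EFinD lee_fin.
  rewrite ge0_integralD//; last 3 first.
  - by move=> x _; rewrite lee_fin powR_ge0.
  - by move=> x _; apply: sume_ge0 => k _; rewrite lee_fin mulr_ge0 ?powR_ge0.
  - by apply: emeasurable_sum => k _; exact: mterm.
  rewrite integral_cst//; apply: leeD2l.
  rewrite ge0_integral_sum//; last first.
    by move=> k x _; rewrite lee_fin mulr_ge0 ?powR_ge0.
  apply: lee_sum => k _; under eq_integral do rewrite EFinM.
  rewrite ge0_integralZl_EFin ?powR_ge0//; last first.
    by apply/measurable_EFinP/measurable_funTS/measurable_indic; exact: mE.
  rewrite integral_indic//; apply: lee_wpmul2l; first by rewrite lee_fin powR_ge0.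
  by apply: le_measure; rewrite ?inE//; exact: measurableI.
rewrite [leRHS]addeC; apply: leeD => //.
have gG k : \int[mu]_(x in G k) (g x)%:E = \int[mu]_x (g x * \1_(G k) x)%:E.
  rewrite integral_mkcond; apply: eq_integral => x _; rewrite patchE indicE.
  by case: ifP => _; rewrite ?mulr1 ?mulr0.
have mgG k : measurable_fun setT (fun x => (g x * \1_(G k) x)%:E).
  by apply/measurable_EFinP/measurable_funM => //; apply: measurable_indic; exact: mG.
apply: (@le_trans _ _ (\sum_(k < n) (2 * (2 `^ p * K))%:E *
    \int[mu]_x ((l k) `^ (p - 1) * (g x * \1_(G k) x))%:E)).
  apply: lee_sum => k _.
  under eq_integral do rewrite EFinM.
  rewrite ge0_integralZl_EFin ?powR_ge0//; last first.
    by move=> x _; rewrite lee_fin mulr_ge0.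
  rewrite -gG muleA -EFinM.
  apply: le_trans (lee_wpmul2l _ (weak _ (l0 k))) _; first by rewrite lee_fin powR_ge0.
  rewrite muleA -EFinM; apply: lee_wpmul2r.
    by apply: integral_ge0 => x _; rewrite lee_fin.
  rewrite lee_fin le_eqVlt; apply/orP; left; apply/eqP.
  have -> : l k.+1 = (2 * l k)%R by rewrite /l exprS mulrCA.
  rewrite powRM// ?(ltW (l0 k))// -[in LHS](mulr_powRB1 (ltW (l0 k))); last by lra.
  by field; rewrite gt_eqF.
rewrite -ge0_sume_distrr; last first.
  move=> k _; apply: integral_ge0 => x _.
  by rewrite lee_fin !mulr_ge0 ?powR_ge0.
rewrite -ge0_integral_sum//; last 2 first.
- move=> k; under eq_fun do rewrite EFinM.
  exact: measurable_funeM.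
- by move=> k x _; rewrite lee_fin !mulr_ge0 ?powR_ge0.
rewrite [in leRHS]EFinM -muleA; apply: lee_wpmul2l.
  by rewrite lee_fin !mulr_ge0 ?powR_ge0.
rewrite -ge0_integralZl_EFin//; last 3 first.
- by move=> x _; rewrite lee_fin powR_ge0.
- exact: mpow.
- by rewrite mulr_ge0 ?powR_ge0.
apply: ge0_le_integral => //.
- by move=> x _; apply: sume_ge0 => k _; rewrite lee_fin !mulr_ge0 ?powR_ge0.
- apply: emeasurable_sum => k _; under eq_fun do rewrite EFinM.
  exact: measurable_funeM.
- by apply: measurable_funeM; exact: mpow.
- move=> x _; rewrite sumEFin lee_fin.
  have -> : (\sum_(k < n) l k `^ (p - 1) * (g x * \1_(G k) x) =
     g x * \sum_(k < n) l k `^ (p - 1) * (l k < 2 * g x)%R%:R)%R.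
    rewrite mulr_sumr; apply: eq_bigr => k _; rewrite mulrCA; congr (_ * (_ * _))%R.
    rewrite indicE; congr (nat_of_bool _)%:R; rewrite mulrC -ltr_pdivrMr//.
    by apply/idP/idP => [/set_mem//|?]; exact/mem_set.
  apply: (@le_trans _ _ (g x * (c * (2 * g x) `^ (p - 1)))%R).
    by apply: ler_wpM2l => //; rewrite cE; apply: dyadic_sum => //; rewrite mulr_ge0.
  rewrite powRM// -[in leRHS](@mulr_powRB1 _ (g x))//; last by lra.
  by rewrite le_eqVlt; apply/orP; left; apply/eqP; ring.
Qed.

End maximal.

(** * Hedberg's interpolation and Jensen's inequality *)

Lemma powRV (R : realType) (x a : R) : 0 <= x -> x^-1 `^ a = (x `^ a)^-1.
Proof. by move=> x0; rewrite -(powR_inv1 x0) -powRrM mulN1r powRN. Qed.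

Section hedberg.
Context {R : realType}.
Implicit Types m L y e : R.

(** A decreasing geometric sum, comparable with its first term, which is at most
    1 / y. *)
Lemma tail_sum y n : 0 < y -> forall e, 0 < e ->
  \sum_(k < n) (e * 2 ^+ k)^-1 * (y <= e * 2 ^+ k)%R%:R <= 2 / y.
Proof.
move=> y0; elim: n => [|n IH] e e0; first by rewrite big_ord0 divr_ge0// ltW.
have [ye|ey] := leP y e; last first.
  rewrite big_ord_recl/= expr0 mulr1 [y <= e]leNgt ey/= mulr0 add0r.
  apply: le_trans (IH (e * 2) _); last by rewrite mulr_gt0.
  by apply: ler_sum => k _; rewrite /bump/= add1n exprS mulrA.
apply: (@le_trans _ _ (\sum_(k < n.+1) (e * 2 ^+ k)^-1)).
  apply: ler_sum => k _; have h : 0 <= (e * 2 ^+ k)^-1.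
    by rewrite invr_ge0 mulr_ge0 ?exprn_ge0// ltW.
  by case: (y <= _); rewrite ?mulr1 ?mulr0.
apply: (@le_trans _ _ (2 / e - (e * 2 ^+ n)^-1)).
  elim: n {IH} => [|n IH].
    by rewrite big_ord_recr big_ord0/= expr0 mulr1 add0r mulr_natl mulr2n addrK.
  rewrite big_ord_recr/=; apply: le_trans (lerD IH (lexx _)) _.
  rewrite exprS; have := exprn_gt0 n (ltr0Sn R 1); move: (2 ^+ n) => z z0.
  by rewrite le_eqVlt; apply/orP; left; apply/eqP; field; lra.
rewrite (@le_trans _ _ (2 / e))//.
  by rewrite gerBl invr_ge0 mulr_ge0 ?exprn_ge0// ltW.
by rewrite ler_pM2l// lef_pV2.
Qed.

(** The two bounds on a term cross at 2^i = (m / L)^(1 / t).  Below this scale the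
    terms increase geometrically, above it they decrease geometrically, and both
    halves are comparable with the value at the crossing. *)
Lemma hedberg_sum (t : R) : 1 < t -> exists2 C : R, 0 <= C & forall m L n,
  0 <= m -> 0 <= L ->
  \sum_(i < n) (2 ^+ i)^-1 * Num.min m ((2 ^+ i) `^ t * L) <=
    C * (m `^ (1 - t^-1) * L `^ t^-1).
Proof.
move=> t1; have q0 : 0 < t - 1 by lra.
have tn0 : t != 0 by lra.
pose c : R := 2 `^ (t - 1) / (2 `^ (t - 1) - 1).
exists (`|c| + 2); first by rewrite addr_ge0.
move=> m L n m0 L0.
have p2 (i : nat) : 0 < (2 : R) ^+ i by rewrite exprn_gt0.
have triv : m = 0 \/ L = 0 -> \sum_(i < n) (2 ^+ i)^-1 * Num.min m ((2 ^+ i) `^ t * L) <=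
    (`|c| + 2) * (m `^ (1 - t^-1) * L `^ t^-1).
  move=> mL; rewrite big1; first by rewrite mulr_ge0 ?addr_ge0 ?mulr_ge0 ?powR_ge0.
  move=> i _; case: mL => ->.
    by rewrite min_l ?mulr0// mulr_ge0 ?powR_ge0.
  by rewrite mulr0 min_r ?mulr0.
have [?|mn0] := eqVneq m 0; first by apply: triv; left.
have [?|Ln0] := eqVneq L 0; first by apply: triv; right.
have {m0 mn0}m0 : 0 < m by rewrite lt_neqAle eq_sym mn0.
have {L0 Ln0}L0 : 0 < L by rewrite lt_neqAle eq_sym Ln0.
pose r := (m / L) `^ t^-1.
have r0 : 0 < r by rewrite powR_gt0// divr_gt0.
have E1 : m / r = m `^ (1 - t^-1) * L `^ t^-1.
  rewrite powRB; last by rewrite (gt_eqF m0) implybT.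
  rewrite powRr1 ?(ltW m0)// /r powRM ?invr_ge0 ?ltW// powRV ?(ltW L0)//.
  by rewrite invfM invrK mulrA.
have E2 : L * r `^ (t - 1) = m `^ (1 - t^-1) * L `^ t^-1.
  rewrite -E1 powRB; last by rewrite (gt_eqF r0) implybT.
  rewrite powRr1 ?(ltW r0)// {1}/r -powRrM mulVf// powRr1; last by rewrite divr_ge0// ltW.
  by rewrite mulrA mulrCA mulfV ?mulr1// gt_eqF.
apply: (@le_trans _ _ (L * \sum_(k < n) (1 * 2 ^+ k) `^ (t - 1) * (1 * 2 ^+ k < r)%R%:R +
   m * \sum_(k < n) (1 * 2 ^+ k)^-1 * (r <= 1 * 2 ^+ k)%R%:R)).
  rewrite !mulr_sumr -big_split; apply: ler_sum => i _ /=; rewrite !mul1r.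
  have [h|h] := ltP (2 ^+ i) r.
    rewrite !mulr1 !mulr0 addr0.
    rewrite powRB; last by rewrite gt_eqF// implybT.
    rewrite powRr1 ?(ltW (p2 i))//.
    rewrite [leRHS](_ : _ = (2 ^+ i)^-1 * ((2 ^+ i) `^ t * L)); last by ring.
    by rewrite ler_pM2l ?invr_gt0// ge_min lexx orbT.
  rewrite !mulr1 !mulr0 add0r mulrC.
  by rewrite ler_pM2r ?invr_gt0// ge_min lexx.
rewrite mulrDl; apply: lerD.
  apply: (@le_trans _ _ (L * (c * r `^ (t - 1)))).
    rewrite ler_pM2l//; apply: dyadic_sum => //; exact: ltW.
  rewrite mulrCA E2; apply: ler_wpM2r; last exact: ler_norm.
  by rewrite mulr_ge0 ?powR_ge0.
apply: (@le_trans _ _ (m * (2 / r))).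
  by rewrite ler_pM2l//; exact: tail_sum.
by rewrite mulrCA E1.
Qed.

End hedberg.

Section jensen.
Context d (T : measurableType d) (R : realType) (mu : {measure set T -> \bar R}).
Local Open Scope ereal_scope.

Lemma measurable_fun_powR (f : T -> R) (q : R) (D : set T) : measurable_fun D f ->
  measurable_fun D (fun x => f x `^ q)%R.
Proof.
by move=> mf; exact: (@measurableT_comp _ _ _ _ _ _ (@powR R ^~ q)).
Qed.

Lemma measurable_norm_powR (f : T -> R) (q : R) (D : set T) : measurable_fun D f ->
  measurable_fun D (fun x => (`|f x| `^ q)%:E).
Proof.
move=> mf; apply/measurable_EFinP/measurable_fun_powR; exact: measurableT_comp.
Qed.

(** Hoelder's inequality against the indicator function of D. *)
Lemma le_integral_powR (p : R) (f : T -> R) (D : set T) : (1 < p)%R ->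
  measurable D -> measurable_fun setT f -> (forall x, 0 <= f x)%R ->
  \int[mu]_(x in D) (f x)%:E <=
    (\int[mu]_(x in D) (f x `^ p)%:E) `^ p^-1 * (mu D) `^ (1 - p^-1).
Proof.
move=> p1 mD mf f0; have p0 : (0 < p)%R by lra.
pose q := ((1 - p^-1)^-1)%R.
have p1' : (p^-1 < 1)%R by rewrite invf_lt1.
have q0 : (0 < q)%R by rewrite invr_gt0 subr_gt0.
have mfD : measurable_fun setT (f \_ D).
  by apply/(measurable_restrictT _ _).1 => //; exact: measurable_funTS.
have m1 : measurable_fun setT (\1_D : T -> R) by exact: measurable_indic.
have := @hoelder _ _ _ mu (f \_ D) (\1_D) p q mfD m1 p0 q0 _.
rewrite invrK addrC subrK => /(_ erefl).
rewrite Lnorm1 unlock invrK.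
rewrite [X in X <= _ -> _](_ : _ = \int[mu]_(x in D) (f x)%:E); last first.
  rewrite [RHS]integral_mkcond; apply: eq_integral => x _.
  rewrite /= !patchE indicE; case: ifP => _; rewrite ?mulr1 ?mul0r ?normr0//.
  by rewrite ger0_norm.
rewrite [X in _ <= X `^ _ * _ -> _](_ : _ = \int[mu]_(x in D) (f x `^ p)%:E); last first.
  rewrite [RHS]integral_mkcond; apply: eq_integral => x _.
  rewrite /= !patchE; case: ifP => _; rewrite ?ger0_norm//.
  by rewrite ?abse0 ?normr0 ?poweR_EFin ?powR0 ?gt_eqF//.
rewrite [X in _ <= _ * X `^ _ -> _](_ : _ = mu D)//.
rewrite -[in RHS](setIT D) -integral_indic//; apply: eq_integral => x _ /=.
rewrite indicE; case: (_ \in _); rewrite /= ?normr1 ?normr0 ?powR1 ?powR0//.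
by rewrite gt_eqF.
Qed.

End jensen.

(** * Volumes of control balls and averages on them *)

Section rational_dense.
Context {R : realType} {N : nat}.

Lemma rational_dense (x : 'rV[R]_N) (U : set 'rV[R]_N) : nbhs x U ->
  exists c : 'rV[rat]_N, U (map_mx ratr c).
Proof.
move=> /rational_box[a [b [xab abU]]]; exists b; apply: abU => i.
by have /andP[h1 h2] := xab i; rewrite lexx andbT (lt_le_trans h1).
Qed.

(** A bounded open set is disjoint from its translate by a large vector, so the
    union of the two has twice the measure.  In dimension 0 there is no such
    translate. *)
Lemma double_measure (Omega : set 'rV[R]_N) : (0 < N)%N -> open Omega ->
  bounded_set Omega -> exists E : set 'rV[R]_N,
  [/\ bounded_set E, Omega `<=` E, open E &
    (2%:E * lebesgueN Omega <= lebesgueN E)%E].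
Proof.
move=> N0 oO [M [_ /(_ (M + 1))]]; rewrite ltrDl ltr01 => /(_ isT) OM.
set K := M + 1 in OM.
have Ki x (i : 'I_N) : Omega x -> `|x ord0 i| <= K.
  move=> /OM /=; rewrite {1}/Num.norm/= mx_normrE; apply: le_trans.
  by apply/bigmax_geP; right => /=; exists (ord0, i).
(* Omega lies in the cube of half-side K, so this translation moves it away. *)
pose c : 'rV[R]_N := const_mx (2 * K + 1).
pose sh (x : 'rV[R]_N) := x + c.
have oS : open (sh @` Omega).
  have -> : sh @` Omega = (fun x => x - c) @^-1` Omega.
    apply/seteqP; split=> [_ [x Ox <-]|x Ox]; first by rewrite /= /sh addrK.
    by exists (x - c) => //; rewrite /sh subrK.
  apply: open_comp => // x _.
  have : {for x, continuous (id - cst c : 'rV[R]_N -> 'rV[R]_N)}.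
    by apply: continuousB; [move=> U; exact|exact: cst_continuous].
  by [].
exists (Omega `|` sh @` Omega); split.
- exists (`|K| + `|c|); split; first by rewrite num_real.
  move=> k Kk x [Ox|[y Oy <-]].
    apply: le_trans (OM _ Ox) _; apply: le_trans (ltW Kk).
    by rewrite (le_trans (ler_norm _))// lerDl.
  apply: le_trans (ler_normD _ _) _; apply: le_trans (ltW Kk); rewrite lerD2r.
  by apply: le_trans (OM _ Oy) _; exact: ler_norm.
- exact: subsetUl.
- exact: openU.
- have mS : lebesgueN (sh @` Omega) = lebesgueN Omega by exact: lebesgue_outer_shift.
  rewrite measureU; last 3 first.
  + exact: open_measurableN.
  + exact: open_measurableN.
  + apply/seteqP; split=> // z [Oz [y Oy /= yz]]; move: Oz; rewrite -yz => Ox.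
    have := Ki _ (Ordinal N0) Ox; have := Ki _ (Ordinal N0) Oy.
    by rewrite /sh !mxE !ler_norml; lra.
  rewrite mule_natl mule2n; apply: leeD; first exact: lexx.
  by rewrite le_eqVlt; apply/orP; left; apply/eqP; exact/esym/mS.
Qed.

End rational_dense.

Section ball_measure.
Context {R : realType} {N d : nat} (X : 'rV[R]_N -> 'M[R]_(d, N)) (Q : R).
Hypothesis SA : standing_assumptions X Q.
Local Notation mu := (@lebesgueN R N).
Local Notation B := (cc_ball X).
Let conn := sa_connected SA.
Let top := sa_topology SA.

Lemma cc_ball_measurable x r :
  measurable (B x r : set (caratheodory_type (@lebesgue_outer R N))).
Proof. exact/open_measurableN/cc_ball_open. Qed.

Lemma cc_ball_gt0 x r : 0 < r -> (0 < mu (B x r))%E.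
Proof.
move=> r0; have := @sa_doubling _ _ _ _ _ SA x (r / 2).
have -> : 2 * (r / 2) = r by field.
by move=> /(_ ltac:(by rewrite divr_gt0))/andP[].
Qed.

(** A small ball is bounded because the topologies agree, and doubling propagates
    finiteness to every radius. *)
Lemma cc_ball_lty x r : (mu (B x r) < +oo)%E.
Proof.
have [e e0 eU] := nbhs_cc_dist conn top (nbhsx_ballx x 1 ltr01).
have H n : (mu (B x (2 ^+ n * e)) < +oo)%E.
  elim: n => [|n IH].
    rewrite expr0 mul1r; apply: bounded_lty.
    exists (`|x| + 1); split; first by rewrite num_real.
    move=> k xk y /eU; rewrite -ball_normE/= => xy.
    rewrite -[y](subrK x) (le_trans (ler_normD _ _))// (le_trans _ (ltW xk))//.
    by rewrite addrC lerD2l distrC ltW.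
  have /andP[_] := @sa_doubling _ _ _ _ _ SA x (2 ^+ n * e) ltac:(by rewrite mulr_gt0 ?exprn_gt0).
  rewrite mulrA -exprS => /le_lt_trans; apply.
  by rewrite lte_mul_pinfty// lee_fin powR_ge0.
have [n rn] : exists n : nat, r <= 2 ^+ n * e.
  exists (Num.bound (r / e)); rewrite -ler_pdivrMr//.
  have [A0|A0] := leP 0 (r / e); last by rewrite (le_trans (ltW A0))// exprn_ge0.
  apply: (le_trans (ltW (archi_boundP A0))).
  by rewrite -natrX ler_nat ltnW// ltn_expl.
apply: le_lt_trans (H n); apply: le_measure; rewrite ?inE; try exact: cc_ball_measurable.
by move=> y; rewrite /cc_ball/= => /lt_le_trans; apply.
Qed.

Definition cc_volume x r : R := fine (mu (B x r)).
Local Notation V := cc_volume.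

Lemma cc_volumeE x r : mu (B x r) = (V x r)%:E.
Proof. by rewrite fineK// ge0_fin_numE// cc_ball_lty. Qed.

Lemma cc_volume_gt0 x r : 0 < r -> 0 < V x r.
Proof. by move=> /(cc_ball_gt0 x); rewrite cc_volumeE lte_fin. Qed.

Lemma cc_volume_double x r : 0 < r -> V x (2 * r) <= 2 `^ Q * V x r.
Proof.
by move=> /(@sa_doubling _ _ _ _ _ SA x)/andP[_]; rewrite !cc_volumeE -EFinM lee_fin.
Qed.

Lemma cc_volume_sub (E : set 'rV[R]_N) x r : open E -> B x r `<=` E ->
  ((V x r)%:E <= mu E)%E.
Proof.
move=> oE BE; rewrite -cc_volumeE; apply: le_measure => //; rewrite inE.
  exact: cc_ball_measurable.
exact: open_measurableN.
Qed.

Lemma cc_volume_mono x y r s : cc_dist X x y + r <= s -> V y r <= V x s.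
Proof.
move=> h; rewrite -lee_fin -(cc_volumeE x); apply: cc_volume_sub; first exact: cc_ball_open.
exact: cc_ball_sub.
Qed.

Lemma cc_volume_halves x r i : 0 < r -> V x r <= (2 ^+ i) `^ Q * V x (r / 2 ^+ i).
Proof.
move=> r0; elim: i => [|i IH]; first by rewrite expr0 divr1 powR1 mul1r.
apply: le_trans IH _; rewrite exprS powRM//.
rewrite [2 `^ Q * _]mulrC -mulrA ler_wpM2l ?powR_ge0//.
have -> : r / 2 ^+ i = 2 * (r / (2 * 2 ^+ i)).
  by have := exprn_gt0 i (ltr0Sn R 1) => h; field; lra.
by apply: cc_volume_double; rewrite divr_gt0// mulr_gt0 ?exprn_gt0.
Qed.

Definition cc_avg x r (f : 'rV[R]_N -> R) : R := (V x r)^-1 * \int[mu]_(y in B x r) f y.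
Local Notation avg := cc_avg.

Local Notation T := (caratheodory_type (@lebesgue_outer R N)).

(** A class of functions that are integrable on every control ball and stable
    under the operations used below. *)
Definition bounded_meas (f : 'rV[R]_N -> R) :=
  measurable_fun [set: T] (f : T -> R) /\ exists M, forall x, `|f x| <= M.

Lemma bounded_meas_integrable f (E : set T) : bounded_meas f -> measurable E ->
  (mu E < +oo)%E -> mu.-integrable E (EFin \o f).
Proof.
move=> [mf [M fM]] mE Efin; apply: measurable_bounded_integrable => //.
  exact: measurable_funTS.
exists M; split; first exact: num_real.
by move=> k Mk x _ /=; rewrite (le_trans (fM x))// ltW.
Qed.

Lemma bounded_meas_integrable_ball f x r : bounded_meas f -> mu.-integrable (B x r : set T) (EFin \o f).
Proof.
move=> bf; apply: bounded_meas_integrable => //; first exact: cc_ball_measurable.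
exact: cc_ball_lty.
Qed.

Lemma bounded_meas_cst c : bounded_meas (fun=> c).
Proof. by split; [exact: measurable_cst|exists `|c|]. Qed.

Lemma bounded_meas_norm f : bounded_meas f -> bounded_meas (fun x => `|f x|).
Proof.
move=> [mf [M fM]]; split; first exact: measurableT_comp.
by exists M => x; rewrite normr_id.
Qed.

Lemma bounded_measB f g : bounded_meas f -> bounded_meas g -> bounded_meas (fun x => f x - g x).
Proof.
move=> [mf [M fM]] [mg [M' gM]]; split; first exact: measurable_funB.
by exists (M + M') => x; rewrite (le_trans (ler_normB _ _))// lerD.
Qed.

Lemma averageE f x r : bounded_meas f -> average (B x r) f = (avg x r f)%:E.
Proof.
move=> bf; rewrite /average /avg EFinM; congr (_ * _)%E.
rewrite fineK//; apply: integrable_fin_num.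
  exact: cc_ball_measurable.
exact: bounded_meas_integrable_ball.
Qed.

Lemma avg_cst x r c : 0 < r -> avg x r (fun=> c) = c.
Proof.
move=> r0; rewrite /avg Rintegral_cst; last exact: cc_ball_measurable.
by rewrite mulrCA -/(V x r) mulVf ?mulr1// gt_eqF// cc_volume_gt0.
Qed.

Lemma avgB x r f g : bounded_meas f -> bounded_meas g ->
  avg x r (fun y => f y - g y) = avg x r f - avg x r g.
Proof.
move=> bf bg; rewrite /avg RintegralB ?mulrBr//.
- exact: cc_ball_measurable.
- exact: bounded_meas_integrable_ball.
- exact: bounded_meas_integrable_ball.
Qed.

Lemma le_avg x r f g : 0 < r -> bounded_meas f -> bounded_meas g ->
  (forall y, B x r y -> f y <= g y) -> avg x r f <= avg x r g.
Proof.
move=> r0 bf bg fg; rewrite /avg ler_pM2l ?invr_gt0 ?cc_volume_gt0//.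
apply: le_Rintegral => //.
- exact: cc_ball_measurable.
- exact: bounded_meas_integrable_ball.
- exact: bounded_meas_integrable_ball.
Qed.

Lemma avg_ge0 x r f : (forall y, 0 <= f y) -> 0 <= avg x r f.
Proof.
move=> f0; apply: mulr_ge0; first by rewrite invr_ge0 fine_ge0.
by apply: Rintegral_ge0.
Qed.

Lemma norm_avg x r f : 0 < r -> bounded_meas f -> `|avg x r f| <= avg x r (fun y => `|f y|).
Proof.
move=> r0 bf; rewrite /avg normrM ger0_norm ?invr_ge0 ?fine_ge0//.
rewrite ler_pM2l ?invr_gt0 ?cc_volume_gt0//; apply: le_normr_Rintegral.
- exact: cc_ball_measurable.
- exact: bounded_meas_integrable_ball.
Qed.

(** Passing to a larger ball of comparable volume costs a factor K; this is the
    form in which doubling is used. *)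
Lemma avg_enlarge x y r s K f : 0 < r -> 0 < s -> bounded_meas f -> (forall z, 0 <= f z) ->
  B x r `<=` B y s -> V y s <= K * V x r -> avg x r f <= K * avg y s f.
Proof.
move=> r0 s0 bf f0 sub VK.
have I : \int[mu]_(z in B x r) f z <= \int[mu]_(z in B y s) f z.
  apply: fine_le.
  - apply: integrable_fin_num; [exact: cc_ball_measurable|exact: bounded_meas_integrable_ball].
  - apply: integrable_fin_num; [exact: cc_ball_measurable|exact: bounded_meas_integrable_ball].
  - apply: ge0_subset_integral => //; try exact: cc_ball_measurable.
    + apply/measurable_EFinP/measurable_funTS; by case: bf.
    + by move=> z _; rewrite lee_fin.
rewrite /avg mulrA.
apply: (@le_trans _ _ ((V x r)^-1 * \int[mu]_(z in B y s) f z)).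
  by rewrite ler_pM2l// invr_gt0 cc_volume_gt0.
apply: ler_wpM2r; first by apply: Rintegral_ge0.
have Vx := cc_volume_gt0 x r0; have Vy := cc_volume_gt0 y s0.
by rewrite ler_pdivlMr// mulrC ler_pdivrMr.
Qed.

End ball_measure.

(** * Pointwise control of a function by the maximal function of its gradient *)

Section potential_estimate.
Context {R : realType} {N d : nat} (X : 'rV[R]_N -> 'M[R]_(d, N)) (Q : R).
Hypothesis SA : standing_assumptions X Q.
Local Notation mu := (@lebesgueN R N).
Local Notation B := (cc_ball X).
Local Notation V := (cc_volume X).
Local Notation avg := (cc_avg X).
Let conn := sa_connected SA.
Let top := sa_topology SA.

(** The difference of two consecutive averages is at most the average, over the
    smaller ball, of the deviation from the mean on the larger one.  Doubling
    moves this average to the larger ball, where Poincare applies. *)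
Lemma telescoping (CP nu : R) (phi : 'rV[R]_N -> R) (g : 'rV[R]_N -> R) (x : 'rV[R]_N) (r : R) n :
  0 < nu -> 0 <= CP -> 0 < r -> bounded_meas phi -> bounded_meas g -> (forall y, 0 <= g y) ->
  (forall r, 0 < r -> avg x r (fun y => `|phi y - avg x r phi|) <=
     CP * r * avg x (nu * r) g) ->
  `|avg x r phi - avg x (r / 2 ^+ n) phi| <=
    2 `^ Q * CP * r * \sum_(i < n) (2 ^+ i)^-1 * avg x (nu * (r / 2 ^+ i)) g.
Proof.
move=> nu0 CP0 r0 bphi bg g0 P.
elim: n => [|n IH]; first by rewrite expr0 divr1 subrr normr0 big_ord0 mulr0.
rewrite big_ord_recr/= mulrDr.
have rn0 : 0 < r / 2 ^+ n by rewrite divr_gt0 ?exprn_gt0.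
have rn10 : 0 < r / 2 ^+ n.+1 by rewrite divr_gt0 ?exprn_gt0.
have rnE : r / 2 ^+ n = 2 * (r / 2 ^+ n.+1).
  by rewrite exprS; have := exprn_gt0 n (ltr0Sn R 1) => h; field; lra.
set c := avg x (r / 2 ^+ n) phi in IH *.
apply: le_trans (ler_distD c _ _) _; apply: lerD => //.
have bc : bounded_meas (fun y => phi y - c) by apply: bounded_measB => //; exact: bounded_meas_cst.
rewrite distrC -{1}(avg_cst SA x c rn10 : avg x (r / 2 ^+ n.+1) (fun=> c) = c).
rewrite -(avgB SA)//; last exact: bounded_meas_cst.
apply: le_trans (norm_avg SA _ rn10 bc) _.
apply: (@le_trans _ _ (2 `^ Q * avg x (r / 2 ^+ n) (fun y => `|phi y - c|))).
  apply: (avg_enlarge SA).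
  - exact: rn10.
  - exact: rn0.
  - exact: bounded_meas_norm.
  - by move=> z; exact: normr_ge0.
  - by apply: (cc_ball_sub conn); rewrite (cc_dist_xx conn) add0r rnE; lra.
  - by rewrite rnE; exact: (cc_volume_double SA).
rewrite -!mulrA ler_wpM2l ?powR_ge0//.
have := P _ rn0; rewrite -/c => /le_trans; apply.
by rewrite !mulrA.
Qed.

Lemma lebesgue_point (phi : 'rV[R]_N -> R) (x : 'rV[R]_N) (r e : R) :
  {for x, continuous phi} -> bounded_meas phi -> 0 < r -> 0 < e ->
  exists n, `|avg x (r / 2 ^+ n) phi - phi x| <= e.
Proof.
move=> cphi bphi r0 e0.
have /(nbhs_cc_dist conn top)[s s0 sU] : nbhs x [set y | `|phi x - phi y| < e].
  by move/cvgrPdist_lt: cphi; exact.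
have [n rn] : exists n : nat, r / 2 ^+ n <= s.
  exists (Num.bound (r / s)); rewrite ler_pdivrMr ?exprn_gt0// mulrC -ler_pdivrMr//.
  apply: (le_trans (ltW (archi_boundP _))); first by rewrite divr_ge0// ltW.
  by rewrite -natrX ler_nat ltnW// ltn_expl.
exists n; set q := r / 2 ^+ n in rn *.
have q0 : 0 < q by rewrite divr_gt0 ?exprn_gt0.
rewrite -{1}(avg_cst SA x (phi x) q0 : avg x q (fun=> phi x) = phi x).
have bc : bounded_meas (fun y => phi y - phi x) by apply: bounded_measB => //; exact: bounded_meas_cst.
rewrite -(avgB SA)//; last exact: bounded_meas_cst.
apply: le_trans (norm_avg SA _ q0 bc) _.
rewrite -[leRHS](avg_cst SA x e q0); apply: (le_avg SA).
- exact: q0.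
- exact: bounded_meas_norm.
- exact: bounded_meas_cst.
- move=> y xy; rewrite distrC; apply/ltW; apply: sU.
  by rewrite /cc_ball/=; apply: lt_le_trans rn.
Qed.

Definition family_index k : 'rV[rat]_N * nat := odflt (0, 0%N) (unpickle k).
Definition family_center k : 'rV[R]_N := map_mx ratr (family_index k).1.
(** Every ball of radius rho / 2^i lies in a ball of twice the radius centred at
    a rational point, hence the factor 2. *)
Definition family_radius (rho : R) k := 2 * (rho / 2 ^+ (family_index k).2).

(** A countable family keeps the supremum measurable; [avg_le_ball_maximal]
    recovers the averages on balls with arbitrary centres. *)
Definition ball_maximal (rho : R) (g : 'rV[R]_N -> R) : 'rV[R]_N -> R :=
  maximal (fun k => B (family_center k) (family_radius rho k)
      : set (caratheodory_type (@lebesgue_outer R N)))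
    (fun k => avg (family_center k) (family_radius rho k) g).

Lemma family_radius_gt0 rho k : 0 < rho -> 0 < family_radius rho k.
Proof. by move=> rho0; rewrite mulr_gt0// divr_gt0// exprn_gt0. Qed.

Section maximal_of_g.
Variables (rho : R) (g : 'rV[R]_N -> R) (A : R).
Hypotheses (rho0 : 0 < rho) (bg : bounded_meas g) (g0 : forall y, 0 <= g y)
  (gA : forall y, g y <= A).

Let K : R := (2 `^ Q) ^+ 2.

Lemma cc_volume_quadruple x r : 0 < r -> V x (4 * r) <= K * V x r.
Proof.
move=> r0; have -> : 4 * r = 2 * (2 * r) by ring.
apply: le_trans (cc_volume_double SA _ _) _; first by rewrite mulr_gt0.
by rewrite /K expr2 -mulrA ler_wpM2l ?powR_ge0// (cc_volume_double SA).
Qed.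

Let T := caratheodory_type (@lebesgue_outer R N).
Let Bf k : set T := B (family_center k) (family_radius rho k).
Let a k := avg (family_center k) (family_radius rho k) g.

Lemma family_avg_bounds k : 0 <= a k <= A.
Proof.
have h := family_radius_gt0 k rho0.
rewrite avg_ge0//= -[leRHS](avg_cst SA (family_center k) A h).
by apply: (le_avg SA) => //; exact: bounded_meas_cst.
Qed.

Lemma avg_le_ball_maximal x i :
  avg x (rho / 2 ^+ i) g <= K * ball_maximal rho g x.
Proof.
set r := rho / 2 ^+ i; have r0 : 0 < r by rewrite divr_gt0// exprn_gt0.
have [c xc] := rational_dense (nbhs_cc_ball conn top x r0).
pose k := pickle (c, i).
have cE : family_center k = map_mx ratr c by rewrite /family_center /family_index pickleK.
have rE : family_radius rho k = 2 * r by rewrite /family_radius /family_index pickleK.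
have d0 : cc_dist X x (map_mx ratr c) < r by [].
apply: (@le_trans _ _ (K * a k)).
  rewrite /a cE rE; apply: (avg_enlarge SA) => //.
  - by rewrite mulr_gt0.
  - apply: cc_ball_sub => //; rewrite cc_dist_sym//; lra.
  - apply: le_trans (cc_volume_quadruple x r0); apply: (cc_volume_mono SA); lra.
apply: ler_wpM2l; first by rewrite exprn_ge0 ?powR_ge0.
apply: (@le_maximal _ T R Bf A a _ _ k).
- by move=> j; have /andP[] := family_avg_bounds j.
- by move=> j; have /andP[] := family_avg_bounds j.
- by rewrite /Bf cE rE /cc_ball/= cc_dist_sym//; lra.
Qed.

Lemma ball_maximal_bounds x : 0 <= ball_maximal rho g x <= A.
Proof.
by apply/andP; split; [apply: (@maximal_ge0 _ T R Bf A a)|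
  apply: (@maximal_le _ T R Bf A a)] => j; have /andP[] := family_avg_bounds j.
Qed.

Lemma measurable_ball_maximal :
  measurable_fun [set: caratheodory_type (@lebesgue_outer R N)] (ball_maximal rho g).
Proof.
apply: (@measurable_maximal _ T R Bf A a).
- by move=> i; exact: (cc_ball_measurable SA).
- by move=> j; have /andP[] := family_avg_bounds j.
- by move=> j; have /andP[] := family_avg_bounds j.
Qed.

(** If B(x, r) meets B(y, s) and r <= s, the triangle inequality places B(x, r) in
    B(y, 3 s); enlarging by 4 instead lets the doubling property apply twice. *)
Lemma ball_maximal_weak l : 0 < l ->
  (mu [set x | (l < ball_maximal rho g x)%R] <=
    (K * (2 / l))%:E * \int[mu]_(x in [set x | (l / 2 < g x)%R]) (g x)%:E)%E.
Proof.
apply: (@maximal_weak_type _ T R mu Bf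
  (fun k => B (family_center k) (4 * family_radius rho k)
      : set (caratheodory_type (@lebesgue_outer R N))) (family_radius rho) K g A a).
- by move=> i; exact: (cc_ball_measurable SA).
- by move=> i; exact: (cc_ball_measurable SA).
- by move=> i; exact: (cc_ball_lty SA).
- move=> i; rewrite !(cc_volumeE SA) -EFinM lee_fin; apply: cc_volume_quadruple.
  exact: family_radius_gt0.
- move=> i; apply: cc_ball_sub => //; rewrite cc_dist_xx// add0r.
  by have := family_radius_gt0 i rho0; lra.
- move=> i j rij [z []]; rewrite /Bf /cc_ball/= => iz jz.
  apply: cc_ball_sub => //.
  have := cc_dist_triangle conn z (family_center j) (family_center i).
  have := family_radius_gt0 j rho0.
  rewrite (cc_dist_sym conn z); lra.
- by rewrite exprn_ge0 ?powR_ge0.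
- by case: bg.
- exact: g0.
- by move=> j; have /andP[] := family_avg_bounds j.
- by move=> j; have /andP[] := family_avg_bounds j.
- move=> k; have := averageE SA (family_center k) (family_radius rho k) bg.
  rewrite /average => /esym E; rewrite E.
  rewrite muleAC -/(V _ _) (cc_volumeE SA) -EFinM mulVf ?mul1e//.
  by rewrite gt_eqF// (cc_volume_gt0 SA)//; exact: family_radius_gt0.
Qed.

End maximal_of_g.

End potential_estimate.

(** * Absorption of the mean *)

Section absorption.
Context d (T : measurableType d) (R : realType) (mu : {measure set T -> \bar R}).

(** Integrating the pointwise inequality over D, the term with the mean of |phi|
    returns with the factor mu(D) / b <= 1 / 2 and is absorbed on the left.
    Then the mean is bounded by that of P, hence by the L^q norm of P, and the
    pointwise inequality gives the claim. *)
Lemma absorption (D : set T) (q b : R) (phi P : T -> R) (A : R) :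
  1 < q -> 0 < b -> measurable D -> (2%:E * mu D <= b%:E)%E ->
  measurable_fun setT phi -> measurable_fun setT P ->
  (forall x, `|phi x| <= A) -> (forall x, 0 <= P x <= A) ->
  (forall x, D x -> `|phi x| <= b^-1 * \int[mu]_(y in D) `|phi y| + P x) ->
  (\int[mu]_(x in D) (`|phi x| `^ q)%:E <=
   (2 `^ (q + 1))%:E * \int[mu]_(x in D) (P x `^ q)%:E)%E.
Proof.
move=> q1 b0 mD Db mphi mP phiA PA phiP.
have q0 : 0 < q by lra.
have Dfin : (mu D < +oo)%E.
  by rewrite ltey; apply/eqP => Doo; move: Db; rewrite Doo gt0_muley ?lte_fin.
have int (f : T -> R) : measurable_fun setT f -> (exists M, forall x, `|f x| <= M) ->
    mu.-integrable D (EFin \o f).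
  move=> mf [M fM]; apply: measurable_bounded_integrable => //.
    exact: measurable_funTS.
  by exists M; split; [exact: num_real|move=> k Mk x _ /=; rewrite (le_trans (fM x))// ltW].
have P0 x : 0 <= P x by have /andP[] := PA x.
have mpow (f : T -> R) : measurable_fun setT f -> measurable_fun setT (fun x => f x `^ q).
  by move=> mf; exact: (@measurableT_comp _ _ _ _ _ _ (@powR R ^~ q)).
have iphi : mu.-integrable D (EFin \o (fun x => `|phi x|)).
  apply: int; first exact: measurableT_comp.
  by exists A => x; rewrite normr_id.
have iP : mu.-integrable D (EFin \o P).
  by apply: int => //; exists A => x; rewrite ger0_norm//; have /andP[] := PA x.
have iPq : mu.-integrable D (EFin \o (fun x => P x `^ q)).
  apply: int; first exact: mpow.
  exists (A `^ q) => x; rewrite ger0_norm ?powR_ge0//.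
  by rewrite ge0_ler_powR ?nnegrE ?(le_trans (normr_ge0 _) (phiA x)) ?(ltW q0)//; have /andP[] := PA x.
set I := \int[mu]_(y in D) `|phi y| in phiP.
pose w := fine (mu D); have wE : mu D = w%:E by rewrite fineK// ge0_fin_numE.
have w0 : 0 <= w by rewrite fine_ge0.
have wb : 2 * w <= b by move: Db; rewrite wE -EFinM lee_fin.
have I0 : 0 <= I by apply: Rintegral_ge0.
pose J := \int[mu]_(x in D) (P x `^ q).
have J0 : 0 <= J by apply: Rintegral_ge0 => x _; exact: powR_ge0.
have JE : (\int[mu]_(x in D) (P x `^ q)%:E)%E = J%:E.
  by rewrite fineK//; exact: integrable_fin_num.
pose IP := \int[mu]_(x in D) P x.
have IP0 : 0 <= IP by apply: Rintegral_ge0.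
have h1 : I <= w * (b^-1 * I) + IP.
  apply: (@le_trans _ _ (\int[mu]_(x in D) (b^-1 * I + P x))).
    apply: le_Rintegral => //.
    apply: int; first exact: measurable_funD.
    exists (`|b^-1 * I| + A) => x; rewrite (le_trans (ler_normD _ _))// lerD2l.
    by rewrite ger0_norm//; have /andP[] := PA x.
  rewrite RintegralD//; last first.
    by apply: int => //; exists (`|b^-1 * I|).
  by rewrite Rintegral_cst// mulrC.
have h2 : b^-1 * I <= 2 / b * IP.
  have : w * (b^-1 * I) <= 2^-1 * I.
    rewrite mulrA ler_wpM2r// ler_pdivrMr//; lra.
  move=> h; rewrite [2 / b]mulrC -mulrA ler_pM2l ?invr_gt0//; lra.
have h3 : IP <= J `^ q^-1 * w `^ (1 - q^-1).
  have := le_integral_powR mu q1 mD mP P0.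
  rewrite JE wE -[X in (X <= _)%E -> _]fineK; last exact: integrable_fin_num.
  by rewrite !poweR_EFin -EFinM lee_fin.
have h4 : (b^-1 * I) `^ q * w <= J.
  apply: (@le_trans _ _ ((2 / b * (J `^ q^-1 * w `^ (1 - q^-1))) `^ q * w)).
    apply: ler_wpM2r => //; apply: ge0_ler_powR; rewrite ?nnegrE.
    - exact: ltW.
    - by rewrite mulr_ge0// invr_ge0 ltW.
    - by rewrite !mulr_ge0 ?powR_ge0// invr_ge0 ltW.
    - apply: le_trans h2 _; apply: ler_wpM2l => //.
      by rewrite mulr_ge0// invr_ge0 ltW.
  rewrite powRM ?mulr_ge0 ?powR_ge0 ?invr_ge0 ?(ltW b0)//.
  rewrite powRM ?powR_ge0// -!powRrM mulVf ?gt_eqF// powRr1// mulrBl mul1r mulVf ?gt_eqF//.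
  have -> : (2 / b) `^ q * (J * w `^ (q - 1)) * w = J * ((2 / b) `^ q * (w * w `^ (q - 1))) by ring.
  rewrite mulr_powRB1// -powRM//; last by rewrite mulr_ge0// invr_ge0 ltW.
  rewrite -[leRHS]mulr1; apply: ler_wpM2l => //.
  have E : 1 `^ q = 1 :> R by rewrite powR1.
  rewrite -[leRHS]E; apply: ge0_ler_powR; rewrite ?nnegrE//; first exact: ltW.
    by rewrite !mulr_ge0// invr_ge0 ltW.
  by rewrite mulrAC ler_pdivrMr// mul1r.
apply: (@le_trans _ _ (\int[mu]_(x in D) (2 `^ q * (b^-1 * I) `^ q + 2 `^ q * P x `^ q)%:E)%E).
  apply: ge0_le_integral => //.
  - by apply/measurable_EFinP/measurable_funTS/mpow; exact: measurableT_comp.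
  - apply/measurable_EFinP/measurable_funTS/measurable_funD => //.
    by apply: measurable_funM => //; exact: mpow.
  - move=> x Dx; rewrite lee_fin.
    have t0 : 0 <= b^-1 * I by rewrite mulr_ge0// invr_ge0 ltW.
    have H u v : 0 <= u -> u <= v -> (u + v) `^ q <= 2 `^ q * v `^ q.
      move=> u0 uv; rewrite -powRM//; last by rewrite (le_trans u0).
      apply: ge0_ler_powR; rewrite ?nnegrE; [exact: ltW|lra|lra|lra].
    apply: (@le_trans _ _ ((b^-1 * I + P x) `^ q)).
      apply: ge0_ler_powR; rewrite ?nnegrE//; first exact: ltW.
        by rewrite addr_ge0.
      exact: phiP.
    have [h|h] := leP (b^-1 * I) (P x).
      by apply: le_trans (H _ _ t0 h) _; rewrite lerDr mulr_ge0 ?powR_ge0.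
    rewrite addrC; apply: le_trans (H _ _ (P0 x) (ltW h)) _.
    by rewrite lerDl mulr_ge0 ?powR_ge0.
under eq_integral do rewrite EFinD.
rewrite ge0_integralD//; last 3 first.
- by move=> x _; rewrite lee_fin mulr_ge0 ?powR_ge0.
- by move=> x _; rewrite lee_fin mulr_ge0 ?powR_ge0.
- by apply/measurable_EFinP/measurable_funTS/measurable_funM => //; exact: mpow.
rewrite (integral_cst mu mD (2 `^ q * (b^-1 * I) `^ q)%:E) wE.
under eq_integral do rewrite EFinM.
rewrite ge0_integralZl_EFin ?powR_ge0//; last 2 first.
- by move=> x _; rewrite lee_fin powR_ge0.
- by apply/measurable_EFinP/measurable_funTS/mpow.
rewrite JE -!EFinM -EFinD lee_fin powRD; last by rewrite pnatr_eq0 implybT.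
rewrite powRr1// -mulrA -mulrDr -mulrA ler_wpM2l ?powR_ge0//; lra.
Qed.

End absorption.

(** * The Sobolev inequality for smooth functions *)

Section sobolev_smooth.
Context {R : realType} {N d : nat} (X : 'rV[R]_N -> 'M[R]_(d, N)) (Q p : R).
Hypothesis SA : standing_assumptions X Q.
Hypotheses (p1 : 1 < p) (pQ : p < Q).
Local Notation mu := (@lebesgueN R N).
Local Notation B := (cc_ball X).
Local Notation V := (cc_volume X).
Local Notation avg := (cc_avg X).
Let conn := sa_connected SA.
Let top := sa_topology SA.
Let q := sobolev_exponent Q p.
Let p0 : 0 < p := lt_trans ltr01 p1.

Lemma avg_hoelder x r (g : 'rV[R]_N -> R) (G : R) : 0 < r -> bounded_meas g ->
  (forall y, 0 <= g y) -> (\int[mu]_y (g y `^ p)%:E <= G%:E)%E ->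
  avg x r g <= (G / V x r) `^ p^-1.
Proof.
move=> r0 bg g0 gG; have v0 := cc_volume_gt0 SA x r0.
have mB := cc_ball_measurable SA x r.
have [mg _] := bg.
have mgp : measurable_fun [set: caratheodory_type (@lebesgue_outer R N)] (fun y => (g y `^ p)%:E).
  by apply/measurable_EFinP; exact: (@measurableT_comp _ _ _ _ _ _ (@powR R ^~ p)).
have G0 : 0 <= G.
  by rewrite -lee_fin (le_trans _ gG)//; apply: integral_ge0 => y _; rewrite lee_fin powR_ge0.
have h : (\int[mu]_(y in B x r) (g y `^ p)%:E <= G%:E)%E.
  by apply: le_trans gG; apply: ge0_subset_integral => // y _; rewrite lee_fin powR_ge0.
have := le_integral_powR mu p1 mB mg g0.
rewrite (cc_volumeE SA) poweR_EFin.
have := averageE SA x r bg; rewrite /average -/(V x r).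
set J := (\int[mu]_(_ in _) (g _)%:E)%E => avE Jle.
rewrite -lee_fin -avE.
apply: (@le_trans _ _ ((V x r)^-1%:E * (G%:E `^ p^-1 * (V x r `^ (1 - p^-1))%:E))%E).
  apply: lee_wpmul2l; first by rewrite lee_fin invr_ge0 ltW.
  apply: le_trans Jle _; apply: lee_wpmul2r; first by rewrite lee_fin powR_ge0.
  apply: gt0_ler_poweR => //.
  - by rewrite invr_ge0 ltW.
  - have J0 : (0 <= \int[mu]_(y in B x r) (g y `^ p)%:E)%E.
      by apply: integral_ge0 => y _; rewrite lee_fin powR_ge0.
    by rewrite in_itv/= leey andbT; exact: J0.
  - by rewrite in_itv/= leey andbT lee_fin.
rewrite poweR_EFin -!EFinM lee_fin le_eqVlt; apply/orP; left; apply/eqP.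
rewrite powRM ?invr_ge0 ?(ltW v0)// powRB ?(gt_eqF v0) ?implybT// powRr1 ?(ltW v0)//.
rewrite powRV ?(ltW v0)//.
have := powR_gt0 p^-1 v0; move: (V x r `^ p^-1) => z z0.
by field; rewrite (gt_eqF z0) (gt_eqF v0).
Qed.

(** A only makes the integrals finite: the constant is uniform in phi, which is
    what allows the passage to the closure of the test functions. *)
Lemma sobolev_C1 (Omega : set 'rV[R]_N) : (0 < N)%N -> open Omega -> bounded_set Omega ->
  exists2 S0 : R, 0 <= S0 & forall (phi : 'rV[R]_N -> R) (A : R),
    let g := fun x => enorm (Xgrad X phi x) in
    C1_on setT phi -> continuous phi ->
    (forall x, `|phi x| <= A) -> (forall x, ~ Omega x -> phi x = 0) ->
    measurable_fun [set: caratheodory_type (@lebesgue_outer R N)] g ->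
    (forall x, g x <= A) -> (forall x, ~ Omega x -> g x = 0) ->
    (\int[mu]_(x in Omega) (`|phi x| `^ q)%:E <=
      S0%:E * (\int[mu]_(x in Omega) (g x `^ p)%:E) `^ (q / p))%E.
Proof.
move=> N0 oO bO.
have [CP [nu [CP0 nu0 Poin]]] := sa_poincare SA.
have [E [bE OE oE mE]] := double_measure N0 oO bO.
have [D0 D00 ED] := bounded_sub_cc_ball conn top (0 : 'rV[R]_N) bE.
have mO : measurable (Omega : set (caratheodory_type (@lebesgue_outer R N))).
  exact: open_measurableN.
have Ofin : (mu Omega < +oo)%E by exact: bounded_lty.
(* Both R0 and rho = nu R0 have to be at least 2 D0: a ball of such a radius
   centred in Omega contains the ball of centre 0 and radius D0, of measure b. *)
pose R0 := 2 * D0 * (1 + nu^-1); pose rho := nu * R0; pose b := V 0 D0.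
have nuV : 0 < nu^-1 by rewrite invr_gt0.
have R00 : 0 < R0 by rewrite !mulr_gt0//; lra.
have rho0 : 0 < rho by rewrite mulr_gt0.
have R0D : 2 * D0 <= R0 by rewrite /R0 ler_peMr//; lra.
have rhoD : 2 * D0 <= rho.
  have -> : rho = 2 * D0 * (nu + 1) by rewrite /rho /R0; field; lra.
  by rewrite ler_peMr//; lra.
have b0 : 0 < b by exact: (cc_volume_gt0 SA).
have bO2 : (2%:E * mu Omega <= b%:E)%E.
  apply: (le_trans mE); rewrite /b -(cc_volumeE SA); apply: le_measure => //; rewrite ?inE.
    exact: open_measurableN.
  exact: (cc_ball_measurable SA).
have Vb x r : Omega x -> 2 * D0 <= r -> b <= V x r.
  move=> /OE/ED; rewrite /cc_ball/= => xD Dr; apply: (cc_volume_mono SA).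
  by rewrite cc_dist_sym//; lra.
pose t := Q / p.
have t1 : 1 < t by rewrite /t ltr_pdivlMr// mul1r.
have [CH CH0 hedb] := hedberg_sum t1.
pose K : R := (2 `^ Q) ^+ 2.
have K0 : 0 <= K by rewrite exprn_ge0// powR_ge0.
have [CL CL0 layer] := @layer_cake _ (caratheodory_type (@lebesgue_outer R N)) R mu p K p1 K0.
pose c1 := 2 `^ Q * CP * R0 * CH.
have c10 : 0 <= c1.
  apply: mulr_ge0 => //; apply: mulr_ge0; last exact: ltW.
  by apply: mulr_ge0; [exact: powR_ge0|exact: ltW].
have q1 : 1 < q.
  rewrite /q /sobolev_exponent ltr_pdivlMr ?subr_gt0// mul1r.
  have : 0 < (p - 1) * Q by rewrite mulr_gt0 ?subr_gt0// (lt_trans p0).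
  by rewrite mulrBl mul1r subr_gt0; apply: le_lt_trans; rewrite gerBl ltW.
exists (2 `^ (q + 1) * (c1 `^ q * (K `^ p * (b^-1 `^ (q / Q) * CL)))).
  by rewrite !mulr_ge0 ?powR_ge0.
move=> phi A g C1phi cphi phiA phi0 mg gA g0.
have g_ge0 x : 0 <= g x by exact: enorm_ge0.
have A0 : 0 <= A by rewrite (le_trans _ (phiA 0)).
have bphi : bounded_meas phi by split; [exact: continuous_measurableN|exists A].
have bg : bounded_meas g by split => //; exists A => x; rewrite ger0_norm.
have poin x r : 0 < r ->
    avg x r (fun y => `|phi y - avg x r phi|) <= CP * r * avg x (nu * r) g.
  move=> r0; have := Poin x r r0 setT phi openT (fun _ _ => I) C1phi.
  rewrite /= (averageE SA _ _ bphi) /=.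
  have bd : bounded_meas (fun y => `|phi y - avg x r phi|).
    by apply/bounded_meas_norm/bounded_measB => //; exact: bounded_meas_cst.
  by rewrite (averageE SA _ _ bd) (averageE SA _ _ bg) -EFinM lee_fin.
have mgp (D : set (caratheodory_type (@lebesgue_outer R N))) : measurable_fun D (fun y => (g y `^ p)%:E).
  apply/measurable_EFinP/measurable_funTS.
  exact: (@measurableT_comp _ _ _ _ _ _ (@powR R ^~ p)).
have GE : (\int[mu]_x (g x `^ p)%:E = \int[mu]_(x in Omega) (g x `^ p)%:E)%E.
  rewrite [RHS]integral_mkcond; apply: eq_integral => x _; rewrite patchE.
  case: ifPn => //; rewrite notin_setE => /g0 ->.
  by rewrite powR0// gt_eqF.
pose G := fine (\int[mu]_(x in Omega) (g x `^ p)%:E)%E.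
have GfinE : (\int[mu]_(x in Omega) (g x `^ p)%:E)%E = G%:E.
  rewrite fineK//; apply: integrable_fin_num => //.
  apply: (measurable_bounded_integrable mO Ofin).
    by apply/measurable_EFinP; exact: mgp.
  exists (A `^ p); split; first exact: num_real.
  move=> k Ak x _ /=; rewrite (le_trans _ (ltW Ak))// ger0_norm ?powR_ge0//.
  by rewrite ge0_ler_powR ?nnegrE// ltW.
have G0 : 0 <= G by apply: fine_ge0; apply: integral_ge0 => x _; rewrite lee_fin powR_ge0.
pose M := ball_maximal X rho g.
have MA x : 0 <= M x <= A by exact: (ball_maximal_bounds SA rho0 bg g_ge0 gA).
have M0 x : 0 <= M x by have /andP[] := MA x.
have mM : measurable_fun [set: caratheodory_type (@lebesgue_outer R N)] M.
  exact: (measurable_ball_maximal SA rho0 bg g_ge0 gA).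
have intM : (\int[mu]_(x in Omega) (M x `^ p)%:E <= (CL * G)%:E)%E.
  rewrite EFinM -GfinE -GE; apply: (layer A) => // l l0.
  exact: (ball_maximal_weak SA rho0 bg g_ge0 gA).
pose L := (G / b) `^ p^-1.
have L0 : 0 <= L by exact: powR_ge0.
pose P x := c1 * ((K * M x) `^ (1 - t^-1) * L `^ t^-1).
have P_ge0 x : 0 <= P x.
  by apply: mulr_ge0 => //; apply: mulr_ge0; exact: powR_ge0.
have t0 : 0 < t := lt_trans ltr01 t1.
have ti1 : t^-1 < 1 by rewrite invf_lt1.
have avL x i : Omega x -> avg x (rho / 2 ^+ i) g <= (2 ^+ i) `^ t * L.
  move=> Ox; have ri : 0 < rho / 2 ^+ i by rewrite divr_gt0// exprn_gt0.
  apply: (le_trans (avg_hoelder _ ri bg g_ge0 _)); first by rewrite GE GfinE.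
  have -> : (2 ^+ i) `^ t * L = ((2 ^+ i) `^ Q * (G / b)) `^ p^-1.
    rewrite powRM ?powR_ge0//; last by rewrite divr_ge0// ltW.
    by rewrite -powRrM.
  have Vi := cc_volume_halves SA x i rho0.
  have Vi0 := cc_volume_gt0 SA x ri.
  have Q2 : 0 <= (2 ^+ i : R) `^ Q by exact: powR_ge0.
  apply: ge0_ler_powR; rewrite ?nnegrE.
  - by rewrite invr_ge0 ltW.
  - by rewrite divr_ge0// ltW.
  - by rewrite mulr_ge0// divr_ge0// ltW.
  - rewrite ler_pdivrMr// mulrAC mulrC.
    rewrite -[leLHS](divfK (lt0r_neq0 b0)); apply: ler_wpM2l.
      by rewrite divr_ge0// ltW.
    exact: le_trans (Vb _ _ Ox rhoD) Vi.
(* Hedberg's pointwise bound; n is chosen so that the n-th average is within e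
   of phi x. *)
have pw x : Omega x -> `|phi x| <= `|avg x R0 phi| + P x.
  move=> Ox; apply/ler_addgt0Pr => e e0.
  have [n Hn] := lebesgue_point SA (cphi x) bphi R00 e0.
  have Tn := telescoping SA n nu0 (ltW CP0) R00 bphi bg g_ge0 (poin x).
  have Sn : `|avg x R0 phi - avg x (R0 / 2 ^+ n) phi| <= P x.
    apply: le_trans Tn _; rewrite /P /c1 -[leRHS]mulrA; apply: ler_wpM2l.
      apply: mulr_ge0; last exact: ltW.
      by apply: mulr_ge0; [exact: powR_ge0|exact: ltW].
    apply: le_trans (hedb (K * M x) L n _ L0); last by rewrite mulr_ge0.
    apply: ler_sum => i _; apply: ler_wpM2l; first by rewrite invr_ge0 exprn_ge0.
    rewrite le_min mulrA -/rho avL// andbT.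
    exact: (avg_le_ball_maximal SA rho0 bg g_ge0 gA).
  have -> : phi x = avg x R0 phi + - (avg x R0 phi - avg x (R0 / 2 ^+ n) phi) +
     - (avg x (R0 / 2 ^+ n) phi - phi x) by ring.
  apply: le_trans (ler_normD _ _) _; rewrite normrN; apply: lerD => //.
  by apply: le_trans (ler_normD _ _) _; rewrite normrN lerD2l.
have bphi' := bounded_meas_norm bphi.
have avO x : Omega x -> `|avg x R0 phi| <= b^-1 * \int[mu]_(y in Omega) `|phi y|.
  move=> Ox; apply: le_trans (norm_avg SA _ R00 bphi) _.
  have VR := Vb _ _ Ox R0D.
  have phiE : (\int[mu]_y (`|phi y|)%:E = \int[mu]_(y in Omega) (`|phi y|)%:E)%E.
    rewrite [RHS]integral_mkcond; apply: eq_integral => y _; rewrite patchE.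
    by case: ifPn => //; rewrite notin_setE => /phi0 ->; rewrite normr0.
  have I1 : \int[mu]_(y in B x R0) `|phi y| <= \int[mu]_(y in Omega) `|phi y|.
    apply: fine_le.
    - apply: integrable_fin_num; first exact: (cc_ball_measurable SA).
      exact: (bounded_meas_integrable_ball SA).
    - by apply: integrable_fin_num => //; exact: bounded_meas_integrable.
    - rewrite -phiE; apply: ge0_subset_integral.
      + exact: (cc_ball_measurable SA).
      + exact: measurableT.
      + by apply/measurable_EFinP; case: bphi'.
      + by move=> y _; rewrite lee_fin.
      + exact: subsetT.
  apply: (@le_trans _ _ ((V x R0)^-1 * \int[mu]_(y in Omega) `|phi y|)).
    by apply: ler_wpM2l => //; rewrite invr_ge0 (le_trans _ VR)// ltW.
  apply: ler_wpM2r; first by apply: Rintegral_ge0.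
  by rewrite lef_pV2// posrE (lt_le_trans b0).
have PB x : 0 <= P x <= c1 * ((K * A) `^ (1 - t^-1) * L `^ t^-1).
  rewrite P_ge0/= ler_wpM2l// ler_wpM2r ?powR_ge0//.
  have /andP[_ MAx] := MA x.
  by rewrite ge0_ler_powR ?nnegrE ?mulr_ge0// ?ler_wpM2l// subr_ge0 ltW.
set A' := c1 * _ in PB.
have mP : measurable_fun [set: caratheodory_type (@lebesgue_outer R N)] P.
  have mKM := measurable_funM (measurable_cst K) mM.
  have mKMt := measurable_fun_powR (1 - t^-1) mKM.
  exact: measurable_funM (measurable_cst c1) (measurable_funM mKMt (measurable_cst _)).
have := @absorption _ _ R mu Omega q b phi P (Num.max A A') q1 b0 mO bO2 bphi.1 mP _ _ _.
move=> /(_ _ _ _)/le_trans; apply.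
- by move=> x; rewrite le_max phiA.
- by move=> x; rewrite le_max; have /andP[-> ->] := PB x; rewrite orbT.
- by move=> x Ox; apply: le_trans (pw x Ox) _; rewrite lerD2r avO.
rewrite EFinM -muleA lee_wpmul2l ?lee_fin ?powR_ge0//.
clearbody c1 K.
have pn : p != 0 by rewrite gt_eqF.
have Q0 : 0 < Q by exact: lt_trans pQ.
have Qn : Q != 0 by rewrite gt_eqF.
have Qpn : Q - p != 0 by rewrite gt_eqF// subr_gt0.
have tq : (1 - t^-1) * q = p.
  by rewrite /t /q /sobolev_exponent; field; rewrite pn Qn Qpn.
have LE : L `^ (t^-1 * q) = G `^ (q / Q) * b^-1 `^ (q / Q).
  rewrite /L -powRrM (_ : p^-1 * _ = q / Q); last first.
    by rewrite /t; field; rewrite pn Qn.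
  by rewrite powRM// invr_ge0 ltW.
have GG : G * G `^ (q / Q) = G `^ (q / p).
  have e1 : 1 + q / Q = q / p.
    by rewrite /q /sobolev_exponent; field; rewrite pn Qn Qpn.
  rewrite -[X in X * _](powRr1 G0) -powRD ?e1//.
  by rewrite mulf_eq0 invr_eq0 (negPf pn) orbF gt_eqF// (lt_trans ltr01 q1).
apply: (@le_trans _ _ (\int[mu]_(x in Omega) ((c1 `^ q * (K `^ p * L `^ (t^-1 * q)))%:E * (M x `^ p)%:E))%E).
  rewrite le_eqVlt; apply/orP; left; apply/eqP; apply: eq_integral => x _.
  rewrite -EFinM; congr EFin; rewrite /P powRM ?mulr_ge0 ?powR_ge0//.
  rewrite powRM ?powR_ge0// -!powRrM tq powRM//; ring.
rewrite ge0_integralZl_EFin; last 4 first.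
- exact: mO.
- by move=> x _; rewrite lee_fin powR_ge0.
- by apply/measurable_EFinP/measurable_funTS; exact: measurable_fun_powR.
- by apply: mulr_ge0; rewrite ?powR_ge0// mulr_ge0 ?powR_ge0.
apply: le_trans (lee_wpmul2l _ intM) _.
  by rewrite lee_fin; apply: mulr_ge0; rewrite ?powR_ge0// mulr_ge0 ?powR_ge0.
rewrite GfinE poweR_EFin -!EFinM lee_fin LE -GG.
by rewrite le_eqVlt; apply/orP; left; apply/eqP; ring.
Qed.

End sobolev_smooth.

(** * Almost everywhere limits and L^p bounds *)

Lemma continuous_norm_powR (R : realType) (q : R) : 0 < q ->
  continuous (fun x : R => `|x| `^ q).
Proof.
move=> q0 x; have [->|x0] := eqVneq x 0.
  apply/cvgrPdist_lt => e e0; rewrite normr0 powR0 ?gt_eqF//.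
  have e1 : 0 < e `^ q^-1 by rewrite powR_gt0.
  near=> y; rewrite sub0r normrN ger0_norm ?powR_ge0//.
  have ye : `|y| < e `^ q^-1.
    by near: y; exists (e `^ q^-1) => //= z; rewrite /ball/= sub0r normrN.
  have -> : e = (e `^ q^-1) `^ q by rewrite -powRrM mulVf ?gt_eqF// powRr1// ltW.
  by rewrite gt0_ltr_powR ?nnegrE// ltW.
apply: (@continuous_comp _ _ _ (@Num.norm _ R) (fun y => y `^ q)).
  exact: norm_continuous.
apply/differentiable_continuous/derivable1_diffP.
by apply: ex_derive; apply: is_derive1_powR; rewrite normr_gt0.
Unshelve. all: by end_near. Qed.

Section lp_generic.
Context d (T : measurableType d) (R : realType) (mu : {measure set T -> \bar R}).
Local Open Scope ereal_scope.

(** Along a subsequence whose k-th integral is at most 2^-k, the series of the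
    functions |f_n - f|^p has a finite integral; so it converges almost
    everywhere, and its terms tend to 0. *)
Lemma ae_cvg_subsequence (p : R) (D : set T) (f_ : nat -> T -> R) (f : T -> R) :
  (0 < p)%R -> measurable D ->
  (forall n, measurable_fun D (f_ n)) -> measurable_fun D f ->
  \int[mu]_(x in D) (`|f_ n x - f x| `^ p)%:E @[n --> \oo] --> 0 ->
  exists2 s : nat -> nat, s n @[n --> \oo] --> \oo &
    {ae mu, forall x, D x -> f_ (s n) x @[n --> \oo] --> f x}.
Proof.
move=> p0 mD mf_ mf cf.
have Hs k : exists n, (k <= n)%N /\ \int[mu]_(x in D) (`|f_ n x - f x| `^ p)%:E <= (1 / (2 ^ k.+1)%:R)%:E.
  have e0 : (0 < 1 / (2 ^ k.+1)%:R :> R)%R by rewrite divr_gt0// ltr0n expn_gt0.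
  move/fine_cvgP : cf => [cfin /cvgrPdist_lt/(_ _ e0) H].
  near \oo => n; exists n; split; first by near: n; exact: nbhs_infty_ge.
  have fin : \int[mu]_(x in D) (`|f_ n x - f x| `^ p)%:E \is a fin_num by near: n.
  rewrite -(fineK fin) lee_fin.
  have : (`|0 - fine (\int[mu]_(x in D) (`|f_ n x - f x| `^ p)%:E)| < 1 / (2 ^ k.+1)%:R)%R by near: n.
  by rewrite sub0r normrN => /ltW; apply: le_trans; exact: ler_norm.
have /choice[s sP] := Hs; exists s.
  apply/cvgnyPge => A; exists A => // n /= An.
  by have [+ _] := sP n; exact: leq_trans.
pose F n x : \bar R := (`|f_ (s n) x - f x| `^ p)%:E.
have mF n : measurable_fun D (F n).
  by apply: measurable_norm_powR; exact: measurable_funB.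
have F0 n x : D x -> 0 <= F n x by rewrite lee_fin powR_ge0.
have sumF : \int[mu]_(x in D) (\sum_(n <oo) F n x) < +oo.
  rewrite integral_nneseries//.
  apply: (@le_lt_trans _ _ (\sum_(n <oo) (0 + (1 / (2 ^ n.+1)%:R)%:E))).
    apply: lee_nneseries => [n _ _|n _]; first by apply: integral_ge0 => x; exact: F0.
    by rewrite add0e; have [] := sP n.
  apply: (le_lt_trans (epsilon_trick _ _ _)) => //.
  by rewrite eseries0// add0e ltry.
have sF0 x : D x -> 0 <= \sum_(n <oo) F n x.
  by move=> Dx; apply: nneseries_ge0 => n _ _; exact: F0.
have iF : mu.-integrable D (fun x => \sum_(n <oo) F n x).
  apply/integrableP; split.
    by apply: ge0_emeasurable_sum => // n x Dx _; exact: F0.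
  rewrite (eq_integral (fun x => \sum_(n <oo) F n x))// => x /set_mem Dx.
  by rewrite gee0_abs// sF0.
have := integrable_ae mD iF; apply: filterS => x Hx Dx.
have Hfin : \sum_(0 <= n <oo) F n x < +oo by rewrite ltey_eq Hx.
have F0x n : 0 <= F n x by exact: F0.
have tail := nneseries_tail_cvg Hfin (fun n _ => F0x n).
apply/cvgrPdist_lt => e e0; have ep0 : (0 < e `^ p)%R by exact: powR_gt0.
have /fine_cvgP[tfin /cvgrPdist_lt/(_ _ ep0) H] := tail.
near=> n.
have fin : \sum_(n <= k <oo) F k x \is a fin_num by near: n.
have : (`|0 - fine (\sum_(n <= k <oo) F k x)| < e `^ p)%R by near: n.
rewrite sub0r normrN => /(le_lt_trans (ler_norm _)).
rewrite -lte_fin fineK// (@nneseries_split _ _ n 1)//.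
rewrite addn1 big_nat1 => h.
have : F n x < (e `^ p)%:E.
  by apply: le_lt_trans h; rewrite leeDl//; apply: nneseries_ge0 => k _ _; exact: F0x.
rewrite lte_fin distrC => h'; rewrite ltNge; apply/negP => eh.
move: h'; rewrite ltNge => /negP; apply.
by apply: ge0_ler_powR; rewrite ?nnegrE// ltW.
Unshelve. all: by end_near. Qed.

Lemma fatou_bound (q C : R) (D : set T) (f_ : nat -> T -> R) (f : T -> R) :
  (0 < q)%R -> measurable D ->
  (forall n, measurable_fun D (f_ n)) -> measurable_fun D f ->
  {ae mu, forall x, D x -> f_ n x @[n --> \oo] --> f x} ->
  (\forall n \near \oo, \int[mu]_(x in D) (`|f_ n x| `^ q)%:E <= C%:E) ->
  \int[mu]_(x in D) (`|f x| `^ q)%:E <= C%:E.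
Proof.
move=> q0 mD mf_ mf aef bnd.
pose F n x : \bar R := (`|f_ n x| `^ q)%:E.
have mF n : measurable_fun D (F n) by exact: measurable_norm_powR.
have F0 n x : D x -> 0 <= F n x by rewrite lee_fin powR_ge0.
have -> : \int[mu]_(x in D) (`|f x| `^ q)%:E = \int[mu]_(x in D) limn_einf (F ^~ x).
  apply: ae_eq_integral => //.
  - exact: measurable_norm_powR.
  - apply: (measurableT_comp (f := oppe)) => //.
    by apply: (measurable_fun_limn_esup (f := fun n x => - F n x)) => n; exact: measurableT_comp.
  - apply: filterS aef => x H Dx.
    have cF : F n x @[n --> \oo] --> (`|f x| `^ q)%:E.
      apply/fine_cvgP; split; first exact: nearW.
      apply: (@cvg_comp _ _ _ (fun n => f_ n x) (fun y => `|y| `^ q)%R).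
        exact: H.
      exact: (continuous_norm_powR q0).
    rewrite is_cvg_limn_einfE; last by apply/cvg_ex; eexists; exact: cF.
    by rewrite (cvg_lim _ cF).
apply: le_trans (fatou mu mD mF F0) _.
rewrite limn_einf_lim; apply: lime_le; first exact: is_cvg_einfs.
near=> n; apply: (@le_trans _ _ (\int[mu]_(x in D) F n x)).
  by apply: ereal_inf_lbound; exists n => /=.
by near: n.
Unshelve. all: by end_near. Qed.

End lp_generic.

(** * Lebesgue norms on Omega, and test functions *)

Section lp_norm.
Context {R : realType} {N : nat} (Omega : set 'rV[R]_N).
Local Notation mu := (@lebesgueN R N).
Local Notation T := (caratheodory_type (@lebesgue_outer R N)).
Hypothesis mO : measurable (Omega : set T).
Implicit Types (f : 'rV[R]_N -> R).

Lemma LpNormE p f : p != 0 ->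
  LpNorm Omega p f = ((\int[mu]_(x in Omega) (`|f x| `^ p)%:E) `^ p^-1)%E.
Proof.
move=> p0; rewrite /LpNorm unlock; congr (_ `^ _)%E.
rewrite [RHS]integral_mkcond; apply: eq_integral => x _.
rewrite /= !patchE; case: ifP => _ //=.
by rewrite normr0 powR0.
Qed.

Lemma LpNorm_powR p f : p != 0 ->
  (LpNorm Omega p f `^ p)%E = (\int[mu]_(x in Omega) (`|f x| `^ p)%:E)%E.
Proof.
move=> p0; rewrite LpNormE// -poweRrM mulVf// poweRe1//.
by apply: integral_ge0 => x _; rewrite lee_fin powR_ge0.
Qed.

Lemma LpNorm_ge0 p f : (0 <= LpNorm Omega p f)%E.
Proof. exact: Lnorm_ge0. Qed.

Lemma measurable_patch f :
  measurable_fun [set: T] (f \_ Omega) <-> measurable_fun (Omega : set T) (f : T -> R).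
Proof. by split => mf; apply/(measurable_restrictT _ mO). Qed.

Lemma in_LpP p f : in_Lp Omega p f <->
  measurable_fun (Omega : set T) (f : T -> R) /\ (LpNorm Omega p f < +oo)%E.
Proof.
rewrite /in_Lp /LpNorm -measurable_patch; split.
  by move=> /andP[/set_mem mf /set_mem nf].
by move=> [mf nf]; apply/andP; split; apply/mem_set.
Qed.

Lemma le_LpNorm p f g : 0 < p -> measurable_fun (Omega : set T) (f : T -> R) ->
  measurable_fun (Omega : set T) (g : T -> R) ->
  (forall x, Omega x -> `|f x| <= `|g x|) ->
  (LpNorm Omega p f <= LpNorm Omega p g)%E.
Proof.
move=> p0 mf mg fg; rewrite !LpNormE ?gt_eqF//.
have I0 h : (\int[mu]_(x in Omega) (`|h x| `^ p)%:E \in `[0, +oo])%E.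
  have H : (0 <= \int[mu]_(x in Omega) (`|h x| `^ p)%:E)%E.
    by apply: integral_ge0 => x _; rewrite lee_fin powR_ge0.
  by rewrite in_itv/= leey andbT; exact: H.
apply: gt0_ler_poweR => //; first by rewrite invr_ge0 ltW.
apply: ge0_le_integral => //.
- exact: measurable_norm_powR.
- exact: measurable_norm_powR.
- by move=> x Ox; rewrite lee_fin ge0_ler_powR ?nnegrE ?(ltW p0)//; exact: fg.
Qed.

Lemma LpNormD p f g : 1 <= p -> measurable_fun (Omega : set T) (f : T -> R) ->
  measurable_fun (Omega : set T) (g : T -> R) ->
  (LpNorm Omega p (fun x => (f x + g x)%R) <= LpNorm Omega p f + LpNorm Omega p g)%E.
Proof.
move=> p1 /measurable_patch mf /measurable_patch mg; rewrite /LpNorm.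
have := minkowski_EFin mu mf mg p1; rewrite (_ : (_ \+ _)%R = (fun x => f x + g x) \_ Omega)//.
by apply/funext => x /=; rewrite !patchE; case: ifP => _; rewrite ?addr0.
Qed.

Lemma LpNormZ p f c : p != 0 -> measurable_fun (Omega : set T) (f : T -> R) ->
  (LpNorm Omega p (fun x => (c * f x)%R) = `|c|%:E * LpNorm Omega p f)%E.
Proof.
move=> p0 mf; rewrite !LpNormE//.
under eq_integral do rewrite normrM powRM// EFinM.
rewrite ge0_integralZl_EFin ?powR_ge0//; last exact: measurable_norm_powR.
have I0 : (0 <= \int[mu]_(x in Omega) (`|f x| `^ p)%:E)%E.
  by apply: integral_ge0 => x _; rewrite lee_fin powR_ge0.
rewrite poweRM//.
by rewrite poweR_EFin -powRrM mulfV// powRr1.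
Qed.

End lp_norm.

Section test_functions.
Context {R : realType} {N d : nat} (X : 'rV[R]_N -> 'M[R]_(d, N)) (Omega : set 'rV[R]_N).
Hypothesis lipX : locally_lipschitz X.
Local Notation T := (caratheodory_type (@lebesgue_outer R N)).
Implicit Types (u phi : 'rV[R]_N -> R).

Lemma continuous_vector_fields : continuous X.
Proof.
move=> x; have [U xU lU] := lipX x.
have {lU}[K [Kr /(_ (`|K| + 1))]] := lU.
rewrite (le_lt_trans (ler_norm _)) ?ltrDl// => /(_ isT) H.
have Ux : U x := nbhs_singleton xU.
apply/(@cvgrPdist_lt _ _ _ (nbhs x) (nbhs_filter x)) => e e0.
have K1 : 0 < `|K| + 1 by rewrite ltr_wpDl.
have e1 : 0 < (`|K| + 1)^-1 * e by rewrite mulr_gt0// invr_gt0.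
apply: (@filterS2 _ (nbhs x) (nbhs_filter x) U (ball x ((`|K| + 1)^-1 * e))) => //.
  move=> y Uy; rewrite -ball_normE/= => xy.
  have := H (x, y) (conj Ux Uy) => /= /le_lt_trans; apply.
  by rewrite -ltr_pdivlMl.
exact: nbhsx_ballx.
Qed.

Lemma continuous_Xgrad_norm u : (forall k, continuous (partial k u)) ->
  continuous (fun x => enorm (Xgrad X u x)).
Proof.
move=> cu x; rewrite /enorm.
apply: (@continuous_comp _ _ _ (fun x => dotp (Xgrad X u x) (Xgrad X u x)) Num.sqrt); last exact: sqrt_continuous.
move: x; apply: continuous_big => [|j _ x]; first exact: add_continuous.
suff H : {for x, continuous (fun y => Xgrad X u y ord0 j)} by apply: continuousM.
have -> : (fun y => Xgrad X u y ord0 j) = (fun y => \sum_(k < N) partial k u y * X y j k).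
  by apply/funext => y; rewrite /Xgrad mxE; apply: eq_bigr => k _; rewrite !mxE.
move: x; apply: continuous_big => [|k _ x]; first exact: add_continuous.
apply: continuousM; first exact: cu.
apply: (@continuous_comp _ _ _ X (fun M : 'M[R]_(d, N) => M j k)); first exact: continuous_vector_fields.
exact: coord_continuous.
Qed.

Lemma test_function_C1 phi : test_function Omega phi -> C1_on setT phi.
Proof.
move=> [H _ _] x _; have [dphi pphi] := H 1%N; split; first exact: dphi.
by move=> k; exact: pphi.
Qed.

Lemma test_function_continuous phi : test_function Omega phi -> continuous phi.
Proof. by move=> [H _ _]; exact: (H 0%N). Qed.

Lemma test_function_partial phi k : test_function Omega phi -> continuous (partial k phi).
Proof. by move=> [H _ _]; have [_ ] := H 1%N; exact. Qed.

Lemma test_function_supp phi x : test_function Omega phi -> ~ Omega x ->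
  \forall y \near x, phi y = 0.
Proof.
move=> [_ _ sO] nOx.
have : open (~` closure [set x | phi x != 0]) by exact/closed_openC/closed_closure.
rewrite openE => /(_ x)/(_ (fun h => nOx (sO _ h))); rewrite /interior.
apply: filterS => y ny; apply/eqP/negPn/negP => phiy; apply: ny.
exact: subset_closure.
Qed.

Lemma test_function_out phi x : test_function Omega phi -> ~ Omega x -> phi x = 0.
Proof. by move=> tphi /(test_function_supp tphi)/nbhs_singleton. Qed.

Lemma test_function_Xgrad_out phi x : test_function Omega phi -> ~ Omega x ->
  Xgrad X phi x = 0.
Proof.
move=> tphi /(test_function_supp tphi) nx.
rewrite /Xgrad (_ : gradient phi x = 0) ?mul0mx//.
apply/rowP => k; rewrite !mxE /partial.
by rewrite (near_eq_derive _ (g := cst 0))// derive_cst.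
Qed.

(** A function that vanishes at the points near which phi vanishes is supported in
    the compact support of phi. *)
Lemma test_function_bounded phi (f : 'rV[R]_N -> R) : test_function Omega phi -> continuous f ->
  (forall x, (\forall y \near x, phi y = 0) -> f x = 0) ->
  exists A, forall x, `|f x| <= A.
Proof.
move=> [_ cphi _] cf f0.
have /compact_bounded[M [_ /(_ (`|M| + 1))]] : compact (f @` closure [set x | phi x != 0]).
  by apply: continuous_compact => //; exact: continuous_subspaceT.
rewrite (le_lt_trans (ler_norm _)) ?ltrDl// => /(_ isT) H.
exists (`|M| + 1) => x; have [Kx|nKx] := pselect (closure [set x | phi x != 0] x).
  by apply: H; exists x.
rewrite f0 ?normr0 ?addr_ge0//.
have : open (~` closure [set x | phi x != 0]) by exact/closed_openC/closed_closure.
rewrite openE => /(_ x)/(_ nKx); rewrite /interior.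
apply: filterS => y ny; apply/eqP/negPn/negP => phiy; apply: ny.
exact: subset_closure.
Qed.

End test_functions.

(** * The Sobolev inequality on the closure of the test functions *)

Lemma cvg0_poweR (R : realType) (a : nat -> \bar R) (q : R) : 0 < q ->
  (forall n, (0 <= a n)%E) -> (a n @[n --> \oo] --> 0%E) ->
  ((a n `^ q)%E @[n --> \oo] --> 0%E).
Proof.
move=> q0 a0 /fine_cvgP[afin acvg]; apply/fine_cvgP; split.
  by apply: filterS afin => n; exact: fin_num_poweR.
have -> : fine \o (fun n => (a n `^ q)%E) = (fun n => `|fine (a n)| `^ q).
  by apply/funext => n /=; rewrite fine_poweR ger0_norm// fine_ge0.
have H : (`|y| `^ q) @[y --> (0 : R)] --> 0.
  by have := @continuous_norm_powR _ _ q0 (0 : R); rewrite /continuous_at normr0 powR0 ?gt_eqF.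
exact: (@cvg_comp _ _ _ (fine \o a) (fun y => `|y| `^ q) _ _ _ acvg H).
Qed.

Section sobolev_W0.
Context {R : realType} {N d : nat} (X : 'rV[R]_N -> 'M[R]_(d, N)) (Omega : set 'rV[R]_N).
Local Notation mu := (@lebesgueN R N).
Local Notation T := (caratheodory_type (@lebesgue_outer R N)).
Hypothesis mO : measurable (Omega : set T).
Hypothesis lipX : locally_lipschitz X.

Lemma measurable_enorm n (G : 'rV[R]_N -> 'rV[R]_n) (D : set T) :
  (forall j, measurable_fun D (fun x => G x ord0 j)) ->
  measurable_fun D (fun x => enorm (G x)).
Proof.
move=> mG; rewrite /enorm.
have ms : measurable_fun [set: R] (@Num.sqrt R).
  by apply: continuous_measurable_fun; exact: sqrt_continuous.
apply: (measurableT_comp ms).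
apply: (@measurable_sum _ T R D _ _ (fun j (x : T) => G x ord0 j * G x ord0 j)) => j.
exact: measurable_funM.
Qed.

Lemma test_function_measurable phi (D : set T) : test_function Omega phi ->
  measurable_fun D (phi : T -> R).
Proof.
by move=> /test_function_continuous cphi; exact/measurable_funTS/continuous_measurableN.
Qed.

Lemma Xgrad_norm_measurable phi : test_function Omega phi ->
  measurable_fun [set: T] (fun x => enorm (Xgrad X phi x)).
Proof.
move=> tphi; apply: continuous_measurableN; apply: continuous_Xgrad_norm => //.
by move=> k; exact: test_function_partial tphi.
Qed.

Lemma Xgrad_measurable phi j (D : set T) : test_function Omega phi ->
  measurable_fun D (fun x => Xgrad X phi x ord0 j).
Proof.
move=> tphi; apply: measurable_funTS.
have -> : (fun y => Xgrad X phi y ord0 j) = (fun y => \sum_(k < N) partial k phi y * X y j k).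
  by apply/funext => y; rewrite /Xgrad mxE; apply: eq_bigr => k _; rewrite !mxE.
apply: (@measurable_sum _ T R _ _ _ (fun k (x : T) => partial k phi x * X x j k)) => k.
apply: measurable_funM; apply: continuous_measurableN.
  exact: test_function_partial tphi.
move=> x; apply: (@continuous_comp _ _ _ X (fun M : 'M[R]_(d, N) => M j k)).
  exact: continuous_vector_fields.
exact: coord_continuous.
Qed.

Lemma W0_ae p u G : 1 <= p -> W0 X Omega p u G ->
  exists phi : nat -> 'rV[R]_N -> R,
  [/\ forall n, test_function Omega (phi n),
      (LpNorm Omega p (fun x => phi n x - u x)%R @[n --> \oo] --> 0)%E,
      (LpNorm Omega p (fun x => enorm (Xgrad X (phi n) x - G x)%R)
             @[n --> \oo] --> 0)%E &
      {ae mu, forall x, Omega x -> phi n x @[n --> \oo] --> u x}].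
Proof.
move=> p1 [uL GL [phi [tphi phiu XphiG]]].
have p0 : 0 < p by exact: lt_le_trans p1.
have [mu_ _] := (in_LpP mO p u).1 uL.
have [] := @ae_cvg_subsequence _ _ _ mu p Omega phi u p0 mO _ mu_ _.
- by move=> n; exact: test_function_measurable.
- have E : (fun n => \int[mu]_(x in Omega) (`|phi n x - u x| `^ p)%:E)%E =
      (fun n => LpNorm Omega p (fun x => phi n x - u x)%R `^ p)%E.
    by apply/funext => n; rewrite LpNorm_powR ?gt_eqF.
  rewrite E; apply: cvg0_poweR p0 _ phiu => n; exact: LpNorm_ge0.
- move=> s soo aes; exists (phi \o s); split.
  + by move=> n; exact: tphi.
  + exact: (cvg_comp s (fun n => LpNorm Omega p (fun x => phi n x - u x)%R) soo phiu).
  + exact: (cvg_comp s (fun n => LpNorm Omega p (fun x => enorm (Xgrad X (phi n) x - G x)%R)) soo XphiG).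
  + exact: aes.
Qed.

Lemma W0_measurable p u G : W0 X Omega p u G ->
  measurable_fun (Omega : set T) (u : T -> R) /\
  forall j, measurable_fun (Omega : set T) (fun x => G x ord0 j).
Proof.
move=> [uL GL _]; split; first by have [] := (in_LpP mO p u).1 uL.
by move=> j; have [] := (in_LpP mO p _).1 (GL j).
Qed.

(** The gradients converge in L^p, so the right-hand sides converge, while on the
    left Fatou's lemma is applied along an almost everywhere convergent
    subsequence.  Adding 1 makes the constant positive. *)
Lemma sobolev_W0 p q (S0 : R) : 1 <= p -> 0 < q -> 0 <= S0 ->
  (forall phi, test_function Omega phi ->
    (\int[mu]_(x in Omega) (`|phi x| `^ q)%:E <=
      S0%:E * (\int[mu]_(x in Omega) (enorm (Xgrad X phi x) `^ p)%:E) `^ (q / p))%E) ->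
  forall u G, W0 X Omega p u G ->
    (LpNorm Omega q u <= (S0 `^ q^-1 + 1)%:E * LpNorm Omega p (@enorm R d \o G))%E.
Proof.
move=> p1 q0 S00 H u G uG.
have p0 : 0 < p by exact: lt_le_trans p1.
have pn : p != 0 by rewrite gt_eqF.
have [phi [tphi phiu XphiG aephi]] := W0_ae p1 uG.
have [mu_ mG] := W0_measurable uG.
have S1 : 0 < S0 `^ q^-1 + 1 by rewrite ltr_wpDl ?powR_ge0.
have [Goo|Gfin] := eqVneq (LpNorm Omega p (@enorm R d \o G)) +oo%E.
  by rewrite Goo gt0_muley ?leey.
have {Gfin}Gfin : LpNorm Omega p (@enorm R d \o G) \is a fin_num.
  by rewrite ge0_fin_numE ?LpNorm_ge0// ltey.
rewrite -(fineK Gfin); set c := fine _; have c0 : 0 <= c by rewrite fine_ge0// LpNorm_ge0.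
apply/lee_addgt0Pr => e' e'0.
pose e := e' / (S0 `^ q^-1 + 1); have e0 : 0 < e by rewrite divr_gt0.
have near_bound : \forall n \near \oo,
    (\int[mu]_(x in Omega) (`|phi n x| `^ q)%:E <= (S0 * (c + e) `^ q)%:E)%E.
  move/fine_cvgP : XphiG => [XGfin /cvgrPdist_lt/(_ _ e0) XG].
  near=> n; apply: le_trans (H _ (tphi n)) _.
  rewrite EFinM; apply: lee_wpmul2l; first by rewrite lee_fin.
  have -> : (\int[mu]_(x in Omega) (enorm (Xgrad X (phi n) x) `^ p)%:E =
      LpNorm Omega p (fun x => enorm (Xgrad X (phi n) x)) `^ p)%E.
    rewrite LpNorm_powR; last exact: pn.
    apply: eq_integral => x _.
    by rewrite ger0_norm ?enorm_ge0.
  rewrite -poweRrM mulrCA divff ?gt_eqF// mulr1.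
  have mXG : measurable_fun (Omega : set T) (fun x => enorm (Xgrad X (phi n) x - G x)).
    apply: (@measurable_enorm _ (fun x => Xgrad X (phi n) x - G x)) => j.
    have -> : (fun x => (Xgrad X (phi n) x - G x) ord0 j) =
        (fun x => Xgrad X (phi n) x ord0 j - G x ord0 j).
      by apply/funext => x; rewrite [LHS]mxE; congr (_ + _); rewrite mxE.
    apply: measurable_funB; last exact: mG.
    exact: (Xgrad_measurable j (tphi n)).
  have mGn : measurable_fun (Omega : set T) (fun x => enorm (G x)) by exact: measurable_enorm.
  have le1 : (LpNorm Omega p (fun x => enorm (Xgrad X (phi n) x)) <= (c + e)%:E)%E.
    apply: (@le_trans _ _ (LpNorm Omega p (fun x => enorm (G x) + enorm (Xgrad X (phi n) x - G x)))).
      apply: le_LpNorm.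
      - exact: mO.
      - exact: p0.
      - exact/measurable_funTS/Xgrad_norm_measurable.
      - exact: measurable_funD.
      - move=> x _; rewrite !ger0_norm ?addr_ge0 ?enorm_ge0//.
        by rewrite -{1}(subrK (G x) (Xgrad X (phi n) x)) addrC ler_enormD.
    apply: le_trans (LpNormD mO p1 mGn mXG) _.
    rewrite EFinD; apply: leeD; first by rewrite /c fineK.
    have fin : LpNorm Omega p (fun x => enorm (Xgrad X (phi n) x - G x)) \is a fin_num by near: n.
    rewrite -(fineK fin) lee_fin; apply: le_trans (ler_norm _) _; apply: ltW.
    rewrite -normrN -sub0r; by near: n.
  rewrite -poweR_EFin; apply: gt0_ler_poweR => //; first exact: ltW.
    by rewrite in_itv/= leey andbT LpNorm_ge0.
  by rewrite in_itv/= leey andbT lee_fin addr_ge0// ltW.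
have := fatou_bound q0 mO (fun n => @test_function_measurable (phi n) Omega (tphi n)) mu_ aephi near_bound.
rewrite LpNormE ?gt_eqF// => B.
apply: (@le_trans _ _ ((S0 * (c + e) `^ q)%:E `^ q^-1)%E).
  apply: gt0_ler_poweR => //; first by rewrite invr_ge0 ltW.
    have I0 : (0 <= \int[mu]_(x in Omega) (`|u x| `^ q)%:E)%E.
      by apply: integral_ge0 => x _; rewrite lee_fin powR_ge0.
    by rewrite in_itv/= leey andbT; exact: I0.
  by rewrite in_itv/= leey andbT lee_fin mulr_ge0 ?powR_ge0.
have ce : 0 <= c + e by rewrite addr_ge0// ltW.
rewrite poweR_EFin powRM ?powR_ge0// -powRrM mulfV ?gt_eqF// powRr1//.
rewrite -EFinM -EFinD lee_fin.
have -> : (S0 `^ q^-1 + 1) * c + e' = (S0 `^ q^-1 + 1) * (c + e).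
  by rewrite mulrDr /e mulrCA mulfV ?mulr1// gt_eqF.
by apply: ler_wpM2r => //; rewrite lerDl.
Unshelve. all: by end_near. Qed.

End sobolev_W0.

Lemma sobolev_constant_exists (R : realType) (N d : nat) (X : 'rV[R]_N -> 'M[R]_(d, N))
    (Omega : set 'rV[R]_N) (p Q : R) :
  (0 < N)%N -> 1 < p < Q -> open Omega -> bounded_set Omega -> standing_assumptions X Q ->
  exists Sp, sobolev_constant X Omega p Q Sp.
Proof.
move=> N0 /andP[p1 pQ] oO bO SA.
have [S0 S00 HS] := sobolev_C1 SA p1 pQ N0 oO bO.
have q0 : 0 < sobolev_exponent Q p.
  have p0 : 0 < p := lt_trans ltr01 p1.
  by rewrite /sobolev_exponent divr_gt0 ?subr_gt0// mulr_gt0// (lt_trans p0).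
exists (S0 `^ (sobolev_exponent Q p)^-1 + 1); split.
  by rewrite ltr_wpDl ?powR_ge0.
have mO := open_measurableN oO.
apply: sobolev_W0 => //; [exact: sa_lipschitz SA|exact: ltW|].
move=> phi tphi.
have cphi := test_function_continuous tphi.
have [A1 HA1] := test_function_bounded tphi cphi (fun x nx => nbhs_singleton nx).
have cg := continuous_Xgrad_norm (sa_lipschitz SA) (fun k => @test_function_partial _ _ Omega phi k tphi).
have [A2 HA2] : exists A, forall x, `|enorm (Xgrad X phi x)| <= A.
  apply: (test_function_bounded tphi cg) => x nx.
  suff -> : Xgrad X phi x = 0 by rewrite enorm0.
  rewrite /Xgrad (_ : gradient phi x = 0) ?mul0mx//.
  apply/rowP => k; rewrite !mxE /partial.
  by rewrite (near_eq_derive _ (g := cst 0))// derive_cst.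
apply: (HS phi (Num.max A1 A2)).
- exact: test_function_C1 tphi.
- exact: cphi.
- by move=> x; rewrite le_max HA1.
- by move=> x; exact: test_function_out tphi.
- exact: (Xgrad_norm_measurable (sa_lipschitz SA) tphi).
- by move=> x; rewrite le_max (le_trans (ler_norm _) (HA2 x)) orbT.
- by move=> x nOx; rewrite (test_function_Xgrad_out X tphi nOx) enorm0.
Qed.

(** * The chain rule *)

Section chain_rule.
Context {R : realType} {N : nat}.
Implicit Types (u f g : 'rV[R]_N -> R).

Lemma derive_comp_real (h : R -> R) u x (v : 'rV[R]_N) dh :
  is_derive (u x) (1 : R) h dh -> differentiable u x ->
  differentiable (fun y => h (u y)) x /\ 'D_v (fun y => h (u y)) x = dh * 'D_v u x.
Proof.
move=> [dh1 dh2] du; have dh' := (derivable1_diffP _ _).1 dh1.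
have dhu : differentiable (h \o u) x by exact: differentiable_comp.
split; first exact: dhu.
rewrite (deriveE v (dhu : differentiable (fun y => h (u y)) x)) (deriveE v du).
have -> : 'd (fun y => h (u y)) x v = 'd h (u x) ('d u x v).
  by rewrite -[LHS]/('d (h \o u) x v) diff_comp.
rewrite -[X in 'd h _ X]mulr1 -[_ * 1]/('d u x v *: (1 : R)) linearZ/=.
by rewrite -(deriveE _ dh') dh2 mulrC.
Qed.

Lemma class_C_continuous k u : class_C k u -> continuous u.
Proof.
case: k => [|k] //= [du _] x; exact: differentiable_continuous (du x).
Qed.

Lemma class_C_pred k u : class_C k.+1 u -> class_C k u.
Proof.
elim: k u => [|k IH] u; first exact: class_C_continuous.
by move=> [du pu]; split => // i; apply: IH; exact: pu.
Qed.

Lemma class_C_cst c k : class_C k (fun _ : 'rV[R]_N => c).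
Proof.
elim: k c => [|k IH] c /=; first by move=> x; exact: cst_continuous.
split => [x|i]; first exact: differentiable_cst.
rewrite (_ : partial i _ = fun=> 0)//.
by apply/funext => x; rewrite /partial (derive_cst c).
Qed.

Lemma class_CD k f g : class_C k f -> class_C k g -> class_C k (fun x => f x + g x).
Proof.
elim: k f g => [|k IH] f g /=.
  by move=> cf cg x; apply: (@continuousD _ _ _ f g); [exact: cf|exact: cg].
move=> [df pf] [dg pg]; split => [x|i]; first exact: differentiableD.
rewrite (_ : partial i _ = fun x => partial i f x + partial i g x); first exact: IH.
apply/funext => x; rewrite /partial.
by rewrite -[LHS]/('D_(delta_mx ord0 i) (f + g) x) deriveD; [by []|exact: diff_derivable|exact: diff_derivable].
Qed.

Lemma class_CM k f g : class_C k f -> class_C k g -> class_C k (fun x => f x * g x).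
Proof.
elim: k f g => [|k IH] f g.
  by move=> cf cg x; apply: (@continuousM _ _ f g); [exact: cf|exact: cg].
move=> Cf Cg; have [df pf] := Cf; have [dg pg] := Cg.
split => [x|i]; first exact: differentiableM.
rewrite (_ : partial i _ = fun x => f x * partial i g x + g x * partial i f x).
  apply: class_CD; apply: IH; [exact: class_C_pred Cf|exact: pg|exact: class_C_pred Cg|exact: pf].
apply/funext => x; rewrite /partial.
by rewrite -[LHS]/('D_(delta_mx ord0 i) (f * g) x) deriveM; [by []|exact: diff_derivable|exact: diff_derivable].
Qed.

(** Differentiating u^a produces a multiple of u^(a - 1) times a derivative of u;
    the induction on the order is therefore over all exponents at once. *)
Lemma class_C_powR u (a : R) k : (forall x, 0 < u x) -> (forall k, class_C k u) ->
  class_C k (fun x => u x `^ a).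
Proof.
move=> u0 Cu; elim: k a => [|k IH] a.
  move=> x; apply: differentiable_continuous.
  have [du _] := Cu 1%N.
  by have [] := @derive_comp_real (fun t => t `^ a) u x 0 _ (is_derive1_powR a (u0 x)) (du x).
have [du _] := Cu 1%N.
split => [x|i].
  by have [] := @derive_comp_real (fun t => t `^ a) u x 0 _ (is_derive1_powR a (u0 x)) (du x).
rewrite (_ : partial i _ = fun x => a * (u x `^ (a - 1) * partial i u x)).
  apply: class_CM; first exact: class_C_cst.
  by apply: class_CM => //; have [_] := Cu k.+1; exact.
apply/funext => x; rewrite /partial mulrA.
by have [] := @derive_comp_real (fun t => t `^ a) u x (delta_mx ord0 i) _ (is_derive1_powR a (u0 x)) (du x).
Qed.

Lemma test_function_comp (Omega : set 'rV[R]_N) (F : R -> R) u : F 0 = 0 ->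
  (forall k, class_C k (fun x => F (u x))) ->
  test_function Omega u -> test_function Omega (fun x => F (u x)).
Proof.
move=> F0 CF [Cu cu sO].
have sub : closure [set x | F (u x) != 0] `<=` closure [set x | u x != 0].
  by apply: closure_subset => x /=; apply: contra => /eqP ->; rewrite F0.
split => //; last exact: subset_trans sO.
by apply: subclosed_compact cu sub; exact: closed_closure.
Qed.

End chain_rule.

Section chain_rule_W0.
Context {R : realType} {N d : nat} (X : 'rV[R]_N -> 'M[R]_(d, N)) (Omega : set 'rV[R]_N).
Local Notation mu := (@lebesgueN R N).
Local Notation T := (caratheodory_type (@lebesgue_outer R N)).
Hypothesis mO : measurable (Omega : set T).
Hypothesis lipX : locally_lipschitz X.
Variables (p : R) (F dF : R -> R) (L : R).
Hypotheses (p1 : 1 <= p) (F0 : F 0 = 0) (dFP : forall t, is_derive t (1 : R) F (dF t))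
  (cdF : continuous dF) (dFL : forall t, `|dF t| <= L)
  (testF : forall phi, test_function Omega phi -> test_function Omega (fun x => F (phi x))).
Let p0 : 0 < p := lt_le_trans ltr01 p1.
Let pn : p != 0. Proof. by rewrite gt_eqF. Qed.
Let L0 : 0 <= L := le_trans (normr_ge0 _) (dFL 0).

Lemma F_lipschitz s t : `|F s - F t| <= L * `|s - t|.
Proof.
wlog st : s t / t <= s.
  by move=> H; case: (leP t s) => [|/ltW] /H//; rewrite distrC (distrC s).
have cF : continuous F.
  by move=> y; apply/differentiable_continuous/derivable1_diffP; case: (dFP y).
have [c _ ->] := @MVT_segment _ F dF t s st (fun y _ => dFP y) (continuous_subspaceT cF).
by rewrite normrM; apply: ler_wpM2r.
Qed.

Lemma Xgrad_comp phi x : test_function Omega phi ->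
  Xgrad X (fun x => F (phi x)) x = dF (phi x) *: Xgrad X phi x.
Proof.
move=> [Cphi _ _]; have [dphi _] := Cphi 1%N.
rewrite /Xgrad scalemxAl; congr (_ *m _); apply/rowP => k; rewrite !mxE /partial.
by have [] := @derive_comp_real _ _ F phi x (delta_mx ord0 k) _ (dFP (phi x)) (dphi x).
Qed.

Lemma LpNorm_enorm_lty (G : 'rV[R]_N -> 'rV[R]_d) : (forall j, in_Lp Omega p (fun x => G x ord0 j)) ->
  (LpNorm Omega p (fun x => enorm (G x)) < +oo)%E.
Proof.
move=> GL.
have mG j : measurable_fun (Omega : set T) (fun x => G x ord0 j).
  by have [] := (in_LpP mO p _).1 (GL j).
have H n (h : 'I_n -> 'I_d) :
    (LpNorm Omega p (fun x => (\sum_(i < n) `|G x ord0 (h i)|)%R) < +oo)%E /\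
    measurable_fun (Omega : set T) (fun x => \sum_(i < n) `|G x ord0 (h i)|).
  split; last first.
    apply: (@measurable_sum _ T R _ _ _ (fun i (x : T) => `|G x ord0 (h i)|%R)) => i.
    by apply: measurableT_comp => //; exact: mG.
  elim: n h => [|n IH] h.
    rewrite LpNormE; last exact: pn.
    under eq_integral do rewrite big_ord0 normr0 powR0 ?pn//.
    by rewrite integral0 poweR0r ?invr_neq0// ltry.
  have -> : (fun x => \sum_(i < n.+1) `|G x ord0 (h i)|) =
      (fun x => \sum_(i < n) `|G x ord0 (h (widen_ord (leqnSn n) i))| + `|G x ord0 (h ord_max)|).
    by apply/funext => x; rewrite big_ord_recr.
  apply: le_lt_trans (LpNormD mO p1 _ _) _.
  - apply: (@measurable_sum _ T R _ _ _ (fun i (x : T) => `|G x ord0 (h (widen_ord (leqnSn n) i))|%R)) => i.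
    by apply: measurableT_comp => //; exact: mG.
  - by apply: measurableT_comp => //; exact: mG.
  apply: lte_add_pinfty; first exact: (IH (fun i => h (widen_ord (leqnSn n) i))).
  have [_] := (in_LpP mO p _).1 (GL (h ord_max)).
  apply: le_lt_trans; apply: le_LpNorm; [exact: mO|exact: p0| |exact: mG|].
    by apply: measurableT_comp => //; exact: mG.
  by move=> x _; rewrite normr_id.
have [H1 H2] := H d id; apply: le_lt_trans H1.
apply: le_LpNorm; [exact: mO|exact: p0| |exact: H2|].
  exact: (@measurable_enorm _ _ _ G).
move=> x _; rewrite ger0_norm ?enorm_ge0// ger0_norm ?sumr_ge0//.
exact: ler_enorm_sum.
Qed.

(** The functions F(phi_n) are test functions whose gradients dF(phi_n) X phi_n
    differ from dF(u) G by dF(phi_n) (X phi_n - G), small since dF is bounded, and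
    (dF(phi_n) - dF(u)) G, small by dominated convergence. *)
Lemma W0_comp u G : W0 X Omega p u G ->
  W0 X Omega p (fun x => F (u x)) (fun x => dF (u x) *: G x).
Proof.
move=> uG; have [phi [tphi phiu XphiG aephi]] := W0_ae mO p1 uG.
have [mu_ mG] := W0_measurable mO uG.
have [uL GL _] := uG.
have mF : measurable_fun [set: R] F.
  apply: continuous_measurable_fun => y.
  by apply/differentiable_continuous/derivable1_diffP; case: (dFP y).
have mdF : measurable_fun [set: R] dF by exact: continuous_measurable_fun.
have mdFu : measurable_fun (Omega : set T) (fun x => dF (u x)) by exact: (measurableT_comp mdF).
have mphi n : measurable_fun (Omega : set T) (phi n : T -> R).
  exact: (@test_function_measurable _ _ Omega (phi n) Omega (tphi n)).
have mdFphi n : measurable_fun (Omega : set T) (fun x => dF (phi n x)).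
  exact: (measurableT_comp mdF (mphi n)).
have mFu : measurable_fun (Omega : set T) (fun x => F (u x)) by exact: (measurableT_comp mF).
have mnG : measurable_fun (Omega : set T) (fun x => enorm (G x)) by exact: (@measurable_enorm _ _ _ G).
split.
- apply/(in_LpP mO); split; first exact: mFu.
  have [_ uLy] := (in_LpP mO p u).1 uL.
  apply: (@le_lt_trans _ _ (LpNorm Omega p (fun x => L * u x))).
    apply: le_LpNorm; [exact: mO|exact: p0|exact: mFu| |].
      exact: (measurable_funM (measurable_cst _) mu_).
    move=> x _; have := F_lipschitz (u x) 0.
    by rewrite F0 !subr0 normrM (ger0_norm L0).
  rewrite LpNormZ; [|exact: mO|exact: pn|exact: mu_].
  by rewrite lte_mul_pinfty// lee_fin.
- move=> j; apply/(in_LpP mO).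
  have E : (fun x => (dF (u x) *: G x) ord0 j) = (fun x => dF (u x) * G x ord0 j).
    by apply/funext => x; rewrite mxE.
  rewrite E; split; first exact: measurable_funM mdFu (mG j).
  have [_ GLy] := (in_LpP mO p _).1 (GL j).
  apply: (@le_lt_trans _ _ (LpNorm Omega p (fun x => L * G x ord0 j))).
    apply: le_LpNorm; [exact: mO|exact: p0|exact: measurable_funM mdFu (mG j)| |].
      exact: (measurable_funM (measurable_cst _) (mG j)).
    by move=> x _; rewrite !normrM (ger0_norm L0) ler_wpM2r.
  rewrite LpNormZ; [|exact: mO|exact: pn|exact: mG].
  by rewrite lte_mul_pinfty// lee_fin.
- exists (fun n x => F (phi n x)); split.
  + by move=> n; exact: testF.
  + apply: (@squeeze_cvge _ _ _ _ (fun=> 0%E) _ (fun n => L%:E * LpNorm Omega p (fun x => phi n x - u x)%R)%E).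
    * apply: nearW => n; apply/andP; split; first exact: LpNorm_ge0.
      have mBn : measurable_fun (Omega : set T) (fun x => phi n x - u x) by exact: measurable_funB.
      rewrite -{1}(ger0_norm L0) -LpNormZ; [|exact: mO|exact: pn|exact: mBn].
      apply: le_LpNorm; [exact: mO|exact: p0| | |].
      - exact: (measurable_funB (measurableT_comp mF (mphi n)) mFu).
      - exact: (measurable_funM (measurable_cst _) mBn).
      - by move=> x _; rewrite normrM (ger0_norm L0); exact: F_lipschitz.
    * exact: cvg_cst.
    * rewrite -(mule0 L%:E); apply: cvgeZl => //.
  + have mXG n : measurable_fun (Omega : set T) (fun x => enorm (Xgrad X (phi n) x - G x)).
      apply: (@measurable_enorm _ _ _ (fun x => Xgrad X (phi n) x - G x)) => j.
      have -> : (fun x => (Xgrad X (phi n) x - G x) ord0 j) =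
          (fun x => Xgrad X (phi n) x ord0 j - G x ord0 j).
        by apply/funext => x; rewrite [LHS]mxE; congr (_ + _); rewrite mxE.
      apply: measurable_funB; last exact: mG.
      exact: (Xgrad_measurable lipX j (tphi n)).
    pose D n x := (dF (phi n x) - dF (u x)) * enorm (G x).
    have mD n : measurable_fun (Omega : set T) (D n).
      exact: measurable_funM (measurable_funB (mdFphi n) mdFu) mnG.
    have DL n x : `|D n x| <= `|(L + L) * enorm (G x)|.
      rewrite !normrM; apply: ler_wpM2r => //.
      by rewrite (le_trans (ler_normB _ _))// [leRHS]ger0_norm ?addr_ge0// lerD.
    have cvgD0 : ((LpNorm Omega p (D n)) @[n --> \oo] --> 0)%E.
      have -> : (fun n => LpNorm Omega p (D n)) =
          (fun n => (\int[mu]_(x in Omega) (`|D n x| `^ p)%:E) `^ p^-1)%E.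
        by apply/funext => n; rewrite LpNormE//; exact: pn.
      apply: cvg0_poweR; first by rewrite invr_gt0.
        by move=> n; apply: integral_ge0 => x _; rewrite lee_fin powR_ge0.
      have mg : measurable_fun (Omega : set T) (fun x => (L + L) * enorm (G x)).
        exact: measurable_funM (measurable_cst _) mnG.
      have ig : mu.-integrable (Omega : set T) (fun x => (`|(L + L) * enorm (G x)| `^ p)%:E).
        apply/integrableP; split; first exact: measurable_norm_powR.
        under eq_integral do rewrite gee0_abs ?lee_fin ?powR_ge0//.
        rewrite -LpNorm_powR; last exact: pn.
        rewrite LpNormZ; [|exact: mO|exact: pn|exact: mnG].
        apply: poweR_lty; rewrite lte_mul_pinfty//.
        exact: LpNorm_enorm_lty.
      have aeD : {ae mu, forall x, Omega x -> (`|D n x| `^ p)%:E @[n --> \oo] --> 0%E}.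
        have FF : Filter (nbhs (almost_everywhere mu)) by exact: ae_filter_ringOfSetsType.
        apply: filterS aephi => x + Ox => /(_ Ox) phix.
        apply/fine_cvgP; split; first exact: nearW.
        have H : D n x @[n --> \oo] --> (0 : R).
          rewrite /D -[X in _ --> X](mul0r (enorm (G x))); apply: cvgMr_tmp.
          rewrite -[X in _ --> X](subrr (dF (u x))); apply: cvgB; last exact: cvg_cst.
          exact: (@cvg_comp _ _ _ (fun n => phi n x) dF _ _ _ phix (@cdF (u x))).
        have := @cvg_comp _ _ _ (fun n => D n x) (fun y => `|y| `^ p) _ _ _ H (@continuous_norm_powR _ _ p0 (0 : R)).
        by rewrite /= normr0 powR0.
      have domD : {ae mu, forall x n, Omega x ->
          (`|(`|D n x| `^ p)%:E| <= (`|((L + L) * enorm (G x))%R| `^ p)%:E)%E}.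
        apply: nearW => x n _; rewrite gee0_abs ?lee_fin ?powR_ge0//.
        by apply: ge0_ler_powR; rewrite ?nnegrE ?(ltW p0).
      have [_ _] := @dominated_convergence _ _ _ mu Omega mO (fun n x => (`|D n x| `^ p)%:E)
        (fun=> 0%E) _ (fun n => measurable_norm_powR p (mD n)) (measurable_cst _) aeD ig domD.
      by rewrite integral0.
    apply: (@squeeze_cvge _ _ _ _ (fun=> 0%E) _ (fun n =>
      L%:E * LpNorm Omega p (fun x => enorm (Xgrad X (phi n) x - G x)%R) + LpNorm Omega p (D n))%E).
    * apply: nearW => n; apply/andP; split; first exact: LpNorm_ge0.
      rewrite -{1}(ger0_norm L0) -LpNormZ; [|exact: mO|exact: pn|exact: mXG].
      have mL : measurable_fun (Omega : set T) (fun x => L * enorm (Xgrad X (phi n) x - G x)).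
        exact: measurable_funM (measurable_cst _) (mXG n).
      have mDa : measurable_fun (Omega : set T) (fun x => `|D n x|).
        exact: measurableT_comp (mD n).
      have -> : LpNorm Omega p (D n) = LpNorm Omega p (fun x => `|D n x|).
        rewrite !LpNormE; [|exact: pn|exact: pn].
        by under [in RHS]eq_integral do rewrite normr_id.
      apply: le_trans (LpNormD mO p1 mL mDa).
      apply: le_LpNorm; [exact: mO|exact: p0| |exact: measurable_funD mL mDa|].
        apply: (@measurable_enorm _ _ _ (fun x => Xgrad X (fun x0 => F (phi n x0)) x - dF (u x) *: G x)) => j.
        have -> : (fun x => (Xgrad X (fun x0 => F (phi n x0)) x - dF (u x) *: G x) ord0 j) =
            (fun x => Xgrad X (fun x0 => F (phi n x0)) x ord0 j - dF (u x) * G x ord0 j).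
          by apply/funext => x; rewrite [LHS]mxE; congr (_ + _); rewrite !mxE.
        apply: measurable_funB; last exact: measurable_funM mdFu (mG j).
        exact: (Xgrad_measurable lipX j (testF (tphi n))).
      move=> x _; rewrite (Xgrad_comp _ (tphi n)) ger0_norm ?enorm_ge0// [leRHS]ger0_norm; last first.
        by rewrite addr_ge0// mulr_ge0// enorm_ge0.
      have -> : dF (phi n x) *: Xgrad X (phi n) x - dF (u x) *: G x =
          dF (phi n x) *: (Xgrad X (phi n) x - G x) + (dF (phi n x) - dF (u x)) *: G x.
        by rewrite scalerBr scalerBl addrA subrK.
      apply: le_trans (ler_enormD _ _) _; rewrite !enormZ; apply: lerD.
        by apply: ler_wpM2r; [exact: enorm_ge0|exact: dFL].
      by rewrite normrM (ger0_norm (enorm_ge0 _)).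
    * exact: cvg_cst.
    * rewrite -(adde0 0%E); apply: cvgeD => //.
      by rewrite -(mule0 L%:E); apply: cvgeZl.
Qed.

End chain_rule_W0.

(** * Smooth truncations of powers *)

Section truncated_powers.
Context {R : realType} (dl : R).
Hypothesis dl01 : 0 < dl < 1.
Implicit Types b t : R.
Let dl0 : 0 < dl. Proof. by case/andP: dl01. Qed.
Let dl1 : dl < 1. Proof. by case/andP: dl01. Qed.

(** A smooth substitute for t^2 with values between dl and 1 / dl; its powers are
    smooth and bounded for every exponent. *)
Definition weight t : R := (dl + t ^+ 2) / (1 + dl * t ^+ 2).
(** The slope t w'(t) / (2 w(t)) of log w in terms of log t^2, a number of [0, 1];
    it is 1 for the untruncated weight t^2. *)
Definition slope t : R :=
  (1 - dl ^+ 2) * t ^+ 2 / ((dl + t ^+ 2) * (1 + dl * t ^+ 2)).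
(** A smooth truncation of t |t|^(2 b); [dtpow] is its derivative. *)
Definition tpow b t : R := t * weight t `^ b.
Definition dtpow b t : R := weight t `^ b * (1 + 2 * b * slope t).

Let num_gt0 t : 0 < dl + t ^+ 2.
Proof. by rewrite ltr_pwDl// sqr_ge0. Qed.

Let den_ge1 t : 1 <= 1 + dl * t ^+ 2.
Proof. by rewrite lerDl mulr_ge0 ?sqr_ge0// ltW. Qed.

Let den_gt0 t : 0 < 1 + dl * t ^+ 2.
Proof. exact: lt_le_trans ltr01 (den_ge1 t). Qed.

Lemma weight_gt0 t : 0 < weight t.
Proof. exact: divr_gt0. Qed.

Lemma weight_le t : weight t <= dl + t ^+ 2.
Proof. by rewrite ler_pdivrMr// ler_peMr// ltW. Qed.

Lemma weight_le_inv t : weight t <= dl^-1.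
Proof.
rewrite ler_pdivrMr// mulrDr mulr1 mulrA mulVf ?gt_eqF// mul1r lerD2r.
by rewrite (@le_trans _ _ 1) ?(ltW dl1)// invf_ge1// ltW.
Qed.

Lemma slope_ge0 t : 0 <= slope t.
Proof.
apply: divr_ge0; last by rewrite mulr_ge0// ltW.
by rewrite mulr_ge0 ?sqr_ge0// subr_ge0 exprn_ile1// ltW.
Qed.

Lemma slope_le1 t : slope t <= 1.
Proof.
rewrite ler_pdivrMr ?mulr_gt0// mul1r.
have t2 : 0 <= t ^+ 2 := sqr_ge0 t; have d0 := dl0; have d1 := dl1.
by nra.
Qed.

Lemma is_derive_weight t :
  is_derive t (1 : R) weight (2 * t * (1 - dl ^+ 2) / (1 + dl * t ^+ 2) ^+ 2).
Proof.
have H : is_derive t (1 : R) ((fun y => dl + y ^+ 2) * (fun y => (1 + dl * y ^+ 2)^-1))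
    (2 * t * (1 - dl ^+ 2) / (1 + dl * t ^+ 2) ^+ 2).
  have D1 : is_derive t (1 : R) (fun y => dl + y ^+ 2) (2 * t).
    apply: is_derive_eq; rewrite /GRing.scale/= add0r; ring.
  have D2 : is_derive t (1 : R) (fun y => 1 + dl * y ^+ 2) (dl * (2 * t)).
    apply: is_derive_eq; rewrite /GRing.scale/= ; ring.
  have D3 := @is_deriveV _ (fun y => 1 + dl * y ^+ 2) t _ 1 (lt0r_neq0 (den_gt0 t)) D2.
  apply: is_derive_eq; rewrite /GRing.scale/=.
  have := den_gt0 t; have := num_gt0 t => ? ?; field.
  by rewrite gt_eqF.
exact: H.
Qed.

Lemma is_derive_tpow b t : is_derive t (1 : R) (tpow b) (dtpow b t).
Proof.
have w0 := weight_gt0 t.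
have dw := is_derive_weight t.
have dwb : is_derive t (1 : R) (fun y => weight y `^ b)
    (b * weight t `^ (b - 1) * (2 * t * (1 - dl ^+ 2) / (1 + dl * t ^+ 2) ^+ 2)).
  have db := is_derive1_powR b w0.
  exact: (@is_derive1_comp _ (fun y => y `^ b) weight t _ _ db dw).
have H : is_derive t (1 : R) (id * (fun y => weight y `^ b)) (dtpow b t).
  apply: is_derive_eq; rewrite /GRing.scale/= mulr1 /dtpow powRB ?lt0r_neq0 ?implybT//.
  rewrite powRr1 ?ltW// /slope /weight.
  have := den_gt0 t; have := num_gt0 t; set W := _ `^ b => ? ?; field.
  by rewrite !gt_eqF.
exact: H.
Qed.

Lemma continuous_weight : continuous weight.
Proof.
move=> t; apply/differentiable_continuous/derivable1_diffP.
by have [] := is_derive_weight t.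
Qed.

Lemma continuous_weight_powR b : continuous (fun t => weight t `^ b).
Proof.
move=> t; apply: (@continuous_comp _ _ _ weight (fun y => y `^ b)).
  exact: continuous_weight.
apply/differentiable_continuous/derivable1_diffP.
by have [] := is_derive1_powR b (weight_gt0 t).
Qed.

Lemma continuous_dtpow b : continuous (dtpow b).
Proof.
have csq c0 c1 (t : R) : c0 + c1 * y ^+ 2 @[y --> t] --> c0 + c1 * t ^+ 2.
  apply: cvgD; first exact: cvg_cst.
  by apply: cvgMl_tmp; exact: exprn_continuous.
move=> t; apply: cvgM; first exact: continuous_weight_powR.
apply: cvgD; first exact: cvg_cst.
apply: cvgMl_tmp; apply: cvgM.
  by apply: cvgMl_tmp; exact: exprn_continuous.
apply: cvgV; first by rewrite mulf_neq0// gt_eqF.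
apply: cvgM; last exact: csq.
by have := csq dl 1 t; rewrite mul1r; under eq_fun do rewrite mul1r.
Qed.

Let factor_ge0 b t : 0 <= b -> 0 <= 2 * b * slope t.
Proof. by move=> b0; apply: mulr_ge0; [exact: mulr_ge0|exact: slope_ge0]. Qed.

Lemma dtpow_ge0 b t : 0 <= b -> 0 <= dtpow b t.
Proof.
by move=> b0; apply: mulr_ge0; rewrite ?powR_ge0// addr_ge0// factor_ge0.
Qed.

Lemma dtpow_bounded b t : 0 <= b -> `|dtpow b t| <= dl^-1 `^ b * (1 + 2 * b).
Proof.
move=> b0; rewrite ger0_norm ?dtpow_ge0// ler_pM ?powR_ge0//.
- by rewrite addr_ge0// factor_ge0.
- by rewrite ge0_ler_powR ?nnegrE ?weight_le_inv// ?invr_ge0 ltW// weight_gt0.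
- by rewrite lerD2l ler_piMr ?slope_le1// mulr_ge0.
Qed.

(** Energy of the test function against energy of the truncated power.  Without
    truncation the slope is 1, and the inequality reads 1 <= 1 + 2 p b. *)
Lemma dtpow_powR p b t : 0 <= p -> 0 <= b ->
  dtpow b t `^ p <= (1 + 2 * b) `^ p * dtpow (p * b) t.
Proof.
move=> p0 b0; have e0 := slope_ge0 t; have e1 := slope_le1 t.
have h1 : 0 <= 1 + 2 * b * slope t by rewrite addr_ge0// factor_ge0.
rewrite /dtpow powRM ?powR_ge0// -powRrM (mulrC b p) [leRHS]mulrCA.
apply: ler_wpM2l; first exact: powR_ge0.
apply: (@le_trans _ _ ((1 + 2 * b) `^ p)).
  rewrite ge0_ler_powR ?nnegrE//; first by rewrite addr_ge0// mulr_ge0.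
  by rewrite lerD2l ler_piMr// mulr_ge0.
by rewrite ler_peMr ?powR_ge0// lerDl factor_ge0// mulr_ge0.
Qed.

Lemma tpow0 b : tpow b 0 = 0. Proof. by rewrite /tpow mul0r. Qed.

Lemma norm_tpow b t : `|tpow b t| = `|t| * weight t `^ b.
Proof. by rewrite normrM (ger0_norm (powR_ge0 _ _)). Qed.

(** Where t^2 >= dl the weight is at most 2 t^2, and elsewhere at most 2 dl.  So a
    bound on the truncated power bounds |t|^(2 b + 1) in the limit dl -> 0. *)
Lemma weight_le_tpow b t : 0 <= b ->
  weight t `^ (b + 2^-1) <= 2 * `|tpow b t| + (2 * dl) `^ (b + 2^-1).
Proof.
move=> b0; have w0 := ltW (weight_gt0 t).
have b1 : 0 <= b + 2^-1 by rewrite addr_ge0.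
have [tdl|tdl] := leP (t ^+ 2) dl.
  apply: (@le_trans _ _ ((2 * dl) `^ (b + 2^-1))); last by rewrite lerDr mulr_ge0.
  apply: ge0_ler_powR; [exact: b1|exact: w0|by rewrite nnegrE mulr_ge0 ?(ltW dl0)|].
  by apply: le_trans (weight_le t) _; move: tdl; lra.
rewrite ler_wpDr ?powR_ge0// norm_tpow powRD; last first.
  by rewrite (gt_eqF (weight_gt0 t)) implybT.
rewrite mulrC mulrA ler_wpM2r ?powR_ge0// powR12_sqrt//.
rewrite -(@ler_pXn2r _ 2) ?nnegrE ?sqrtr_ge0 ?mulr_ge0// sqr_sqrtr//.
rewrite exprMn real_normK ?num_real// (le_trans (weight_le t))//.
have t2 : 0 <= t ^+ 2 := sqr_ge0 t; move: tdl t2; set y := t ^+ 2; lra.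
Qed.

(** With gamma = 1 + 2 b, the exponent on the right is
    sigma = (p (gamma - 1) + 1) / gamma.  One factor is the truncated power
    itself; the remaining power of the weight is handled by [weight_le_tpow]. *)
Lemma norm_tpow_le p b t : 1 <= p -> 0 <= b ->
  `|tpow (p * b) t| <=
  (2 * `|tpow b t| + (2 * dl) `^ (b + 2^-1)) `^ (1 + (p - 1) * b / (b + 2^-1)).
Proof.
move=> p1 b0; have w0 := weight_gt0 t.
have b1 : 0 < b + 2^-1 by rewrite ltr_wpDl.
have q0 : 0 <= (p - 1) * b / (b + 2^-1).
  by rewrite divr_ge0 ?(ltW b1)// mulr_ge0// subr_ge0.
have -> : `|tpow (p * b) t| = `|tpow b t| * (weight t `^ (b + 2^-1)) `^ ((p - 1) * b / (b + 2^-1)).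
  rewrite !norm_tpow -mulrA -powRrM -powRD ?(gt_eqF w0) ?implybT//.
  by congr (_ * _ `^ _); field; rewrite gt_eqF// ltr_pwDr// mulr_ge0.
have Z0 : 0 <= 2 * `|tpow b t| + (2 * dl) `^ (b + 2^-1) by rewrite addr_ge0 ?mulr_ge0 ?powR_ge0.
rewrite [leRHS]powRD ?(gt_eqF (ltr_wpDr q0 ltr01))// powRr1//.
apply: ler_pM; rewrite ?powR_ge0//.
  by rewrite (@le_trans _ _ (2 * `|tpow b t|)) ?lerDl ?powR_ge0// mulr_natl mulr2n lerDl.
by rewrite ge0_ler_powR ?nnegrE ?powR_ge0// weight_le_tpow.
Qed.

Lemma class_C_tpow N (u : 'rV[R]_N -> R) b : (forall k, class_C k u) ->
  forall k, class_C k (fun x => tpow b (u x)).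
Proof.
move=> Cu k.
have Csq c0 c1 j : class_C j (fun x => c0 + c1 * u x ^+ 2).
  apply: class_CD; first exact: class_C_cst.
  by apply: class_CM; [exact: class_C_cst|apply: class_CM].
apply: class_CM => //; apply: class_C_powR => [x|j]; first exact: weight_gt0.
have -> : (fun x => weight (u x)) =
    (fun x => (dl + 1 * u x ^+ 2) * (1 + dl * u x ^+ 2) `^ (-1)).
  by apply/funext => x; rewrite /weight mul1r powR_inv1// ltW.
by apply: class_CM; [exact: Csq|apply: class_C_powR; [move=> x|move=> i]; [|exact: Csq]].
Qed.

End truncated_powers.

(** * Integral inequalities for the energy estimate *)

Section integral_below.
Import HBNNSimple.
Local Open Scope ereal_scope.
Context d (T : measurableType d) (R : realType) (mu : {measure set T -> \bar R}).

(** The integral of an arbitrary g is a difference of two suprema over simple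
    functions.  The lower bound by h >= 0 forces the simple functions below the
    negative part of g to vanish almost everywhere, and those below h to lie
    below the positive part of g up to a null set.  This is applied to the
    integrand a(x, u, Xu) . Xv. *)
Lemma ae_le_integral_below (D : set T) (h g : T -> \bar R) : measurable D ->
  (forall x, D x -> 0 <= h x) -> measurable_fun D h ->
  {ae mu, forall x, D x -> h x <= g x} ->
  \int[mu]_(x in D) h x <= \int[mu]_(x in D) g x.
Proof.
move=> mD h0 mh [B [mB B0 sB]].
have hg x : D x -> ~ B x -> h x <= g x.
  move=> Dx nBx; apply: contrapT => nhg; apply: nBx; apply: sB => /= H.
  by apply: nhg; exact: H.
have aeB : {ae mu, forall x, ~ B x}.
  by exists B; split => // x /= /contrapT.
have FF : Filter (nbhs (almost_everywhere mu)) by exact: ae_filter_ringOfSetsType.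
rewrite (integralE _ _ g).
have -> : \int[mu]_(x in D) (g^\- x) = 0.
  apply/eqP; rewrite eq_le integral_ge0 ?andbT//.
  rewrite ge0_integralE//; apply: ge_ereal_sup => _ [k kg <-].
  rewrite -integralT_nnsfun.
  have : \int[mu]_x (k x)%:E = \int[mu]_x (cst 0 x).
    apply: ae_eq_integral => //; first exact/measurable_EFinP.
    apply: filterS aeB => x nBx _; apply: le_anti; apply/andP; split; last first.
      by rewrite /cst lee_fin; exact: fun_ge0.
    apply: le_trans (kg x) _.
    rewrite patchE; case: ifPn => // /set_mem Dx.
    rewrite funenegE ge_max lexx andbT leeNl oppe0.
    by rewrite (le_trans (h0 x Dx))// hg.
  by move=> ->; rewrite integral_cst// mul0e.
rewrite sube0.
pose h1 := h \_ (~` B).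
have -> : \int[mu]_(x in D) h x = \int[mu]_(x in D) h1 x.
  apply: ae_eq_integral => //.
    apply/(measurable_restrict _ (measurableC mB) mD).
    by apply: measurable_funS mh => //; exact: subIsetl.
  by apply: filterS aeB => x nBx _; rewrite /h1 patchE mem_set.
rewrite ge0_integralE; last first.
  by move=> x Dx; rewrite /h1 patchE; case: ifP => // _; exact: h0.
rewrite ge0_integralE//; apply: le_ereal_sup => _ [k kh <-]; exists k => //= x.
apply: le_trans (kh x) _; rewrite !patchE; case: ifPn => // /set_mem Dx.
rewrite /h1 patchE; case: ifPn => [/set_mem nBx|_]; last by rewrite funeposE le_max lexx orbT.
by rewrite funeposE le_max hg.
Qed.

End integral_below.

Section lp_hoelder.
Context {R : realType} {N : nat} (Omega : set 'rV[R]_N).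
Local Notation mu := (@lebesgueN R N).
Local Notation T := (caratheodory_type (@lebesgue_outer R N)).
Hypothesis mO : measurable (Omega : set T).
Implicit Types (f g : 'rV[R]_N -> R).

Lemma LpNorm_hoelder r r' f g : 0 < r -> 0 < r' -> r^-1 + r'^-1 = 1 ->
  measurable_fun (Omega : set T) (f : T -> R) ->
  measurable_fun (Omega : set T) (g : T -> R) ->
  (\int[mu]_(x in Omega) (f x * g x)%:E <= LpNorm Omega r f * LpNorm Omega r' g)%E.
Proof.
move=> r0 r'0 rr' mf mg.
have mfg : measurable_fun (Omega : set T) (fun x => (f x * g x)%:E).
  by apply/measurable_EFinP; exact: measurable_funM.
apply: le_trans (lee_abs _) _; apply: le_trans (le_abse_integral mu mO mfg) _.
have := hoelder mu ((measurable_patch mO f).2 mf) ((measurable_patch mO g).2 mg) r0 r'0 rr'.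
apply: le_trans; rewrite Lnorm1 integral_mkcond.
have -> : ((fun x => `|(f x * g x)%:E|) \_ Omega = fun x => `|(EFin \o ((f \_ Omega) \* (g \_ Omega))%R) x|)%E.
  apply/funext => x /=; rewrite !patchE; case: ifP => _ //.
  by rewrite mul0r normr0.
exact: lexx.
Qed.

Lemma LpNorm_cst_lty q : 0 < q -> (mu Omega < +oo)%E ->
  (LpNorm Omega q (fun=> 1%R) < +oo)%E.
Proof.
move=> q0 mOy; rewrite LpNormE ?gt_eqF//; apply: poweR_lty.
under eq_integral do rewrite normr1 powR1.
by rewrite integral_cst// mul1e.
Qed.

End lp_hoelder.

(** Either the error e already dominates A, or A <= 4 Sp I^(1 / p); in the second
    case A^p is at most a multiple of F A^sg, and A^sg is divided out. *)
Lemma absorb_power (R : realType) (p sg F A I c Sp alpha e : R) :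
  0 < Sp -> 0 < alpha -> 0 <= c -> 1 <= p -> 0 <= sg < p ->
  0 <= A -> 0 <= I -> 0 <= F -> 0 <= e ->
  alpha * I <= c * (F * A `^ sg) ->
  A <= 2 * (Sp * I `^ p^-1) + e ->
  A <= 2 * e + ((4 * Sp) `^ p * c / alpha * F) `^ (p - sg)^-1.
Proof.
move=> Sp0 al0 c0 p1 /andP[sg0 sgp] A0 I0 F0 e0 H1 H2.
have p0 : 0 < p := lt_le_trans ltr01 p1.
have [Ae|eA] := leP A (2 * e); first by rewrite (le_trans Ae)// lerDl powR_ge0.
have Ap : 0 < A by apply: le_lt_trans eA; rewrite mulr_ge0.
have psg : 0 < p - sg by rewrite subr_gt0.
have H3 : A <= 4 * Sp * I `^ p^-1.
  have : A <= 2 * (Sp * I `^ p^-1) + A / 2 by apply: le_trans H2 _; rewrite lerD2l; move: eA; clear; lra.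
  rewrite -mulrA; set y := Sp * _; clear; lra.
have H4 : A `^ p <= (4 * Sp) `^ p * I.
  have -> : (4 * Sp) `^ p * I = (4 * Sp * I `^ p^-1) `^ p.
    by rewrite [RHS]powRM ?powR_ge0 ?mulr_ge0 ?(ltW Sp0)// -powRrM mulVf ?gt_eqF// powRr1.
  by apply: ge0_ler_powR; rewrite ?nnegrE ?(ltW p0) ?mulr_ge0 ?powR_ge0 ?(ltW Sp0).
have H5 : A `^ p <= (4 * Sp) `^ p * c / alpha * F * A `^ sg.
  apply: le_trans H4 _; rewrite -!mulrA; apply: ler_wpM2l; first exact: powR_ge0.
  by rewrite mulrCA ler_pdivlMl.
have H6 : A `^ (p - sg) <= (4 * Sp) `^ p * c / alpha * F.
  by rewrite powRB ?gt_eqF ?implybT// ler_pdivrMr ?powR_gt0.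
apply: ler_wpDl; first by rewrite mulr_ge0.
have -> : A = (A `^ (p - sg)) `^ (p - sg)^-1.
  by rewrite -powRrM mulfV ?gt_eqF// powRr1.
have K0 : 0 <= (4 * Sp) `^ p * c / alpha * F.
  by apply: mulr_ge0 => //; apply: divr_ge0; [apply: mulr_ge0; [exact: powR_ge0|]|exact: ltW].
apply: ge0_ler_powR; [by rewrite invr_ge0 ltW|by rewrite nnegrE powR_ge0|exact: K0|exact: H6].
Qed.

(** * The a priori estimate *)

Section a_priori_estimate.
Context {R : realType} {N d : nat} (X : 'rV[R]_N -> 'M[R]_(d, N)) (Omega : set 'rV[R]_N).
Local Notation mu := (@lebesgueN R N).
Local Notation T := (caratheodory_type (@lebesgue_outer R N)).
Hypothesis mO : measurable (Omega : set T).
Hypothesis lipX : locally_lipschitz X.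
Hypothesis mOy : (mu Omega < +oo)%E.
Variables (p q m b alpha Sp : R).
Hypotheses (p1 : 1 < p) (q1 : 1 <= q) (m1 : 1 < m) (b0 : 0 <= b) (al0 : 0 < alpha) (Sp0 : 0 < Sp).
Let sg := 1 + (p - 1) * b / (b + 2^-1).
Hypothesis sgq : sg / q = 1 - m^-1.
Hypothesis sobolev : forall w G, W0 X Omega p w G ->
  (LpNorm Omega q w <= Sp%:E * LpNorm Omega p (fun x => enorm (G x)))%E.
Variables (a : 'rV[R]_N -> R -> 'rV[R]_d -> 'rV[R]_d) (f u : 'rV[R]_N -> R) (G : 'rV[R]_N -> 'rV[R]_d).
Hypothesis coercive : {ae mu, forall x, Omega x -> forall s xi,
  alpha * enorm xi `^ p <= dotp (a x s xi) xi}.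
Hypothesis fm : in_Lp Omega m f.
Hypothesis uG : W0 X Omega p u G.
Hypothesis weak : forall v Xv, W0 X Omega p v Xv ->
  (\int[mu]_(x in Omega) (dotp (a x (u x) (G x)) (Xv x))%:E =
   \int[mu]_(x in Omega) (f x * v x)%:E)%E.

Let p0 : 0 < p. Proof. exact: lt_trans p1. Qed.
Let q0 : 0 < q. Proof. exact: lt_le_trans q1. Qed.
Let m0 : 0 < m. Proof. exact: lt_trans m1. Qed.
Let qn : q != 0. Proof. by rewrite gt_eqF. Qed.
Let pn : p != 0. Proof. by rewrite gt_eqF. Qed.
Let c := 1 + 2 * b.
Let c0 : 0 < c. Proof. by rewrite ltr_wpDr// mulr_ge0. Qed.
Let bh : 0 < b + 2^-1. Proof. by rewrite ltr_wpDl. Qed.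
Let sg1 : 1 <= sg.
Proof. by rewrite lerDl divr_ge0 ?(ltW bh)// mulr_ge0// subr_ge0 ltW. Qed.
Let sgp : p - sg = (p - 1) / c.
Proof. by rewrite /sg /c; field; rewrite !gt_eqF// ltr_pwDr// mulr_ge0. Qed.

Section fixed_truncation.
Variable dl : R.
Hypothesis dl01 : 0 < dl < 1.
Let eta := (2 * dl) `^ (b + 2^-1).
Let Z x := 2 * `|tpow dl b (u x)| + eta.

Let Z0 x : 0 <= Z x.
Proof. by rewrite addr_ge0 ?mulr_ge0 ?powR_ge0. Qed.

Lemma W0_tpow b' : 0 <= b' ->
  W0 X Omega p (fun x => tpow dl b' (u x)) (fun x => dtpow dl b' (u x) *: G x).
Proof.
move=> b'0; apply: (@W0_comp _ _ _ X Omega mO lipX p (tpow dl b') (dtpow dl b') _ (ltW p1)).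
- exact: tpow0.
- by move=> t; exact: is_derive_tpow.
- exact: continuous_dtpow.
- by move=> t; exact: dtpow_bounded.
- move=> phi tphi; have [Cphi _ _] := tphi.
  by apply: (test_function_comp (tpow0 dl b') _ tphi); exact: class_C_tpow.
- exact: uG.
Qed.

Let mtpow b' : 0 <= b' -> measurable_fun (Omega : set T) (fun x => tpow dl b' (u x)).
Proof. by move=> b'0; have [] := W0_measurable mO (W0_tpow b'0). Qed.

Let mZ : measurable_fun (Omega : set T) Z.
Proof.
apply: measurable_funD; last exact: measurable_cst.
apply: measurable_funM; first exact: measurable_cst.
exact: (measurableT_comp (@normr_measurable R setT) (mtpow b0)).
Qed.

Let pb0 : 0 <= p * b. Proof. by rewrite mulr_ge0// ltW. Qed.

Let mdG : measurable_fun (Omega : set T) (fun x => enorm (dtpow dl b (u x) *: G x)).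
Proof.
have [_ mG] := W0_measurable mO (W0_tpow b0).
exact: (@measurable_enorm _ _ _ (fun x => dtpow dl b (u x) *: G x)).
Qed.

(** Coercivity and [dtpow_powR] on the left, Hoelder's inequality and
    [norm_tpow_le] on the right, for the test function tpow dl (p b) u. *)
Lemma truncated_energy_le :
  ((alpha / c `^ p)%:E *
     \int[mu]_(x in Omega) (enorm (dtpow dl b (u x) *: G x) `^ p)%:E <=
   LpNorm Omega m f * LpNorm Omega q Z `^ sg)%E.
Proof.
have k0 : 0 < alpha / c `^ p by rewrite divr_gt0// powR_gt0.
have mI : measurable_fun (Omega : set T) (fun x => (enorm (dtpow dl b (u x) *: G x) `^ p)%:E).
  by apply/measurable_EFinP/measurable_fun_powR.
have HW := weak (W0_tpow pb0).
rewrite -ge0_integralZl_EFin; [|exact: mO| |exact: mI|exact: ltW]; last first.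
  by move=> x _; rewrite lee_fin powR_ge0.
apply: (@le_trans _ _ (\int[mu]_(x in Omega)
    (dotp (a x (u x) (G x)) (dtpow dl (p * b) (u x) *: G x))%:E)%E).
  apply: ae_le_integral_below.
  - exact: mO.
  - by move=> x _; rewrite mule_ge0// lee_fin ?powR_ge0// ltW.
  - by apply/measurable_EFinP; apply: measurable_funM (measurable_cst _) _; exact/measurable_EFinP.
  have FF : Filter (nbhs (almost_everywhere mu)) by exact: ae_filter_ringOfSetsType.
  apply: filterS coercive => x + Ox => /(_ Ox (u x) (G x)) co.
  rewrite -EFinM lee_fin dotpZr enormZ powRM ?enorm_ge0//.
  rewrite ger0_norm; last exact: dtpow_ge0.
  apply: (@le_trans _ _ (dtpow dl (p * b) (u x) * (alpha * enorm (G x) `^ p))); last first.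
    by apply: ler_wpM2l => //; exact: dtpow_ge0.
  rewrite [leLHS]mulrA [leRHS]mulrA; apply: ler_wpM2r; first exact: powR_ge0.
  rewrite mulrAC ler_pdivrMr ?powR_gt0// [leRHS]mulrAC mulrC ler_wpM2r ?(ltW al0)// mulrC.
  by apply: dtpow_powR => //; exact: ltW.
rewrite HW.
have r0 : 0 < (1 - m^-1)^-1 by rewrite invr_gt0 subr_gt0 invf_lt1.
have mPhi := mtpow pb0.
have mf : measurable_fun (Omega : set T) f by have [] := (in_LpP mO m f).1 fm.
apply: (@le_trans _ _ (LpNorm Omega m f * LpNorm Omega (1 - m^-1)^-1 (fun x => tpow dl (p * b) (u x)))%E).
  apply: LpNorm_hoelder; [exact: mO|exact: m0|exact: r0| |exact: mf|exact: mPhi].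
  by rewrite invrK addrC subrK.
apply: lee_wpmul2l; first exact: LpNorm_ge0.
have mZs : measurable_fun (Omega : set T) (fun x => Z x `^ sg) by exact: measurable_fun_powR.
apply: (@le_trans _ _ (LpNorm Omega (1 - m^-1)^-1 (fun x => Z x `^ sg))).
  apply: le_LpNorm; [exact: mO|exact: r0|exact: mPhi|exact: mZs|].
  move=> x _; rewrite [leRHS]ger0_norm ?powR_ge0//.
  exact: (norm_tpow_le dl01 _ (ltW p1) b0).
rewrite !LpNormE; [|exact: qn|by rewrite gt_eqF].
rewrite -poweRrM invrK -sgq [q^-1 * _]mulrC.
suff -> : (\int[mu]_(x in Omega) (`|Z x `^ sg| `^ (sg / q)^-1)%:E =
    \int[mu]_(x in Omega) (`|Z x| `^ q)%:E)%E by exact: lexx.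
apply: eq_integral => x _; congr (_%:E).
rewrite (ger0_norm (Z0 x)) ger0_norm ?powR_ge0// -powRrM.
congr (_ `^ _); have : sg != 0 by rewrite gt_eqF// (lt_le_trans ltr01).
by move=> sgn; rewrite invf_div mulrCA mulfV// mulr1.
Qed.

(** Z exceeds 2 |tpow dl b u| by a constant that vanishes with dl, so its L^q norm
    A is finite by the Sobolev inequality, and [absorb_power] applies. *)
Lemma truncated_bound : exists A, [/\ 0 <= A,
  (\int[mu]_(x in Omega) (`|weight dl (u x) `^ 2^-1| `^ (c * q))%:E <= (A `^ q)%:E)%E &
  A <= 2 * (eta * fine (LpNorm Omega q (fun=> 1%R))) +
    ((4 * Sp) `^ p * c `^ p / alpha * fine (LpNorm Omega m f)) `^ (c / (p - 1))].
Proof.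
have L1 : LpNorm Omega q (fun=> 1%R) \is a fin_num.
  by rewrite ge0_fin_numE ?LpNorm_ge0//; exact: LpNorm_cst_lty.
have fF : LpNorm Omega m f \is a fin_num.
  rewrite ge0_fin_numE; last exact: LpNorm_ge0.
  by have [] := (in_LpP mO m f).1 fm.
have eta0 : 0 <= eta by exact: powR_ge0.
have Psi := sobolev (W0_tpow b0).
have [_ GL _] := W0_tpow b0.
have Ify := LpNorm_enorm_lty mO (ltW p1) GL.
set E := LpNorm Omega p _ in Psi Ify.
have E0 : (0 <= E)%E by exact: LpNorm_ge0.
have fE : E \is a fin_num by rewrite ge0_fin_numE.
have Zle : (LpNorm Omega q Z <= 2%:E * (Sp%:E * E) + eta%:E * LpNorm Omega q (fun=> 1%R))%E.
  have mP : measurable_fun (Omega : set T) (fun x => `|tpow dl b (u x)|).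
    exact: (measurableT_comp (@normr_measurable R setT) (mtpow b0)).
  have m1' : measurable_fun (Omega : set T) (fun=> 1 : R) by exact: measurable_cst.
  have EZ : Z = (fun x => 2 * `|tpow dl b (u x)| + eta * 1).
    by apply/funext => x; rewrite mulr1.
  rewrite EZ; apply: le_trans (LpNormD mO q1 _ _) _.
  - exact: measurable_funM (measurable_cst _) mP.
  - exact: measurable_funM (measurable_cst _) m1'.
  rewrite (LpNormZ mO 2 qn mP) (LpNormZ mO eta qn m1').
  rewrite ger0_norm// (ger0_norm eta0); apply: leeD; last exact: lexx.
  apply: lee_wpmul2l; first by rewrite lee_fin.
  apply: le_trans Psi; rewrite !LpNormE; [|exact: qn|exact: qn].
  suff -> : (\int[mu]_(x in Omega) (`|(`|tpow dl b (u x)|)%R| `^ q)%:E =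
      \int[mu]_(x in Omega) (`|tpow dl b (u x)| `^ q)%:E)%E by exact: lexx.
  by apply: eq_integral => x _; rewrite normr_id.
have fZ : LpNorm Omega q Z \is a fin_num.
  rewrite ge0_fin_numE; last exact: LpNorm_ge0.
  apply: le_lt_trans Zle _; rewrite -(fineK L1) -(fineK fE) -!EFinM -EFinD.
  exact: ltry.
have Z0' : 0 <= fine (LpNorm Omega q Z) by rewrite fine_ge0// LpNorm_ge0.
exists (fine (LpNorm Omega q Z)); split.
- exact: Z0'.
- rewrite -poweR_EFin fineK// LpNorm_powR; last exact: qn.
  have mw : measurable_fun (Omega : set T) (fun x => weight dl (u x)).
    have mwt : measurable_fun [set: R] (weight dl).
      by apply: continuous_measurable_fun; exact: continuous_weight.
    by apply: (measurableT_comp mwt); have [] := W0_measurable mO uG.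
  apply: ge0_le_integral.
  + exact: mO.
  + by move=> x _; rewrite lee_fin powR_ge0.
  + by apply: measurable_norm_powR; exact: measurable_fun_powR.
  + exact: measurable_norm_powR.
  move=> x _; rewrite lee_fin ger0_norm ?powR_ge0// -powRrM.
  have -> : 2^-1 * (c * q) = (b + 2^-1) * q by rewrite /c; field.
  rewrite powRrM; apply: ge0_ler_powR; rewrite ?nnegrE ?powR_ge0 ?(ltW q0)//.
  rewrite ger0_norm; last exact: Z0.
  exact: weight_le_tpow.
- have -> : c / (p - 1) = (p - sg)^-1 by rewrite sgp invf_div.
  pose I := fine (E `^ p)%E.
  have I0 : 0 <= I by rewrite fine_ge0// poweR_ge0.
  have EI : I `^ p^-1 = fine E.
    rewrite /I fine_poweR -powRrM mulfV; last exact: pn.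
    by rewrite powRr1// fine_ge0.
  apply: (@absorb_power _ p sg (fine (LpNorm Omega m f)) _ I) => //.
  + exact: powR_ge0.
  + exact: ltW.
  + rewrite (le_trans ler01 sg1)/= -subr_gt0 sgp divr_gt0// subr_gt0; exact: p1.
  + by rewrite fine_ge0// LpNorm_ge0.
  + by rewrite mulr_ge0// fine_ge0// LpNorm_ge0.
  + have := truncated_energy_le.
    have -> : (\int[mu]_(x in Omega) (enorm (dtpow dl b (u x) *: G x) `^ p)%:E = E `^ p)%E.
      rewrite /E LpNorm_powR; last exact: pn.
      by apply: eq_integral => x _; rewrite ger0_norm// enorm_ge0.
    rewrite -(fineK fF) -[in X in (_ <= _ * X)%E](fineK fZ) poweR_EFin.
    have -> : (E `^ p)%E = I%:E by rewrite /I fineK// fin_num_poweR.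
    rewrite -!EFinM lee_fin -[in X in _ -> X]ler_pdivrMl ?powR_gt0//.
    by rewrite [in X in _ -> X]mulrA [in X in _ -> X](mulrC (_^-1)).
  + move: Zle; rewrite -{1}(fineK fZ) -(fineK L1) -(fineK fE) -!EFinM -EFinD lee_fin.
    by rewrite EI.
Qed.

End fixed_truncation.

Lemma cvg_weight (t : R) (dl : nat -> R) : (forall n, 0 < dl n < 1) ->
  dl n @[n --> \oo] --> (0 : R) ->
  weight (dl n) t `^ 2^-1 @[n --> \oo] --> `|t|.
Proof.
move=> dl01 dl0; have h2 : 0 < 2^-1 :> R by rewrite invr_gt0.
have H : weight (dl n) t @[n --> \oo] --> (0 + t ^+ 2) / (1 + 0 * t ^+ 2).
  apply: cvgM; first by apply: cvgD => //; exact: cvg_cst.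
  apply: cvgV; first by rewrite mul0r addr0.
  by apply: cvgD; [exact: cvg_cst|apply: cvgMr_tmp].
have := @cvg_comp _ _ _ (fun n => weight (dl n) t) (fun y => `|y| `^ 2^-1) _ _ _ H
  (@continuous_norm_powR _ 2^-1 h2 _).
rewrite mul0r add0r addr0 divr1 ger0_norm ?sqr_ge0// powR12_sqrt ?sqr_ge0// sqrtr_sqr.
apply: cvg_trans; apply: near_eq_cvg; apply: nearW => n /=.
by rewrite (ger0_norm (ltW (weight_gt0 (dl01 n) t))).
Qed.

(** The bound of [truncated_bound] does not depend on dl up to a term that tends to
    0.  By Fatou it passes to |u|, with an arbitrarily small e added to B. *)
Lemma weak_solution_estimate :
  in_Lp Omega (c * q) u /\
  (LpNorm Omega (c * q) u <=
    (((4 * Sp) `^ p * c `^ p / alpha) `^ (p - 1)^-1)%:E * LpNorm Omega m f `^ (p - 1)^-1)%E.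
Proof.
set K := (4 * Sp) `^ p * c `^ p / alpha.
have K0 : 0 <= K by rewrite divr_ge0 ?(ltW al0)// mulr_ge0// powR_ge0.
have cq0 : 0 < c * q by rewrite mulr_gt0.
have cqn : c * q != 0 by rewrite gt_eqF.
have [mu_ _] := W0_measurable mO uG.
pose dl (n : nat) : R := n.+2%:R^-1.
have dl01 n : 0 < dl n < 1 by rewrite invr_gt0 ltr0n /= invf_lt1 ?ltr0n// ltr1n.
have dl0 : dl n @[n --> \oo] --> (0 : R).
  have := @cvg_harmonic R; rewrite -(cvg_shiftS (@harmonic R)); exact.
have fF : LpNorm Omega m f \is a fin_num.
  rewrite ge0_fin_numE; last exact: LpNorm_ge0.
  by have [] := (in_LpP mO m f).1 fm.
set F := fine (LpNorm Omega m f).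
have F0 : 0 <= F by rewrite fine_ge0// LpNorm_ge0.
set V := fine (LpNorm Omega q (fun=> 1%R)).
have V0 : 0 <= V by rewrite fine_ge0// LpNorm_ge0.
set B := (K * F) `^ (c / (p - 1)).
have B0 : 0 <= B by exact: powR_ge0.
have mw n : measurable_fun (Omega : set T) (fun x => weight (dl n) (u x) `^ 2^-1).
  have mwt : measurable_fun [set: R] (weight (dl n)).
    by apply: continuous_measurable_fun; exact: continuous_weight.
  by apply: measurable_fun_powR; exact: (measurableT_comp mwt).
have aew : {ae mu, forall x, Omega x -> weight (dl n) (u x) `^ 2^-1 @[n --> \oo] --> `|u x|}.
  by apply: nearW => x _; exact: cvg_weight.
have cvg_eta : 2 * ((2 * dl n) `^ (b + 2^-1) * V) @[n --> \oo] --> (0 : R).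
  have H2 : 2 * dl n @[n --> \oo] --> (0 : R).
    by rewrite -[X in _ --> X](mulr0 2); apply: cvgMl_tmp.
  have := @cvg_comp _ _ _ (fun n => 2 * dl n) (fun y => `|y| `^ (b + 2^-1)) _ _ _ H2
    (@continuous_norm_powR _ _ bh (0 : R)).
  rewrite normr0 powR0 ?gt_eqF// => H3.
  rewrite -[X in _ --> X](mulr0 2); apply: cvgMl_tmp.
  rewrite -[X in _ --> X](mul0r V); apply: cvgMr_tmp.
  apply: cvg_trans H3; apply: near_eq_cvg; apply: nearW => n /=.
  by rewrite ger0_norm// mulr_ge0// ltW//; case/andP: (dl01 n).
have muu : measurable_fun (Omega : set T) (fun x => `|u x|) by exact: measurableT_comp.
have bound e : 0 < e -> (LpNorm Omega (c * q) u <= ((e + B) `^ c^-1)%:E)%E.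
  move=> e0.
  have eB : 0 <= e + B by rewrite addr_ge0// ltW.
  have : (\int[mu]_(x in Omega) (`|(`|u x|)%R| `^ (c * q))%:E <= ((e + B) `^ q)%:E)%E.
    apply: (@fatou_bound _ _ _ mu (c * q) ((e + B) `^ q) Omega
      (fun n x => weight (dl n) (u x) `^ 2^-1) (fun x => `|u x|) cq0 mO mw muu aew).
    near=> n.
    have [A [A0 HA1 HA2]] := truncated_bound (dl01 n).
    apply: le_trans HA1 _; rewrite lee_fin.
    apply: ge0_ler_powR; rewrite ?nnegrE ?(ltW q0)//.
    apply: le_trans HA2 _; apply: lerD; last exact: lexx.
    apply: le_trans (ler_norm _) _; apply: ltW; rewrite -normrN -sub0r.
    by near: n; move/cvgrPdist_lt : cvg_eta => /(_ _ e0).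
  under eq_integral do rewrite normr_id.
  move=> H; rewrite LpNormE//.
  apply: (@le_trans _ _ (((e + B) `^ q)%:E `^ (c * q)^-1)%E).
    apply: gt0_ler_poweR => //; first by rewrite invr_ge0 ltW.
      have I0 : (0 <= \int[mu]_(x in Omega) (`|u x| `^ (c * q))%:E)%E.
        by apply: integral_ge0 => x _; rewrite lee_fin powR_ge0.
      by rewrite in_itv/= leey andbT; exact: I0.
    by rewrite in_itv/= leey andbT lee_fin powR_ge0.
  rewrite poweR_EFin -powRrM lee_fin le_eqVlt; apply/orP; left; apply/eqP.
  by congr (_ `^ _); rewrite invfM mulrCA mulfV// mulr1.
have fu : LpNorm Omega (c * q) u \is a fin_num.
  rewrite ge0_fin_numE; last exact: LpNorm_ge0.
  by apply: le_lt_trans (bound 1 ltr01) _; exact: ltry.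
split.
  apply/(in_LpP mO); split; first exact: mu_.
  by rewrite -ge0_fin_numE//; exact: LpNorm_ge0.
rewrite -(fineK fu) -(fineK fF) poweR_EFin -EFinM lee_fin -/F.
set y := fine _; have y0 : 0 <= y by rewrite fine_ge0// LpNorm_ge0.
have yB : y `^ c <= B.
  apply/ler_addgt0Pr => e e0; rewrite addrC.
  have eB : 0 <= e + B by rewrite addr_ge0// ltW.
  have := bound e e0; rewrite -(fineK fu) lee_fin -/y => yb.
  have -> : e + B = ((e + B) `^ c^-1) `^ c by rewrite -powRrM mulVf ?gt_eqF// powRr1.
  by apply: ge0_ler_powR; rewrite ?nnegrE ?powR_ge0 ?(ltW c0).
have -> : y = (y `^ c) `^ c^-1 by rewrite -powRrM mulfV ?gt_eqF// powRr1.
rewrite -powRM//.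
have -> : (K * F) `^ (p - 1)^-1 = B `^ c^-1.
  rewrite /B -powRrM; congr (_ `^ _).
  by rewrite mulrAC mulfV ?gt_eqF// mul1r.
by apply: ge0_ler_powR; rewrite ?nnegrE ?powR_ge0 ?invr_ge0 ?(ltW c0).
Unshelve. all: by end_near. Qed.

End a_priori_estimate.

(** * Relations between the exponents, and conclusion *)

Theorem theorem4p4 (R : realType) (Q p m alpha s : R)
  (hQ : 2 < Q) (hp : 1 < p < Q)
  (hm : p * Q / (Q * (p - 1) + p) <= m < Q / p)
  (halpha : 0 < alpha)
  (hs : s = m * (p - 1) * Q / (Q - m * p)) :
  s = sobolev_exponent Q (sobolev_exponent Q m * (p - 1)) /\
  exists C : R -> R,
  forall (N d : nat) (X : 'rV[R]_N -> 'M[R]_(d, N)) (Omega : set 'rV[R]_N),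
  (2 <= N)%N -> (2 <= d)%N ->
  open Omega -> bounded_set Omega ->
  standing_assumptions X Q ->
  (exists Sp, sobolev_constant X Omega p Q Sp) /\
  forall Sp, sobolev_constant X Omega p Q Sp ->
  forall (beta : R) (h : 'rV[R]_N -> R)
    (a : 'rV[R]_N -> R -> 'rV[R]_d -> 'rV[R]_d) (f u : 'rV[R]_N -> R),
  0 < beta ->
  operator_assumptions Omega p alpha beta h a ->
  in_Lp Omega m f ->
  weak_solution X Omega p a f u ->
  in_Lp Omega s u /\
  (LpNorm Omega s u <= (C Sp)%:E * LpNorm Omega m f `^ (p - 1)^-1)%E.
Proof.
move: hp hm => /andP[p1 pQ] /andP[pm mQ].
have p0 : 0 < p := lt_trans ltr01 p1.
have Q0 : 0 < Q := lt_trans p0 pQ.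
have mp : 0 < Q - m * p by rewrite subr_gt0 -ltr_pdivlMr.
have D0 : 0 < Q * (p - 1) + p by rewrite ltr_wpDl// mulr_ge0 ?(ltW Q0)// subr_ge0 ltW.
have pm' : p * Q <= m * (Q * (p - 1) + p) by rewrite -ler_pdivrMr.
have m1 : 1 < m.
  rewrite -(ltr_pM2r D0) mul1r; apply: lt_le_trans pm'.
  by rewrite -subr_gt0 (_ : _ - _ = Q - p) ?subr_gt0//; ring.
have m0 : 0 < m := lt_trans ltr01 m1.
have Qp : 0 < Q - p by rewrite subr_gt0.
have Qm : 0 < Q - m.
  rewrite subr_gt0; apply: lt_le_trans mQ _.
  by rewrite ler_pdivrMr// ler_peMr ?(ltW Q0)// ltW.
(* 1 + 2 b is s divided by the Sobolev exponent of p, and b >= 0 is the lower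
   bound on m. *)
pose b := (m * (Q * (p - 1) + p) - p * Q) / (2 * (p * (Q - m * p))).
have b0 : 0 <= b.
  by rewrite divr_ge0 ?subr_ge0// mulr_ge0// mulr_ge0// ltW.
pose q := sobolev_exponent Q p.
have q1 : 1 <= q.
  rewrite /q /sobolev_exponent ler_pdivlMr// mul1r lerBlDr.
  have : Q <= p * Q by rewrite ler_peMl ?(ltW Q0)// ltW.
  by move=> h; rewrite ler_wpDr// ltW.
have sE : s = (1 + 2 * b) * q.
  rewrite hs /b /q /sobolev_exponent; field.
  by rewrite !gt_eqF.
(* The power of the test function that Hoelder's inequality asks for is exactly
   the one that the Sobolev inequality controls. *)
have sgq : (1 + (p - 1) * b / (b + 2^-1)) / q = 1 - m^-1.
  rewrite /b /q /sobolev_exponent; field.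
  have -> : m * (Q * (p - 1) + p) - p * Q + p * (Q - m * p) = m * ((p - 1) * (Q - p)) by ring.
  by rewrite !gt_eqF// !mulr_gt0// subr_gt0.
split.
  rewrite hs /sobolev_exponent; field.
  have -> : Q * (Q - m) - m * Q * (p - 1) = Q * (Q - m * p) by ring.
  by rewrite !gt_eqF// mulr_gt0.
exists (fun Sp => ((4 * Sp) `^ p * (1 + 2 * b) `^ p / alpha) `^ (p - 1)^-1).
move=> N d X Omega N2 _ oO bO SA; split.
  by apply: sobolev_constant_exists => //; [exact: ltnW|rewrite p1].
move=> Sp [Sp0 HSp] beta h a f u _ OA fm [G uG weak].
rewrite sE.
apply: (@weak_solution_estimate _ _ _ X Omega (open_measurableN oO) (sa_lipschitz SA)
  (bounded_lty bO) p q m b alpha Sp p1 q1 m1 b0 halpha Sp0 sgq _ a f u G).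
- by move=> w H; exact: HSp.
- exact: oa_coercive OA.
- exact: fm.
- exact: uG.
- exact: weak.
Qed.
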